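(* Assume that there are an open set $\mathbb{W}\subset\mathbb{C}$ (bounded) containing $I_\delta$ and a function $\Phi\in\mathcal{B}\cap\mathcal{X}_0$ such that $p_0(\Phi)$ is a fixed point of $\mathcal{R}_\delta$ and such that, with $a:=\Phi(1)$, the closures of both $a\mathbb{W}$ and $p_0(\Phi)(a\mathbb{W})$ are contained in $\mathbb{W}$. Let $\omega\in\mathbb{T}$. Then there exists an open neighborhood $U\subset\mathcal{D}(\mathcal{T})\cap\mathcal{B}$ of $\Phi$ (in the topology of $\mathcal{D}(\mathcal{T})\cap\mathcal{B}$ induced by $\mathcal{B}$) such that $\mathcal{T}_\omega:U\to\mathcal{B}$ is well defined, and $\mathcal{T}_\omega$ is Fréchet differentiable at any $\Psi\in U$, with derivative in the direction $h$ equal to $$\begin{aligned}[D\mathcal{T}_\omega(\Psi,h)](\theta,x)=&\ \frac1a(\partial_x\Psi)(\theta+\omega,\Psi(\theta,ax))\,h(\theta,ax)+\frac1ah(\theta+\omega,\Psi(\theta,ax))\\&+\frac ba(\partial_x\Psi)(\theta+\omega,\Psi(\theta,ax))\,(\partial_x\Psi)(\theta,ax)\,x-\frac b{a^2}\Psi(\theta+\omega,\Psi(\theta,ax)),\end{aligned}$$ where now $a=\int_0^1\Psi(\theta,1)\,d\theta$ and $b=\int_0^1h(\theta,1)\,d\theta$.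
   Context: $\mathbb{T}=\mathbb{R}/\mathbb{Z}$; $\delta>0$ is a fixed small number; $I_\delta=[-1-\delta,1+\delta]$; $r\ge1$ is fixed. $\mathcal{M}_\delta$ is the set of continuously differentiable even maps $\psi:I_\delta\to I_\delta$ with $\psi(0)=1$ and $x\psi'(x)<0$ for $x\neq0$. With $a=\psi(1)$, $a'=(1+\delta)a$, $b'=\psi(a')$, $\mathcal{D}(\mathcal{R}_\delta)$ consists of those $\psi\in\mathcal{M}_\delta$ with $a<0$, $1>b'>-a'$, $\psi(b')<-a'$; $\mathcal{R}_\delta(\psi)(x)=\frac1a\psi(\psi(ax))$ on $\mathcal{D}(\mathcal{R}_\delta)$. $p_0(f)(x)=\int_0^1f(\theta,x)\,d\theta$; $\mathcal{X}=\{f\in C^r(\mathbb{T}\times I_\delta,I_\delta):p_0(f)\in\mathcal{M}_\delta\}$; $\mathcal{X}_0=\{f\in\mathcal{X}:p_0(f)=f\}$. For $\omega\in\mathbb{T}$, $[\mathcal{T}_\omega(g)](\theta,x)=\frac1{\hat a}g(\theta+\omega,g(\theta,\hat ax))$, $\hat a=\int_0^1g(\theta,1)\,d\theta$; $\mathcal{D}(\mathcal{T})=\{g\in\mathcal{X}:\mathcal{T}_\omega(g)\in\mathcal{X}\}$. $\mathbb{B}_\rho=\{z\in\mathbb{C}:|\mathrm{Im}\,z|<\rho\}$ for a fixed $\rho>0$. $\mathcal{B}=\mathcal{B}(\mathbb{B}_\rho,\mathbb{W})$ is the Banach space, with the supremum norm on $\mathbb{B}_\rho\times\mathbb{W}$,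 of functions $f:\mathbb{B}_\rho\times\mathbb{W}\to\mathbb{C}$ holomorphic in $\mathbb{B}_\rho\times\mathbb{W}$, continuous on the closure, real on real arguments, and $1$-periodic in the first variable. A function of $\mathcal{B}$ is in $\mathcal{X}$, $\mathcal{X}_0$ or $\mathcal{D}(\mathcal{T})$ if its restriction to $\mathbb{T}\times I_\delta$ is. Since $\mathcal{D}(\mathcal{T})\cap\mathcal{B}$ is not open in $\mathcal{B}$, Fréchet differentiability at $\Psi\in U$ means: the bounded linear operator $h\mapsto D\mathcal{T}_\omega(\Psi,h)$ on $\mathcal{B}$ satisfies $\|\mathcal{T}_\omega(\Psi+h)-\mathcal{T}_\omega(\Psi)-D\mathcal{T}_\omega(\Psi,h)\|=o(\|h\|)$ as $h\to0$ in $\mathcal{B}$, where $\mathcal{T}_\omega(\Psi+h)$ is given by $[\mathcal{T}_\omega(\Psi+h)](\theta,x)=\frac1{\hat a}(\Psi+h)(\theta+\omega,(\Psi+h)(\theta,\hat ax))$ with $\hat a=\int_0^1(\Psi+h)(\theta,1)\,d\theta$.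
   Formalization: If W is disconnected, it is additionally assumed that Φ(θ,x)=p_0(Φ)(x) on the components of W other than the one containing I_δ; without this Φ(θ,ax) may leave W and the claim fails. For connected W nothing is added. *)

(* Defs.v *)
From HB Require Import structures.
From mathcomp Require Import all_boot all_order all_algebra.
From mathcomp Require Import all_classical all_reals all_analysis.
From mathcomp Require Import complex.

Set Implicit Arguments.
Unset Strict Implicit.
Unset Printing Implicit Defensive.
Import Order.TTheory GRing.Theory Num.Theory.
Import numFieldNormedType.Exports.
Local Open Scope classical_set_scope.
Local Open Scope ring_scope.

(* The complex numbers as a normed module over themselves: the topology and
   the complex differential calculus are only attached to the regular module. *)
Notation Cplx R := (R[i]^o).
Notation "x %:CC" := (real_complex _ x : Cplx _)
  (at level 1, left associativity, format "x %:CC") : ring_scope.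

(** * Real setting.

   Maps on I_delta are represented by total functions R -> R of which only the
   restriction to I_delta matters, and maps on T x I_delta (T = R/Z) by total
   functions R -> R -> R, 1-periodic in the first variable, of which only the
   restriction to R x I_delta matters. *)

Section RealSetting.
Variable R : realType.
Implicit Types (delta omega a x l : R) (psi : R -> R) (f g : R -> R -> R).

Definition Idelta delta : set R := `[- 1 - delta, 1 + delta]%classic.

(* derivative relative to A, hence one-sided at the end points of an interval *)
Definition has_derivative_within (A : set R) psi x l : Prop :=
  (psi y - psi x) / (y - x) @[y --> within A x^'] --> l.

Definition inM delta psi : Prop :=
  [/\ forall x, Idelta delta x -> Idelta delta (psi x),
      forall x, Idelta delta x -> psi (- x) = psi x,
      psi 0 = 1 &
      exists dpsi : R -> R,
        [/\ forall x, Idelta delta x ->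
              has_derivative_within (Idelta delta) psi x (dpsi x),
            {within Idelta delta, continuous dpsi} &
            forall x, Idelta delta x -> x != 0 -> x * dpsi x < 0]].

Definition inDR delta psi : Prop :=
  let a := psi 1 in
  let a' := (1 + delta) * a in
  let b' := psi a' in
  [/\ inM delta psi, a < 0, - a' < b' < 1 & psi b' < - a'].

Definition renorm psi : R -> R := fun x => (psi 1)^-1 * psi (psi (psi 1 * x)).

Definition renorm_fixed_point delta psi : Prop :=
  inDR delta psi /\ forall x, Idelta delta x -> renorm psi x = psi x.

Definition p0 f : R -> R :=
  fun x => \int[lebesgue_measure]_(theta in `[0, 1]) f theta x.

Fixpoint class_C delta (k : nat) f : Prop :=
  {within [set z : R * R | Idelta delta z.2],
     continuous (fun z : R * R => f z.1 z.2)} /\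
  if k is k'.+1 then
    exists f1 f2 : R -> R -> R,
      [/\ forall theta x, Idelta delta x ->
            is_derive theta (1 : R) (fun t => f t x) (f1 theta x),
          forall theta x, Idelta delta x ->
            has_derivative_within (Idelta delta) (f theta) x (f2 theta x),
          class_C delta k' f1 &
          class_C delta k' f2]
  else True.

Definition inX delta (r : nat) f : Prop :=
  [/\ forall theta x, Idelta delta x -> f (theta + 1) x = f theta x,
      forall theta x, Idelta delta x -> Idelta delta (f theta x),
      class_C delta r f &
      inM delta (p0 f)].

Definition inX0 delta (r : nat) f : Prop :=
  inX delta r f /\ forall theta x, Idelta delta x -> p0 f x = f theta x.

Definition T_real omega g : R -> R -> R := fun theta x =>
  let a := p0 g 1 in a^-1 * g (theta + omega) (g theta (a * x)).

(* The first two conditions say that the formula defining T_omega(g) makes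
   sense on T x I_delta. *)
Definition inDT delta (r : nat) omega g : Prop :=
  [/\ inX delta r g,
      p0 g 1 != 0,
      forall x, Idelta delta x -> Idelta delta (p0 g 1 * x) &
      inX delta r (T_real omega g)].

End RealSetting.

(** * Complex setting.

   An element of the space B(B_rho, W) is represented by a total function on
   C x C; only its values on the closure of B_rho x W matter. *)

Section ComplexSetting.
Variables (R : realType) (rho : R) (W : set (Cplx R)).
Local Notation C := (Cplx R).
Implicit Types (f g h Psi : C * C -> C) (x : C) (omega : R).

Definition strip : set C := [set z : C | `|complex.Im z| < rho].

Definition inB f : Prop :=
  [/\ forall z, (strip `*` W) z -> differentiable f z,
      {within closure (strip `*` W), continuous f},
      forall theta x : R, W x%:CC -> complex.Im (f (theta%:CC, x%:CC)) = 0 &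
      forall theta x : C, strip theta -> W x ->
        f (theta + 1, x) = f (theta, x)].

Definition normB f : \bar R :=
  ereal_sup [set (Normc.normc (f z))%:E | z in strip `*` W].

Definition restr f : R -> R -> R :=
  fun theta x : R => complex.Re (f (theta%:CC, x%:CC)).

Definition p0C f : C -> C := fun x =>
  Complex
    (\int[lebesgue_measure]_(theta in `[0, 1])
       complex.Re (f (theta%:CC, x)))
    (\int[lebesgue_measure]_(theta in `[0, 1])
       complex.Im (f (theta%:CC, x))).

Definition dx f : C * C -> C := fun z => derive1 (fun y : C => f (z.1, y)) z.2.

Definition T_op omega g : C * C -> C := fun z =>
  let a := p0C g 1 in a^-1 * g (z.1 + omega%:CC, g (z.1, a * z.2)).

(* The formula defining T_omega(g) makes sense on B_rho x W, and its value is
   again in B. *)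
Definition T_defined omega g : Prop :=
  [/\ p0C g 1 != 0,
      forall x, W x -> W (p0C g 1 * x),
      forall theta x, strip theta -> W x -> W (g (theta, p0C g 1 * x)) &
      inB (T_op omega g)].

Definition DT omega Psi h : C * C -> C := fun z =>
  let a := p0C Psi 1 in
  let b := p0C h 1 in
  let: (theta, x) := z in
  let y := Psi (theta, a * x) in
  a^-1 * dx Psi (theta + omega%:CC, y) * h (theta, a * x)
  + a^-1 * h (theta + omega%:CC, y)
  + b / a * dx Psi (theta + omega%:CC, y) * dx Psi (theta, a * x) * x
  - b / a ^+ 2 * Psi (theta + omega%:CC, y).

(* B is a real Banach space, because of the condition "real on real
   arguments". *)
Definition bounded_linear_B (L : (C * C -> C) -> C * C -> C) : Prop :=
  [/\ forall h, inB h -> inB (L h),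
      forall (c : R) h k, inB h -> inB k -> forall z, (strip `*` W) z ->
        L (fun w => c%:CC * h w + k w) z = c%:CC * L h z + L k z &
      exists M : R, forall h, inB h -> (normB (L h) <= M%:E * normB h)%E].

Definition frechet_derivative_T omega Psi (L : (C * C -> C) -> C * C -> C)
    : Prop :=
  bounded_linear_B L /\
  forall e : R, 0 < e -> exists2 eta : R, 0 < eta &
    forall h, inB h -> (normB h < eta%:E)%E ->
      T_defined omega (Psi + h) /\
      (normB (fun z => T_op omega (Psi + h) z - T_op omega Psi z - L h z)%R
         <= e%:E * normB h)%E.

End ComplexSetting.

(* Main.v *)
Require Import Defs.
From HB Require Import structures.
From mathcomp Require Import all_boot all_order all_algebra.
From mathcomp Require Import all_classical all_reals all_analysis.
From mathcomp Require Import complex.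
From mathcomp Require Import ring lra.
Import Order.TTheory GRing.Theory Num.Theory.
Import numFieldNormedType.Exports.
Local Open Scope classical_set_scope.
Local Open Scope ring_scope.
Set Implicit Arguments.
Unset Strict Implicit.
Unset Printing Implicit Defensive.

(** The operator T composes g with itself, so its derivative loses one derivative
    in x: the statement says that on holomorphic functions this loss is harmless,
    because Cauchy's integral formula bounds derivatives by the sup norm at every
    point that keeps a fixed distance to the complement of W.

    Such a distance exists. The closures of a W and of p_0(Phi)(a W) are compact
    subsets of the open set W, so a whole eps-neighbourhood of both stays in W
    ([uniform_margin]). By the identity theorem Phi(theta, x) does not depend on
    theta ([Phi_fibered]), hence the second closure controls all the values
    Phi(theta, a x). The resulting property [margin] persists under small
    perturbations of Phi in B ([margin_stable]); U is the trace on D(T) of a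
    small ball about Phi. The function Phi itself lies in D(T), because a fixed
    point of the renormalization operator is reproduced by T
    ([inDT_fixed_point]).

    With a margin eps, expand T(Psi + h) around the two evaluation points a x
    and Psi(theta, a x). The first order part is DT(Psi, h), and what is left
    consists of Taylor remainders of Psi of order two and of h of order one. By
    the Cauchy estimates ([taylor1], [lipschitz1]) all of them are bounded by a
    constant times the square of the norm of h ([T_remainder], [T_frechet]).

    It remains to see that DT(Psi, h) belongs to B, that is, that the x-derivative
    of Psi is holomorphic in both variables and continuous up to the edges
    |Im theta| = rho, where Psi is only known to be continuous. Cauchy's formula
    in x passes to the limit in theta ([slice_cauchy]), which gives holomorphy in x
    and continuity of the derivative on the edges ([dx_continuous]); in the interior
    one differentiates under the integral sign ([dx_differentiable]).

    Cauchy's formula is derived from pointwise differentiability. A circle about p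
    is moved to a small circle about w through circles avoiding w; the form
    f(z) dz / (z - w), pulled back to the rectangle of the parameters, has integral
    zero over its boundary by Goursat's bisection argument ([goursat]), and the
    integral over the small circle tends to f(w) ([cauchy_formula]). The identity
    theorem follows: if zeros of f cluster at p, then f(w) = (w - p)^n g_n(w) for all
    n, with g_n the Cauchy transform of f(z) / (z - p)^n, and the bound on g_n forces
    f to vanish near p ([vanish_of_cluster_zero]). *)

(** The modulus with values in R rather than in R[i], so that estimates take
    place in a totally ordered field. *)
Notation nc := (@Normc.normc _).
Notation Rep := (@complex.Re _).
Notation Imp := (@complex.Im _).

(** * Modulus and topology of the complex plane *)

Section Modulus.
Variable R : realType.
Local Notation C := (Cplx R).
Implicit Types (z w : C).

Lemma ncE z : `|z| = (nc z)%:C%C :> C. Proof. by []. Qed.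

Lemma nc_ge0 z : 0 <= nc z. Proof. by case: z => a b; exact: sqrtr_ge0. Qed.
Lemma nc0 : nc (0 : C) = 0. Proof. by rewrite Normc.normc0. Qed.
Lemma nc1 : nc (1 : C) = 1. Proof. by rewrite Normc.normc1. Qed.
Lemma nc_eq0 z : (nc z == 0) = (z == 0).
Proof.
apply/eqP/eqP => [/Normc.eq0_normc//|->]; exact: nc0.
Qed.
Lemma nc_gt0 z : (0 < nc z) = (z != 0).
Proof. by rewrite lt_def nc_eq0 nc_ge0 andbT. Qed.
Lemma ncM z w : nc (z * w) = nc z * nc w. Proof. exact: Normc.normcM. Qed.
Lemma ncV z : nc z^-1 = (nc z)^-1. Proof. exact: Normc.normcV. Qed.
Lemma ncX z n : nc (z ^+ n) = nc z ^+ n.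
Proof. by elim: n => [|n ih]; rewrite ?nc1// !exprS ncM ih. Qed.
Lemma ncN z : nc (- z) = nc z. Proof. exact: normcN. Qed.
Lemma ncD z w : nc (z + w) <= nc z + nc w. Proof. exact: le_normcD. Qed.
Lemma ncB z w : nc (z - w) <= nc z + nc w. Proof. by rewrite -(ncN w) ncD. Qed.
Lemma ncC z w : nc (z - w) = nc (w - z). Proof. by rewrite -ncN opprB. Qed.
Lemma ncBD u z w : nc (z - w) <= nc (z - u) + nc (u - w).
Proof. by rewrite -(subrKA u z) ncD. Qed.
Lemma nc_Re z : `|Rep z| <= nc z.
Proof.
case: z => a b /=; rewrite -sqrtr_sqr ler_sqrt ?addr_ge0 ?sqr_ge0//.
by rewrite lerDl sqr_ge0.
Qed.
Lemma nc_Im z : `|Imp z| <= nc z.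
Proof.
case: z => a b /=; rewrite -sqrtr_sqr ler_sqrt ?addr_ge0 ?sqr_ge0//.
by rewrite lerDr sqr_ge0.
Qed.
Lemma nc_real (x : R) : nc (x%:CC : C) = `|x|.
Proof. by rewrite /= expr0n/= addr0 sqrtr_sqr. Qed.
Lemma nc_le z : nc z <= `|Rep z| + `|Imp z|.
Proof.
case: z => a b /=; rewrite -[leRHS]ger0_norm ?addr_ge0// -sqrtr_sqr.
rewrite ler_sqrt ?sqr_ge0// -(real_normK (num_real a)) -(real_normK (num_real b)).
have := normr_ge0 a; have := normr_ge0 b; nra.
Qed.

Lemma nbhs_ncP z (A : set C) :
  nbhs z A <-> exists2 e : R, 0 < e & forall y, nc (y - z) < e -> A y.
Proof.
split=> [/nbhs_ballP[e /= e0 he]|[e e0 he]].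
  have er : e = (Rep e)%:C%C by rewrite RRe_real ?gtr0_real.
  exists (Rep e); first by move: e0; rewrite er ltcR.
  move=> y hy; apply: he; rewrite -ball_normE/= distrC ncE er ltcR; exact: hy.
apply/nbhs_ballP; exists (e%:C%C) => /=; first by rewrite ltcR.
by move=> y; rewrite -ball_normE/= distrC ncE ltcR => /he.
Qed.

Lemma cvg_ncP (T : Type) (F : set_system T) (f : T -> C) (l : C) : Filter F ->
  (f @ F --> l) <-> (forall e : R, 0 < e -> \forall x \near F, nc (f x - l) < e).
Proof.
move=> FF; split=> [h e e0|h A /nbhs_ncP[e e0 he]].
  by apply: (h (fun y => nc (y - l) < e)); apply/nbhs_ncP; exists e.
rewrite /nbhs/=; near=> x; apply: he; near: x; exact: h.
Unshelve. all: by end_near. Qed.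

Lemma continuous_Re : continuous (Rep : C -> R).
Proof.
move=> z; apply/(@cvgrPdist_lt _ _ _ (nbhs z)) => e e0; apply/nbhs_ncP; exists e => // y.
by move=> hy; apply: le_lt_trans hy; rewrite distrC -raddfB nc_Re.
Qed.

Lemma continuous_Im : continuous (Imp : C -> R).
Proof.
move=> z; apply/(@cvgrPdist_lt _ _ _ (nbhs z)) => e e0; apply/nbhs_ncP; exists e => // y.
by move=> hy; apply: le_lt_trans hy; rewrite distrC -raddfB nc_Im.
Qed.

Lemma cvg_Complex (T : Type) (F : set_system T) (f g : T -> R) (a b : R) :
  Filter F -> f @ F --> a -> g @ F --> b ->
  (fun t => Complex (f t) (g t) : C) @ F --> (Complex a b : C).
Proof.
move=> FF fa gb; apply/cvg_ncP => e e0.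
move/cvgrPdist_lt : fa => /(_ (e / 2)) fa; move/cvgrPdist_lt : gb => /(_ (e / 2)) gb.
near=> t; apply: (le_lt_trans (nc_le _)); rewrite /= (splitr e) ltrD//.
  by rewrite distrC; near: t; apply: fa; rewrite divr_gt0.
by rewrite distrC; near: t; apply: gb; rewrite divr_gt0.
Unshelve. all: by end_near. Qed.

Lemma continuous_real_complex : continuous (fun x : R => x%:CC : C).
Proof. by move=> x; apply: cvg_Complex; [exact: cvg_id|exact: cvg_cst]. Qed.

End Modulus.

(** * Complex differentiability by estimates *)

Section Deriv.
Variable R : realType.
Local Notation C := (Cplx R).

Lemma shift_littleo (V : normedModType R[i]) (f : V -> C) (L : {linear V -> C}) x :
  (forall e : R, 0 < e ->
     \forall k \near (0 : V), (nc (f (k + x) - f x - L k : C))%:C%C <= e%:C%C * `|k|) ->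
  f \o shift x = cst (f x) + L +o_ 0 id.
Proof.
move=> h; apply/eqaddoP => e e_gt0.
have er : e = (Rep e)%:C%C by rewrite RRe_real ?gtr0_real.
have e0 : 0 < Rep e by rewrite -(ltcR 0) -er.
near=> k; rewrite er.
have -> : (f \o shift x - (cst (f x) + L)) k = f (k + x) - f x - L k.
  by rewrite /= ?fctE opprD addrA.
by near: k; exact: h.
Unshelve. all: by end_near. Qed.

Lemma differentiable_eps (V : normedModType R[i]) (f : V -> C) (L : {linear V -> C}) x :
  continuous L ->
  (forall e : R, 0 < e ->
     \forall k \near (0 : V), (nc (f (k + x) - f x - L k : C))%:C%C <= e%:C%C * `|k|) ->
  differentiable f x /\ 'd f x = L :> (V -> C).
Proof.
move=> cL /shift_littleo E; have dE := diff_unique cL E.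
by split; [apply/diff_locallyP; rewrite dE; split|exact: dE].
Qed.

(** The estimate determines the derivative, so the same criterion also computes it. *)
Lemma differentiable1_eps (f : C -> C) z d :
  (forall e : R, 0 < e -> exists2 dl : R, 0 < dl &
     forall k : C, nc k < dl -> nc (f (z + k) - f z - d * k) <= e * nc k) ->
  differentiable f z /\ f^`()%classic z = d.
Proof.
move=> h.
have lin_d : linear (fun k : C => d * k : C).
  by move=> c u v; rewrite mulrDr /GRing.scale/= mulrCA.
pose dM := GRing.isLinear.Build _ _ _ _ _ lin_d.
pose L : {linear C -> C} := HB.pack (fun k : C => d * k : C) dM.
have cL : continuous L.
  by move=> k; apply: (@cvgM _ _ (nbhs k) _ (cst d) id); [exact: cvg_cst|exact: cvg_id].
have h' : forall e : R, 0 < e -> \forall k \near (0 : C),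
   (nc (f (k + z) - f z - L k : C))%:C%C <= e%:C%C * `|k|.
  move=> e /h[dl dl0 hdl]; apply/nbhs_ncP; exists dl => // k.
  rewrite subr0 => /hdl; rewrite (addrC z) ncE -(rmorphM (real_complex R)) lecR => hk.
  exact hk.
have [df E] := differentiable_eps cL h'; split => //.
by rewrite derive1E' // E /= mulr1.
Qed.

Lemma differentiable1_epsP (f : C -> C) z : differentiable f z ->
  forall e : R, 0 < e -> exists2 dl : R, 0 < dl &
     forall k : C, nc k < dl -> nc (f (z + k) - f z - f^`()%classic z * k) <= e * nc k.
Proof.
move=> df e e0.
have /diff_locally/eqaddoP := df.
have ec0 : 0 < e%:C%C by rewrite ltcR.
move=> /(_ _ ec0) /nbhs_ncP[dl dl0 h]; exists dl => // k kdl.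
have := h k; rewrite subr0 => /(_ kdl).
rewrite -[X in `|X|]/((f \o shift z) k - (f z + 'd f z k)).
rewrite (diff1E df) opprD addrA /= ncE -(rmorphM (real_complex R)) lecR.
by rewrite (addrC z) -[k *: _]/(k * _) (mulrC k).
Qed.

Lemma differentiable2_eps (f : C * C -> C) z (d1 d2 : C) :
  (forall e : R, 0 < e -> exists2 dl : R, 0 < dl &
     forall k1 k2 : C, nc k1 < dl -> nc k2 < dl ->
      nc (f (z.1 + k1, z.2 + k2) - f z - (d1 * k1 + d2 * k2)) <= e * (nc k1 + nc k2)) ->
  differentiable f z.
Proof.
move=> h.
have lin_d : linear (fun k : C * C => d1 * k.1 + d2 * k.2 : C).
  move=> c u v; rewrite /GRing.scale/=.
  set c' : C := c; set a1 : C := u.1; set a2 : C := u.2.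
  set b1 : C := v.1; set b2 : C := v.2.
  suff : d1 * (c' * a1 + b1) + d2 * (c' * a2 + b2) =
    c' * (d1 * a1 + d2 * a2) + (d1 * b1 + d2 * b2) by [].
  by ring.
pose dM := GRing.isLinear.Build _ _ _ _ _ lin_d.
pose L : {linear (C * C)%type -> C} := HB.pack (fun k : C * C => d1 * k.1 + d2 * k.2 : C) dM.
have cL : continuous L.
  move=> k; apply: (@cvgD _ _ _ (nbhs k) _ (fun k => d1 * k.1) (fun k => d2 * k.2)).
    by apply: (@cvgM _ _ (nbhs k) _ (cst d1) fst); [exact: cvg_cst|exact: cvg_fst].
  by apply: (@cvgM _ _ (nbhs k) _ (cst d2) snd); [exact: cvg_cst|exact: cvg_snd].
apply: (proj1 (differentiable_eps cL _)) => e e0.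
have e20 : 0 < e / 2 by rewrite divr_gt0.
have [dl dl0 hdl] := h _ e20.
apply/nbhs_ballP; exists (dl%:C%C) => /=; first by rewrite ltcR.
move=> [k1 k2]; rewrite -ball_normE /= sub0r normrN prod_normE /=.
rewrite !ncE.
have -> : Num.max (nc k1)%:C%C (nc k2)%:C%C = (Num.max (nc k1) (nc k2))%:C%C :> R[i].
  by rewrite !maxEle lecR; case: (_ <= _).
rewrite ltcR -(rmorphM (real_complex R)) lecR gt_max => /andP[k1d k2d].
have := hdl _ _ k1d k2d; case: z {h hdl} => [z1 z2] /= hz.
rewrite -[(k1, k2) + (z1, z2)]/(k1 + z1, k2 + z2) (addrC k1) (addrC k2).
apply: (le_trans hz); rewrite -mulrA ler_pM2l//.
have : nc k1 <= Num.max (nc k1) (nc k2) by rewrite le_max lexx.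
have : nc k2 <= Num.max (nc k1) (nc k2) by rewrite le_max lexx orbT.
by set m := Num.max _ _; lra.
Qed.

End Deriv.

(** * Integrals of complex paths *)

Section Within.
Variables (R : realType) (T : topologicalType).
Local Notation C := (Cplx R).

Lemma withinP (S : topologicalType) (A : set T) (u : T -> S) :
  {within A, continuous u} <-> forall x, A x -> u @ within A (nbhs x) --> u x.
Proof. exact: subspace_continuousP. Qed.

Lemma within_comp (S S' : topologicalType) (A : set T) (u : T -> S) (g : S -> S') :
  {within A, continuous u} -> (forall x, A x -> {for u x, continuous g}) ->
  {within A, continuous (fun x => g (u x))}.
Proof.
move=> /withinP cu cg; apply/withinP => x Ax.
by apply: (cvg_comp u g (cu x Ax)); exact: cg.
Qed.

Lemma withinM (A : set T) (u v : T -> C) :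
  {within A, continuous u} -> {within A, continuous v} ->
  {within A, continuous (fun x => u x * v x)}.
Proof.
move=> /withinP cu /withinP cv.
by apply/withinP => x Ax; apply: cvgM; [exact: cu|exact: cv].
Qed.

Lemma withinD (A : set T) (u v : T -> C) :
  {within A, continuous u} -> {within A, continuous v} ->
  {within A, continuous (fun x => u x + v x)}.
Proof.
move=> /withinP cu /withinP cv.
by apply/withinP => x Ax; apply: cvgD; [exact: cu|exact: cv].
Qed.

Lemma withinB (A : set T) (u v : T -> C) :
  {within A, continuous u} -> {within A, continuous v} ->
  {within A, continuous (fun x => u x - v x)}.
Proof.
move=> /withinP cu /withinP cv.
by apply/withinP => x Ax; apply: cvgB; [exact: cu|exact: cv].
Qed.

Lemma within_cst (S : topologicalType) (A : set T) (k : S) :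
  {within A, continuous (fun=> k)}.
Proof. by apply/withinP => x Ax; exact: cvg_cst. Qed.

Lemma within_at (S : topologicalType) (A : set T) (u : T -> S) :
  (forall x, A x -> {for x, continuous u}) -> {within A, continuous u}.
Proof.
move=> cu; apply/withinP => x Ax.
by apply: cvg_within_filter; exact: cu.
Qed.

End Within.

Section PathIntegral.
Variable R : realType.
Local Notation C := (Cplx R).
Local Notation mu := (@lebesgue_measure R).
Implicit Types (a b c t : R) (u v U : R -> C).

(** The real and imaginary parts are integrated separately: this is the shape of
    [p0C], which thus is such an integral along the real axis. *)
Definition pathint a b u : C :=
  Complex (\int[mu]_(t in `[a, b]) Rep (u t)) (\int[mu]_(t in `[a, b]) Imp (u t)).

Lemma integrable_seg a b (f : R -> R) : {within `[a, b], continuous f} ->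
  mu.-integrable `[a, b] (EFin \o f).
Proof.
by move=> cf; apply: continuous_compact_integrable => //; exact: segment_compact.
Qed.

Lemma within_Re a b u : {within `[a, b], continuous u} ->
  {within `[a, b], continuous (fun t => Rep (u t))}.
Proof. by move=> cu; exact: (within_comp cu (fun x _ => @continuous_Re R (u x))). Qed.

Lemma within_Im a b u : {within `[a, b], continuous u} ->
  {within `[a, b], continuous (fun t => Imp (u t))}.
Proof. by move=> cu; exact: (within_comp cu (fun x _ => @continuous_Im R (u x))). Qed.

Lemma Rintegral_cat a b c (f : R -> R) : a <= c -> c <= b ->
  {within `[a, b], continuous f} ->
  \int[mu]_(t in `[a, b]) f t =
  \int[mu]_(t in `[a, c]) f t + \int[mu]_(t in `[c, b]) f t.
Proof.
move=> ac cb cf.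
have := @Rintegral_itvB _ f (BLeft a) (BRight b) c (integrable_seg cf).
rewrite !bnd_simp => /(_ ac cb).
rewrite Rintegral_itv_obnd_cbnd.
  by move=> <-; rewrite addrC subrK.
apply: integrableS (integrable_seg cf) => //.
by apply: subset_itv; rewrite bnd_simp.
Qed.

Lemma pathint_cat a b c u : a <= c -> c <= b -> {within `[a, b], continuous u} ->
  pathint a b u = pathint a c u + pathint c b u.
Proof.
move=> ac cb cu; rewrite /pathint (Rintegral_cat ac cb (within_Re cu)).
by rewrite (Rintegral_cat ac cb (within_Im cu)).
Qed.

Lemma pathintZ a b (k : C) u : {within `[a, b], continuous u} ->
  pathint a b (fun t => k * u t) = k * pathint a b u.
Proof.
move=> cu.
have iR := integrable_seg (within_Re cu); have iI := integrable_seg (within_Im cu).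
case: k => k1 k2; rewrite /pathint.
have iZ (r : R) (f : R -> R) : mu.-integrable `[a, b] (EFin \o f) ->
    mu.-integrable `[a, b] (EFin \o (fun t => r * f t)).
  by move=> fi; have := integrableZl _ r fi; exact.
congr Complex.
  rewrite -!RintegralZl// -RintegralB//; [|exact: iZ|exact: iZ].
  by apply: eq_Rintegral => t _ /=; case: (u t).
rewrite -!RintegralZl// -RintegralD//; [|exact: iZ|exact: iZ].
by apply: eq_Rintegral => t _ /=; case: (u t).
Qed.

Lemma pathintD a b u v : {within `[a, b], continuous u} ->
  {within `[a, b], continuous v} ->
  pathint a b (fun t => u t + v t) = pathint a b u + pathint a b v.
Proof.
move=> cu cv; rewrite /pathint.
have uR := integrable_seg (within_Re cu); have uI := integrable_seg (within_Im cu).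
have vR := integrable_seg (within_Re cv); have vI := integrable_seg (within_Im cv).
congr Complex.
  by rewrite -RintegralD//; apply: eq_Rintegral => t _ /=; case: (u t); case: (v t).
by rewrite -RintegralD//; apply: eq_Rintegral => t _ /=; case: (u t); case: (v t).
Qed.

Lemma eq_pathint a b u v : (forall t, a <= t <= b -> u t = v t) ->
  pathint a b u = pathint a b v.
Proof.
by move=> uv; rewrite /pathint; congr Complex; apply: eq_Rintegral => t;
  rewrite inE/= in_itv/= => /uv ->.
Qed.

Lemma pathintB a b u v : {within `[a, b], continuous u} ->
  {within `[a, b], continuous v} ->
  pathint a b (fun t => u t - v t) = pathint a b u - pathint a b v.
Proof.
move=> cu cv.
have cNv : {within `[a, b], continuous (fun t => -1 * v t)}.
  by apply: withinM; [exact: within_cst|].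
have -> : pathint a b (fun t => u t - v t) = pathint a b (fun t => u t + -1 * v t).
  by apply: eq_pathint => t _; rewrite mulN1r.
by rewrite (pathintD cu cNv) (pathintZ _ cv) mulN1r.
Qed.

Lemma Rintegral_le a b (f : R -> R) (M : R) : a <= b ->
  {within `[a, b], continuous f} -> (forall t, a <= t <= b -> `|f t| <= M) ->
  `|\int[mu]_(t in `[a, b]) f t| <= M * (b - a).
Proof.
move=> ab cf fM.
have fi := integrable_seg cf.
have fine_mu : fine (mu `[a, b]%classic) = b - a.
  by rewrite lebesgue_measure_itv/= lte_fin; case: ltrgtP ab => //= -> _; rewrite subrr.
apply: (le_trans (le_normr_Rintegral _ fi)) => //.
rewrite -fine_mu -Rintegral_cst//; apply: le_Rintegral => //.
by have := integrable_norm fi; exact.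
by apply: integrable_seg; exact: within_cst.
Qed.

(** The factor 2 comes from bounding the real and imaginary parts separately. *)
Lemma pathint_le a b u (M : R) : a <= b ->
  {within `[a, b], continuous u} -> (forall t, a <= t <= b -> nc (u t) <= M) ->
  nc (pathint a b u) <= 2 * M * (b - a).
Proof.
move=> ab cu uM; apply: (le_trans (nc_le _)).
rewrite -mulrA mulr_natl mulr2n /= lerD//; apply: Rintegral_le => //.
- exact: within_Re.
- by move=> t /uM; exact: le_trans (nc_Re _).
- exact: within_Im.
- by move=> t /uM; exact: le_trans (nc_Im _).
Qed.

(** A path has a real variable and complex values, so its derivative is that of
    its two real components. *)
Definition path_derive U t (d : C) :=
  is_derive t 1 (fun s => Rep (U s)) (Rep d) /\
  is_derive t 1 (fun s => Imp (U s)) (Imp d).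

Lemma FTC_seg a b (f F : R -> R) : a <= b -> {within `[a, b], continuous f} ->
  (forall t, a <= t <= b -> is_derive t 1 F (f t)) ->
  \int[mu]_(t in `[a, b]) f t = F b - F a.
Proof.
rewrite le_eqVlt => /predU1P[->|ab] cf dF.
  by rewrite subrr set_itv1 Rintegral_set1.
rewrite /Rintegral (continuous_FTC2 ab cf (F := F))//.
  have cF t : a <= t <= b -> {for t, continuous F}.
    by move=> /dF[/derivable1_diffP/differentiable_continuous].
  split.
  - by move=> t; rewrite in_itv/= => /andP[at_ tb]; have [] := dF t _; rewrite ?ltW.
  - by apply: cvg_at_right_filter; apply: cF; rewrite lexx ltW.
  - by apply: cvg_at_left_filter; apply: cF; rewrite lexx ltW.
move=> t; rewrite in_itv/= => /andP[at_ tb].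
by rewrite derive1E; have [] := dF t _; rewrite ?ltW.
Qed.

Lemma pathint_FTC a b u U : a <= b -> {within `[a, b], continuous u} ->
  (forall t, a <= t <= b -> path_derive U t (u t)) ->
  pathint a b u = U b - U a.
Proof.
move=> ab cu dU; rewrite /pathint.
have ER := FTC_seg ab (within_Re cu) (fun t tab => (dU t tab).1).
have EI := FTC_seg ab (within_Im cu) (fun t tab => (dU t tab).2).
rewrite ER EI; by case: (U b) => b1 b2; case: (U a).
Qed.

Lemma path_derive_cst (k : C) t : path_derive (fun=> k) t 0.
Proof. by split; exact: is_derive_cst. Qed.

Lemma path_deriveD U V t d1 d2 : path_derive U t d1 -> path_derive V t d2 ->
  path_derive (fun s => U s + V s) t (d1 + d2).
Proof.
move=> [U1 U2] [V1 V2]; split.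
  have -> : (fun s => Rep (U s + V s)) = (fun s => Rep (U s)) + (fun s => Rep (V s)).
    by apply/funext => s /=; rewrite fctE; case: (U s); case: (V s).
  apply: (is_derive_eq (is_deriveD U1 V1)).
  by case: d1 {U1 U2} => a1 b1; case: d2 {V1 V2}.
have -> : (fun s => Imp (U s + V s)) = (fun s => Imp (U s)) + (fun s => Imp (V s)).
  by apply/funext => s /=; rewrite fctE; case: (U s); case: (V s).
apply: (is_derive_eq (is_deriveD U2 V2)).
by case: d1 {U1 U2} => a1 b1; case: d2 {V1 V2}.
Qed.

Lemma path_deriveM U V t d1 d2 : path_derive U t d1 -> path_derive V t d2 ->
  path_derive (fun s => U s * V s) t (d1 * V t + U t * d2).
Proof.
move=> [U1 U2] [V1 V2].
have dM (f g : R -> R) (df dg : R) : is_derive t 1 f df -> is_derive t 1 g dg ->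
    is_derive t 1 (f * g) (f t * dg + g t * df).
  by move=> ? ?; apply: is_derive_eq.
split.
  have -> : (fun s => Rep (U s * V s)) = (fun s => Rep (U s)) * (fun s => Rep (V s))
      - (fun s => Imp (U s)) * (fun s => Imp (V s)).
    by apply/funext => s /=; rewrite !fctE; case: (U s); case: (V s).
  apply: (is_derive_eq (is_deriveB (dM _ _ _ _ U1 V1) (dM _ _ _ _ U2 V2))).
  case: d1 {U1 U2} => a1 b1; case: d2 {V1 V2} => a2 b2.
  by case: (U t) => x1 y1; case: (V t) => x2 y2 /=; ring.
have -> : (fun s => Imp (U s * V s)) = (fun s => Rep (U s)) * (fun s => Imp (V s))
    + (fun s => Imp (U s)) * (fun s => Rep (V s)).
  by apply/funext => s /=; rewrite !fctE; case: (U s); case: (V s).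
apply: (is_derive_eq (is_deriveD (dM _ _ _ _ U1 V2) (dM _ _ _ _ U2 V1))).
case: d1 {U1 U2} => a1 b1; case: d2 {V1 V2} => a2 b2.
by case: (U t) => x1 y1; case: (V t) => x2 y2 /=; ring.
Qed.

Lemma path_derive_real t : path_derive (fun s => s%:CC) t 1.
Proof. split; [exact: (is_derive_id t 1)|exact: (is_derive_cst (0 : R) t 1)]. Qed.

Lemma path_deriveZ (k : C) U t d : path_derive U t d ->
  path_derive (fun s => k * U s) t (k * d).
Proof.
move=> dU; have := path_deriveM (path_derive_cst k t) dU.
by have -> : 0 * U t + k * d = k * d by rewrite mul0r add0r.
Qed.

Lemma pathint_cst a b (k : C) : a <= b -> pathint a b (fun=> k) = k * (b - a)%:CC.
Proof.
move=> ab; rewrite (pathint_FTC (U := fun t => k * t%:CC) ab).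
- by rewrite -mulrBr; congr (_ * _); rewrite -(rmorphB (real_complex R)).
- exact: within_cst.
- move=> t _; have := path_deriveZ k (path_derive_real t).
  by have -> : k * 1 = k by rewrite mulr1.
Qed.

(** Uniform convergence on the compact segment is what lets a limit be taken
    under the integral sign. *)
Lemma pathint_cvg (T : Type) (F : set_system T) a b (u : T -> R -> C) (v : R -> C) :
  Filter F -> a <= b ->
  (\forall x \near F, {within `[a, b], continuous u x}) ->
  {within `[a, b], continuous v} ->
  (forall t, a <= t <= b -> forall e, 0 < e ->
     \forall t' \near t & x \near F, a <= t' <= b -> nc (u x t' - v t') <= e) ->
  pathint a b (u x) @[x --> F] --> pathint a b v.
Proof.
move=> FF ab cu cv h; apply/cvg_ncP => e e0.
pose e' := e / (4 * (1 + (b - a))).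
have ba : 0 <= b - a by rewrite subr_ge0.
have e'0 : 0 < e' by rewrite /e' divr_gt0// mulr_gt0// ltr_wpDr.
have /near_covering_withinP := (@compact_near_coveringP R `[a, b]).1 (@segment_compact R a b).
move=> /(_ T F (fun x t => nc (u x t - v t) <= e') FF) H.
have {}H : \near F, `[a, b]%classic `<=` (fun t => nc (u F t - v t) <= e').
  apply: H => t; rewrite /= in_itv/= => /h /(_ _ e'0).
  by apply: filterS => -[t' x] /=; rewrite in_itv/=.
near=> x.
have cx : {within `[a, b], continuous u x} by near: x.
rewrite -(pathintB cx cv).
apply: (@le_lt_trans _ _ (2 * e' * (b - a))).
  apply: (pathint_le ab (withinB cx cv)) => t tab.
  have : `[a, b]%classic `<=` (fun t => nc (u x t - v t) <= e') by near: x; exact: H.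
  by apply; rewrite /= in_itv.
rewrite /e'; set d := b - a in ba *.
have d1 : 0 < 1 + d by lra.
rewrite mulrAC -subr_gt0.
have -> : e - 2 * d * (e / (4 * (1 + d))) = e * (2 + d) / (2 * (1 + d)).
  by field; rewrite gt_eqF.
by rewrite divr_gt0 ?mulr_gt0//; lra.
Unshelve. all: by end_near. Qed.

End PathIntegral.

(** * Goursat's theorem for pulled back forms *)

Section Bisection.
Variable R : realType.

Lemma nested_intervals (l : nat -> R) :
  (forall n, l n <= l n.+1 /\ l n.+1 + 2^-1 ^+ n.+1 <= l n + 2^-1 ^+ n) ->
  exists x, forall n, l n <= x <= l n + 2^-1 ^+ n.
Proof.
move=> H.
have pow0 n : 0 < (2^-1 : R) ^+ n by rewrite exprn_gt0// invr_gt0.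
have mono n m : l n <= l (n + m)%N /\ l (n + m)%N + 2^-1 ^+ (n + m) <= l n + 2^-1 ^+ n.
  elim: m => [|m [ih1 ih2]]; rewrite ?addn0 ?addnS//.
  by have [h1 h2] := H (n + m)%N; split; lra.
have ub n : ubound (range l) (l n + 2^-1 ^+ n).
  move=> _ [m _ <-]; have [mn|/ltnW nm] := leqP m n.
    have [] := mono m (n - m)%N; rewrite subnKC// => h _.
    by have := pow0 n; lra.
  have [_] := mono n (m - n)%N; rewrite subnKC// => h.
  by have := pow0 m; lra.
exists (sup (range l)) => n; apply/andP; split.
  by apply: ub_le_sup; [exists (l 0%N + 2^-1 ^+ 0); exact: ub|exists n].
by apply: ge_sup; [exists (l 0%N); exists 0%N|exact: ub].
Qed.

(** Starting from the unit square, any property inherited by one of the four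
    quarters singles out a point with arbitrarily small good squares around it. *)
Lemma bisection (P : R -> R -> R -> Prop) : P 0 0 1 ->
  (forall x y h, 0 < h -> P x y h -> exists x' y',
     [/\ x' = x \/ x' = x + h / 2, y' = y \/ y' = y + h / 2 & P x' y' (h / 2)]) ->
  exists x0 y0, forall n, exists x y,
    [/\ P x y (2^-1 ^+ n), x <= x0 <= x + 2^-1 ^+ n & y <= y0 <= y + 2^-1 ^+ n].
Proof.
move=> P0 step.
have pow0 n : 0 < (2^-1 : R) ^+ n by rewrite exprn_gt0// invr_gt0.
have /choice[F FP] (q : R * R * nat) : exists q' : R * R * nat,
    P q.1.1 q.1.2 (2^-1 ^+ q.2) ->
    [/\ q'.1.1 = q.1.1 \/ q'.1.1 = q.1.1 + 2^-1 ^+ q.2 / 2,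
        q'.1.2 = q.1.2 \/ q'.1.2 = q.1.2 + 2^-1 ^+ q.2 / 2,
        q'.2 = q.2.+1 & P q'.1.1 q'.1.2 (2^-1 ^+ q'.2)].
  have [h|h] := pselect (P q.1.1 q.1.2 (2^-1 ^+ q.2)); last by exists q.
  have [x' [y' [hx hy hP]]] := step _ _ _ (pow0 _) h.
  by exists (x', y', q.2.+1) => _; split => //=; rewrite exprSr.
pose q n := iter n F (0 : R, 0 : R, 0%N).
have qP n : (q n).2 = n /\ P (q n).1.1 (q n).1.2 (2^-1 ^+ n).
  elim: n => [|n [ih1 ih2]]; first by rewrite expr0.
  have := FP (q n); rewrite ih1 => /(_ ih2) [_ _].
  rewrite -[F (q n)]/(q n.+1) => e hP; split => //.
  by rewrite -[X in 2^-1 ^+ X]e.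
have qS n : ((q n.+1).1.1 = (q n).1.1 \/ (q n.+1).1.1 = (q n).1.1 + 2^-1 ^+ n / 2) /\
            ((q n.+1).1.2 = (q n).1.2 \/ (q n.+1).1.2 = (q n).1.2 + 2^-1 ^+ n / 2).
  have [e1 hP] := qP n.
  by have := FP (q n); rewrite e1 => /(_ hP) [].
have [x0 hx0] : exists x, forall n, (q n).1.1 <= x <= (q n).1.1 + 2^-1 ^+ n.
  apply: nested_intervals => n; have := pow0 n; rewrite exprSr.
  by have [[] -> _] := qS n; lra.
have [y0 hy0] : exists x, forall n, (q n).1.2 <= x <= (q n).1.2 + 2^-1 ^+ n.
  apply: nested_intervals => n; have := pow0 n; rewrite exprSr.
  by have [_ [] ->] := qS n; lra.
exists x0, y0 => n; exists (q n).1.1, (q n).1.2; split => //.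
by have [] := qP n.
Qed.

End Bisection.

Section Goursat.
Variable R : realType.
Local Notation C := (Cplx R).
Variables (G Gl Gt : R -> R -> C) (K : R).
Hypothesis K_ge0 : 0 <= K.
Hypothesis dGt : forall l t, path_derive (G l) t (Gt l t).
Hypothesis dGl : forall l t, path_derive (fun s => G s t) l (Gl l t).
Hypothesis cGt : forall l, continuous (Gt l).
Hypothesis cGl : forall t, continuous (fun l => Gl l t).
Hypothesis GtK : forall l t, 0 <= l <= 1 -> nc (Gt l t) <= K.
Hypothesis GlK : forall l t, 0 <= l <= 1 -> nc (Gl l t) <= K.
Hypothesis G_lip : forall l t l' t', 0 <= l <= 1 -> 0 <= l' <= 1 ->
  nc (G l t - G l' t') <= K * (`|l - l'| + `|t - t'|).

Lemma path_derive_continuous (U : R -> C) t d : path_derive U t d ->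
  {for t, continuous U}.
Proof.
move=> [[/derivable1_diffP/differentiable_continuous h1 _]
        [/derivable1_diffP/differentiable_continuous h2 _]].
have -> : U = (fun s => Complex (Rep (U s)) (Imp (U s))).
  by apply/funext => s; case: (U s).
exact: cvg_Complex.
Qed.

(** The integral of the pulled back form g dz over the boundary of the rectangle
    [l1, l2] x [t1, t2]. *)
Definition rectint (g : C -> C) (l1 l2 t1 t2 : R) : C :=
  pathint t1 t2 (fun t => g (G l2 t) * Gt l2 t)
  - pathint t1 t2 (fun t => g (G l1 t) * Gt l1 t)
  - (pathint l1 l2 (fun l => g (G l t2) * Gl l t2)
     - pathint l1 l2 (fun l => g (G l t1) * Gl l t1)).

Section Continuity.
Variable g : C -> C.

Lemma within_t l t1 t2 : (forall t, t1 <= t <= t2 -> {for G l t, continuous g}) ->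
  {within `[t1, t2], continuous (fun t => g (G l t) * Gt l t)}.
Proof.
move=> cg; apply: withinM; apply: within_at => t /=; last by move=> _; exact: cGt.
rewrite in_itv/= => tt; apply: (@continuous_comp _ _ _ (G l) g); last exact: cg.
exact: path_derive_continuous (dGt l t).
Qed.

Lemma within_l t l1 l2 : (forall l, l1 <= l <= l2 -> {for G l t, continuous g}) ->
  {within `[l1, l2], continuous (fun l => g (G l t) * Gl l t)}.
Proof.
move=> cg; apply: withinM; apply: within_at => l /=; last by move=> _; exact: cGl.
rewrite in_itv/= => ll; apply: (@continuous_comp _ _ _ (fun s => G s t) g); last exact: cg.
exact: path_derive_continuous (dGl l t).
Qed.

End Continuity.

(** An affine form has a primitive, so the four sides cancel. *)
Lemma rectint_affine (a b : C) l1 l2 t1 t2 : l1 <= l2 -> t1 <= t2 ->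
  rectint (fun z => a + b * z) l1 l2 t1 t2 = 0.
Proof.
move=> l12 t12.
pose F (z : C) := a * z + b / 2 * (z * z).
have dF (U : R -> C) t d : path_derive U t d ->
    path_derive (fun s => F (U s)) t ((a + b * U t) * d).
  move=> dU.
  have -> : (a + b * U t) * d = a * d + b / 2 * (d * U t + U t * d) by field.
  exact: path_deriveD (path_deriveZ a dU) (path_deriveZ (b / 2) (path_deriveM dU dU)).
have ca (z : C) : {for z, continuous (fun z : C => a + b * z)}.
  apply: (@cvgD _ _ _ (nbhs z) _ (cst a) (fun z : C => b * z)); first exact: cvg_cst.
  by apply: (@cvgM _ _ (nbhs z) _ (cst b) id); [exact: cvg_cst|exact: cvg_id].
have It l : pathint t1 t2 (fun t => (a + b * G l t) * Gt l t) = F (G l t2) - F (G l t1).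
  apply: (pathint_FTC (U := fun t => F (G l t)) t12) => [|t _]; last exact: dF.
  by apply: (@within_t (fun z => a + b * z)) => t _; exact: ca.
have Il t : pathint l1 l2 (fun l => (a + b * G l t) * Gl l t) = F (G l2 t) - F (G l1 t).
  apply: (pathint_FTC (U := fun l => F (G l t)) l12) => [|l _]; last exact: (dF (fun s => G s t)).
  by apply: (@within_l (fun z => a + b * z)) => l _; exact: ca.
rewrite /rectint !It !Il.
set x1 := F _; set x2 := F (G l2 t1); set x3 := F (G l1 t2); set x4 := F (G l1 t1).
by ring.
Qed.

Lemma rectintB (f g : C -> C) l1 l2 t1 t2 :
  (forall l t, l1 <= l <= l2 -> t1 <= t <= t2 -> {for G l t, continuous f}) ->
  (forall l t, l1 <= l <= l2 -> t1 <= t <= t2 -> {for G l t, continuous g}) ->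
  l1 <= l2 -> t1 <= t2 ->
  rectint (fun z => f z - g z) l1 l2 t1 t2 =
  rectint f l1 l2 t1 t2 - rectint g l1 l2 t1 t2.
Proof.
move=> cf cg l12 t12.
have Et l : l1 <= l <= l2 -> pathint t1 t2 (fun t => (f (G l t) - g (G l t)) * Gt l t) =
    pathint t1 t2 (fun t => f (G l t) * Gt l t) - pathint t1 t2 (fun t => g (G l t) * Gt l t).
  move=> ll; rewrite -(pathintB (within_t (cf l ^~ ll)) (within_t (cg l ^~ ll))).
  by apply: eq_pathint => t _; rewrite mulrBl.
have El t : t1 <= t <= t2 -> pathint l1 l2 (fun l => (f (G l t) - g (G l t)) * Gl l t) =
    pathint l1 l2 (fun l => f (G l t) * Gl l t) - pathint l1 l2 (fun l => g (G l t) * Gl l t).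
  move=> tt; rewrite -(pathintB (within_l (fun l ll => cf l t ll tt)) (within_l (fun l ll => cg l t ll tt))).
  by apply: eq_pathint => l _; rewrite mulrBl.
rewrite /rectint !Et ?El ?lexx ?l12 ?t12//.
set x1 := pathint _ _ _; set x2 := pathint _ _ _; set x3 := pathint _ _ _.
set x4 := pathint _ _ _; set x5 := pathint _ _ _; set x6 := pathint _ _ _.
set x7 := pathint _ _ _; set x8 := pathint _ _ _; ring.
Qed.

Lemma rectint_le (g : C -> C) l t h M : 0 <= h -> 0 <= M -> 0 <= l -> l + h <= 1 ->
  (forall l' t', l <= l' <= l + h -> t <= t' <= t + h -> {for G l' t', continuous g}) ->
  (forall l' t', l <= l' <= l + h -> t <= t' <= t + h -> nc (g (G l' t')) <= M) ->
  nc (rectint g l (l + h) t (t + h)) <= 8 * (M * K * h).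
Proof.
move=> h0 M0 l0 l1 cg gM.
have lh : l <= l + h by lra. have th : t <= t + h by lra.
have Bt l' : l <= l' <= l + h ->
    nc (pathint t (t + h) (fun t' => g (G l' t') * Gt l' t')) <= 2 * (M * K * h).
  move=> ll; have := pathint_le (M := M * K) th (within_t (cg l' ^~ ll)).
  rewrite (addrC t) addrK mulrA; apply => t' tt; rewrite ncM.
  by apply: ler_pM; rewrite ?nc_ge0 ?gM// ?GtK//; [rewrite (addrC t)|move/andP: ll; lra].
have Bl t' : t <= t' <= t + h ->
    nc (pathint l (l + h) (fun l' => g (G l' t') * Gl l' t')) <= 2 * (M * K * h).
  move=> tt; have := pathint_le (M := M * K) lh (within_l (fun l ll => cg l t' ll tt)).
  rewrite (addrC l) addrK mulrA; apply => l' ll; rewrite ncM.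
  by apply: ler_pM; rewrite ?nc_ge0 ?gM// ?GlK//; [rewrite (addrC l)|move/andP: ll; lra].
have bl1 : l <= l <= l + h by rewrite lexx.
have bl2 : l <= l + h <= l + h by rewrite lexx andbT.
have bt1 : t <= t <= t + h by rewrite lexx.
have bt2 : t <= t + h <= t + h by rewrite lexx andbT.
have h1 := Bt _ bl1; have h2 := Bt _ bl2; have h3 := Bl _ bt1; have h4 := Bl _ bt2.
rewrite /rectint; apply: (le_trans (ncB _ _)).
apply: (le_trans (lerD (ncB _ _) (ncB _ _))).
move: h1 h2 h3 h4; set x1 := nc _; set x2 := nc _; set x3 := nc _; set x4 := nc _; lra.
Qed.

Lemma rectint_split (g : C -> C) l t h : 0 <= h ->
  (forall l' t', l <= l' <= l + h -> t <= t' <= t + h -> {for G l' t', continuous g}) ->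
  rectint g l (l + h) t (t + h) =
  rectint g l (l + h / 2) t (t + h / 2)
  + rectint g (l + h / 2) (l + h / 2 + h / 2) t (t + h / 2)
  + rectint g l (l + h / 2) (t + h / 2) (t + h / 2 + h / 2)
  + rectint g (l + h / 2) (l + h / 2 + h / 2) (t + h / 2) (t + h / 2 + h / 2).
Proof.
move=> h0 cg.
have -> : l + h / 2 + h / 2 = l + h by lra.
have -> : t + h / 2 + h / 2 = t + h by lra.
have lm : l <= l + h / 2 by lra. have ml : l + h / 2 <= l + h by lra.
have tm : t <= t + h / 2 by lra. have mt : t + h / 2 <= t + h by lra.
have St l' : l <= l' <= l + h -> pathint t (t + h) (fun t' => g (G l' t') * Gt l' t') =
    pathint t (t + h / 2) (fun t' => g (G l' t') * Gt l' t') +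
    pathint (t + h / 2) (t + h) (fun t' => g (G l' t') * Gt l' t').
  by move=> ll; exact: pathint_cat tm mt (within_t (cg l' ^~ ll)).
have Sl t' : t <= t' <= t + h -> pathint l (l + h) (fun l' => g (G l' t') * Gl l' t') =
    pathint l (l + h / 2) (fun l' => g (G l' t') * Gl l' t') +
    pathint (l + h / 2) (l + h) (fun l' => g (G l' t') * Gl l' t').
  by move=> tt; exact: pathint_cat lm ml (within_l (fun l ll => cg l t' ll tt)).
have bl1 : l <= l <= l + h by rewrite lexx; lra.
have bl2 : l <= l + h <= l + h by rewrite lexx andbT; lra.
have bt1 : t <= t <= t + h by rewrite lexx; lra.
have bt2 : t <= t + h <= t + h by rewrite lexx andbT; lra.
rewrite /rectint (St _ bl1) (St _ bl2) (Sl _ bt1) (Sl _ bt2).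
move: (pathint t (t + h / 2) (fun t' => g (G l t') * Gt l t')) => x1.
move: (pathint (t + h / 2) (t + h) (fun t' => g (G l t') * Gt l t')) => x2.
move: (pathint t (t + h / 2) (fun t' => g (G (l + h) t') * Gt (l + h) t')) => x3.
move: (pathint (t + h / 2) (t + h) (fun t' => g (G (l + h) t') * Gt (l + h) t')) => x4.
move: (pathint l (l + h / 2) (fun l' => g (G l' t) * Gl l' t)) => x5.
move: (pathint (l + h / 2) (l + h) (fun l' => g (G l' t) * Gl l' t)) => x6.
move: (pathint l (l + h / 2) (fun l' => g (G l' (t + h)) * Gl l' (t + h))) => x7.
move: (pathint (l + h / 2) (l + h) (fun l' => g (G l' (t + h)) * Gl l' (t + h))) => x8.
move: (pathint _ _ _) => y1; move: (pathint _ _ _) => y2.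
move: (pathint _ _ _) => y3; move: (pathint _ _ _) => y4.
ring.
Qed.

(** Goursat's bisection: a rectangle with a nonzero boundary integral contains
    arbitrarily small squares whose integral is at least a fixed multiple of their
    area, but where g has a derivative the integral is o(area), because the affine
    part of g has a primitive. *)
Lemma goursat (g : C -> C) :
  (forall l t, 0 <= l <= 1 -> 0 <= t <= 1 -> differentiable g (G l t)) ->
  rectint g 0 1 0 1 = 0.
Proof.
move=> dg.
have cg l t : 0 <= l <= 1 -> 0 <= t <= 1 -> {for G l t, continuous g}.
  by move=> ll tt; apply: differentiable_continuous; exact: dg.
apply/eqP; rewrite -nc_eq0; apply/negPn/negP; move=> eta_neq0.
set eta := nc _ in eta_neq0.
have eta0 : 0 < eta by rewrite lt_def eta_neq0 nc_ge0.
pose P l t h := [/\ 0 <= l /\ l + h <= 1, 0 <= t /\ t + h <= 1 &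
  eta * h ^+ 2 <= nc (rectint g l (l + h) t (t + h))].
have P0 : P 0 0 1.
  by split; [split; lra|split; lra|rewrite expr1n mulr1 !add0r].
have Pstep x y h : 0 < h -> P x y h -> exists x' y',
   [/\ x' = x \/ x' = x + h / 2, y' = y \/ y' = y + h / 2 & P x' y' (h / 2)].
  move=> h0 [[x0 xh] [y0 yh]].
  have half z : 0 <= z -> z + h <= 1 -> (0 <= z /\ z + h / 2 <= 1) /\
      (0 <= z + h / 2 /\ z + h / 2 + h / 2 <= 1) by move=> ? ?; do !split; lra.
  have [x1 x2] := half _ x0 xh; have [y1 y2] := half _ y0 yh.
  have xs l : x <= l <= x + h -> 0 <= l <= 1.
    by move=> /andP[? ?]; apply/andP; split; lra.
  have ys t : y <= t <= y + h -> 0 <= t <= 1.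
    by move=> /andP[? ?]; apply/andP; split; lra.
  move=> hP.
  have cgs l' t' : x <= l' <= x + h -> y <= t' <= y + h -> {for G l' t', continuous g}.
    by move=> /xs ? /ys ?; exact: cg.
  rewrite (rectint_split (ltW h0) cgs) in hP.
  (* Otherwise all four quarters fall short of their share of the integral. *)
  have [p1|p1] := lerP (eta * (h / 2) ^+ 2) (nc (rectint g x (x + h / 2) y (y + h / 2))).
    by exists x, y; split; [left|left|split].
  have [p2|p2] := lerP (eta * (h / 2) ^+ 2)
      (nc (rectint g (x + h / 2) (x + h / 2 + h / 2) y (y + h / 2))).
    by exists (x + h / 2), y; split; [right|left|split].
  have [p3|p3] := lerP (eta * (h / 2) ^+ 2)
      (nc (rectint g x (x + h / 2) (y + h / 2) (y + h / 2 + h / 2))).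
    by exists x, (y + h / 2); split; [left|right|split].
  have [p4|p4] := lerP (eta * (h / 2) ^+ 2)
      (nc (rectint g (x + h / 2) (x + h / 2 + h / 2) (y + h / 2) (y + h / 2 + h / 2))).
    by exists (x + h / 2), (y + h / 2); split; [right|right|split].
  exfalso; move: hP p1 p2 p3 p4; move: (rectint _ _ _ _ _) => r1.
  move: (rectint _ _ _ _ _) => r2; move: (rectint _ _ _ _ _) => r3.
  move: (rectint _ _ _ _ _) => r4 hP p1 p2 p3 p4.
  have h1 := ncD (r1 + r2 + r3) r4; have h2 := ncD (r1 + r2) r3; have h3 := ncD r1 r2.
  move: h1 h2 h3 hP p1 p2 p3 p4; rewrite expr_div_n -natrX.
  move: (nc (r1 + r2 + r3 + r4)) => n0; move: (nc (r1 + r2 + r3)) => n1.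
  move: (nc (r1 + r2)) => n2; move: (nc r1) => n3; move: (nc r2) => n4.
  move: (nc r3) => n5; move: (nc r4) => n6.
  lra.
have [x0 [y0 H]] := bisection P0 Pstep.
have x01 : 0 <= x0 <= 1.
  by have [x [y [[[? ?] _ _] /andP[? ?] _]]] := H 0%N; apply/andP; split; lra.
have y01 : 0 <= y0 <= 1.
  by have [x [y [[_ [? ?] _] _ /andP[? ?]]]] := H 0%N; apply/andP; split; lra.
(* [rectint_le] turns a remainder e |z - z0| into 16 e K^2 times the area. *)
pose e := eta / (16 * K ^+ 2 + 1).
have K2 : 0 < 16 * K ^+ 2 + 1 by have := sqr_ge0 K; lra.
have e0 : 0 < e by rewrite /e divr_gt0.
have [dl dl0 hdl] := differentiable1_epsP (dg _ _ x01 y01) e0.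
have [n hn] : exists n, 2 * K * 2^-1 ^+ n < dl.
  have d' : 0 < dl / (2 * K + 1) by rewrite divr_gt0// ltr_wpDl// mulr_ge0.
  have : (fun n => (2^-1 : R) ^+ n) @ \oo --> (0 : R).
    by apply: cvg_expr; rewrite ger0_norm ?invr_ge0// invf_lt1// ltr1n.
  move=> /cvgrPdist_lt /(_ _ d') [n _ /(_ n (leqnn n))].
  rewrite /= sub0r normrN ger0_norm ?exprn_ge0 ?invr_ge0// => hn; exists n.
  move: hn; rewrite ltr_pdivlMr; last by rewrite ltr_wpDl// mulr_ge0.
  have : 0 < (2^-1 : R) ^+ n by rewrite exprn_gt0// invr_gt0.
  lra.
have [x [y [[[x_ge0 xh] [y_ge0 yh]]]]] := H n.
move: hn xh yh; set h := 2^-1 ^+ n => hn xh yh.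
have h0 : 0 < h by rewrite /h exprn_gt0// invr_gt0.
have xs l : x <= l <= x + h -> 0 <= l <= 1.
  by move=> /andP[? ?]; apply/andP; split; lra.
have ys t : y <= t <= y + h -> 0 <= t <= 1.
  by move=> /andP[? ?]; apply/andP; split; lra.
have close u0 u v : u <= u0 <= u + h -> u <= v <= u + h -> `|v - u0| <= h.
  by move=> /andP[? ?] /andP[? ?]; rewrite ler_norml; apply/andP; split; lra.
have xxh : x <= x + h by rewrite lerDl ltW. have yyh : y <= y + h by rewrite lerDl ltW.
move=> hP xx yy.
set z0 := G x0 y0 in hdl; set b := (g^`()%classic z0) in hdl.
pose a := g z0 - b * z0.
have ca (z : C) : {for z, continuous (fun z : C => a + b * z)}.
  apply: (@cvgD _ _ _ (nbhs z) _ (cst a) (fun z : C => b * z)); first exact: cvg_cst.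
  by apply: (@cvgM _ _ (nbhs z) _ (cst b) id); [exact: cvg_cst|exact: cvg_id].
have cgs l' t' : x <= l' <= x + h -> y <= t' <= y + h -> {for G l' t', continuous g}.
  by move=> /xs ? /ys ?; exact: cg.
have E : rectint (fun z => g z - (a + b * z)) x (x + h) y (y + h) =
    rectint g x (x + h) y (y + h).
  by rewrite (rectintB cgs (fun l t _ _ => ca (G l t)) xxh yyh) rectint_affine// subr0.
have M0 : 0 <= e * (2 * K * h) by rewrite mulr_ge0 ?(ltW e0)// mulr_ge0 ?(ltW h0)// mulr_ge0.
have : nc (rectint g x (x + h) y (y + h)) <= 8 * (e * (2 * K * h) * K * h).
  rewrite -E; apply: (rectint_le (ltW h0) M0 x_ge0 xh) => [l' t' ll tt|].
  apply: (@cvgB _ _ _ (nbhs (G l' t')) _ g (fun z : C => a + b * z)); [exact: cgs|exact: ca].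
  move=> l' t' ll tt.
  have d1 : nc (G l' t' - z0) <= 2 * K * h.
    apply: (le_trans (G_lip _ _ (xs _ ll) x01)).
    by rewrite (mulrC 2) -mulrA ler_wpM2l// mulr_natl mulr2n lerD// ?(close _ _ _ xx ll) ?(close _ _ _ yy tt).
  have := hdl (G l' t' - z0) (le_lt_trans d1 hn).
  rewrite (addrC z0) subrK.
  have -> : g (G l' t') - (a + b * G l' t') = g (G l' t') - g z0 - b * (G l' t' - z0).
    by rewrite /a; ring.
  move=> h1; apply: (le_trans h1); rewrite ler_wpM2l// ltW//.
move=> /(le_trans hP).
have -> : 8 * (e * (2 * K * h) * K * h) = e * (16 * K ^+ 2) * h ^+ 2 by ring.
rewrite ler_pM2r ?exprn_gt0// => h1.
have : e * (16 * K ^+ 2 + 1) = eta by rewrite /e divfK// gt_eqF.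
lra.
Qed.

End Goursat.

(** * Cauchy's integral formula *)

Section Circle.
Variable R : realType.
Local Notation C := (Cplx R).

Definition unit_circle (t : R) : C := Complex (cos (pi *+ 2 * t)) (sin (pi *+ 2 * t)).
Local Notation ec := unit_circle.

(** The constant 2 i pi, with d/dt [unit_circle] = 2 i pi [unit_circle]. *)
Definition itwopi : C := Complex 0 (pi *+ 2).

Lemma itwopi_neq0 : itwopi != 0.
Proof.
rewrite -nc_eq0; apply/negP => /eqP h.
have := nc_Im itwopi; rewrite h /= normr_le0 mulrn_eq0/= => /eqP h'.
by have := pi_gt0 R; rewrite h' ltxx.
Qed.

Lemma nc_itwopi_le : nc itwopi <= 2 * pi.
Proof.
apply: (le_trans (nc_le _)).
have -> : Rep itwopi = 0 by []. have -> : Imp itwopi = pi *+ 2 by [].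
by rewrite normr0 add0r mulr_natl ger0_norm// mulrn_wge0// pi_ge0.
Qed.

Lemma nc_unit_circle t : nc (ec t) = 1.
Proof. by rewrite /= cos2Dsin2 sqrtr1. Qed.

Lemma unit_circle_neq0 t : ec t != 0.
Proof. by rewrite -nc_eq0 nc_unit_circle oner_eq0. Qed.

Lemma unit_circle01 : ec 0 = ec 1.
Proof. by rewrite /ec mulr0 mulr1 cos0 sin0 cos2pi sin2pi. Qed.

Lemma is_derive_comp_real (f g : R -> R) t df dg :
  is_derive (g t) 1 f df -> is_derive t 1 g dg -> is_derive t 1 (fun s => f (g s)) (df * dg).
Proof.
move=> [f1 f2] [g1 g2].
have dfg : derivable (f \o g) t 1.
  move/derivable1_diffP : g1 => g1; move/derivable1_diffP : f1 => f1.
  by apply/derivable1_diffP; exact: differentiable_comp g1 f1.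
apply: DeriveDef => //.
by have := derive1_comp g1 f1; rewrite !derive1E f2 g2.
Qed.

Lemma unit_circle_derive t : path_derive ec t (itwopi * ec t).
Proof.
have dl : is_derive t 1 (fun s : R => pi *+ 2 * s) (pi *+ 2).
  have := @is_deriveZ _ _ _ id (pi *+ 2) t 1 1 (is_derive_id t 1).
  by rewrite /GRing.scale/= mulr1.
split=> /=.
  rewrite mul0r sub0r -mulNr mulrC mulrN -mulNr.
  exact: (is_derive_comp_real (is_derive_cos _) dl).
rewrite mul0r add0r mulrC.
exact: (is_derive_comp_real (is_derive_sin _) dl).
Qed.

Lemma continuous_unit_circle : continuous ec.
Proof. by move=> t; exact: path_derive_continuous (unit_circle_derive t). Qed.

Definition circle (p : C) (s : R) (t : R) : C := p + s%:CC * ec t.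

Lemma nc_circle p s t : nc (circle p s t - p) = `|s|.
Proof. by rewrite /circle addrAC subrr add0r ncM nc_unit_circle mulr1 nc_real. Qed.

Lemma continuous_circle p s : continuous (circle p s).
Proof.
move=> t; apply: (@cvgD _ _ _ (nbhs t) _ (cst p) (fun t => s%:CC * ec t)).
  exact: cvg_cst.
apply: (@cvgM _ _ (nbhs t) _ (cst s%:CC) ec); first exact: cvg_cst.
exact: continuous_unit_circle.
Qed.

Lemma unit_circle_lip t t' : nc (ec t - ec t') <= 4 * pi * `|t - t'|.
Proof.
wlog tt : t t' / t' <= t.
  by move=> H; have [/H//|/ltW/H] := leP t' t; rewrite ncC distrC.
have cu : {within `[t', t], continuous (fun s => itwopi * ec s)}.
  by apply: withinM; [exact: within_cst|apply: within_at => x _; exact: continuous_unit_circle].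
rewrite -(pathint_FTC tt cu (fun s _ => unit_circle_derive s)).
rewrite ger0_norm ?subr_ge0//.
have -> : 4 * pi = 2 * (2 * pi) :> R by ring.
apply: (pathint_le tt cu) => s _.
by rewrite ncM nc_unit_circle mulr1 nc_itwopi_le.
Qed.

End Circle.

Section CauchyFormula.
Variable R : realType.
Local Notation C := (Cplx R).
Local Notation ec := (@unit_circle R).

Lemma differentiable_quotient (f : C -> C) (w z : C) :
  differentiable f z -> z != w -> differentiable (fun z => f z / (z - w)) z.
Proof.
move=> df zw.
have dzw : differentiable (fun z : C => z - w) z.
  by apply: (@differentiableB _ _ _ id (cst w)); [exact: ex_diff|exact: differentiable_cst].
have dV : differentiable (fun z : C => (z - w)^-1) z.
  by apply: (differentiableV dzw); rewrite subr_eq0.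
exact: (differentiableM df dV).
Qed.

(** The circle of radius s about p is slid onto a small circle about w, through
    circles none of which meets w. *)
Lemma circle_homotopy (f : C -> C) (p w : C) (s e : R) : 0 < e -> nc (w - p) + e <= s ->
  (forall z, nc (z - p) <= s -> differentiable f z) ->
  pathint 0 1 (fun t => f (circle p s t) * (s%:CC * ec t) / (circle p s t - w)) =
  pathint 0 1 (fun t => f (circle w e t)).
Proof.
move=> e0 wpe df.
have wp0 := nc_ge0 (w - p).
pose B (l : R) : R := e + l * (s - e).
pose G (l t : R) : C := circle (w + l%:CC * (p - w)) (B l) t.
pose Gt (l t : R) : C := (B l)%:CC * (itwopi R * ec t).
pose Gl (l t : R) : C := (p - w) + (s - e)%:CC * ec t.
(* K bounds both partial derivatives of G and its Lipschitz constant; 4 pi is the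
   Lipschitz constant found for the unit circle. *)
pose K := nc (p - w) + (s + e) * (1 + 4 * pi).
have pi0 := pi_gt0 R.
have B0 l : 0 <= l <= 1 -> e <= B l <= s + e.
  by move=> /andP[l0 l1]; rewrite /B; apply/andP; split; nra.
have dGt l t : path_derive (G l) t (Gt l t).
  rewrite /Gt -[_ * _]add0r.
  exact: path_deriveD (path_derive_cst _ t) (path_deriveZ _ (unit_circle_derive t)).
have dGl l t : path_derive (fun l => G l t) l (Gl l t).
  have -> : (fun l => G l t) = (fun l => (w + e%:CC * ec t) + Gl l t * l%:CC).
    apply/funext => x; rewrite /G /circle /B /Gl.
    have -> : (e + x * (s - e))%:CC = e%:CC + x%:CC * (s%:CC - e%:CC) :> C.
      by rewrite rmorphD rmorphM rmorphB.
    have -> : (s - e)%:CC = s%:CC - e%:CC :> C by rewrite rmorphB.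
    by move: (x%:CC) (e%:CC) (s%:CC) (ec t) => x' e' s' c; ring.
  rewrite -[X in path_derive _ _ X]add0r.
  apply: path_deriveD; first exact: path_derive_cst.
  by have := path_deriveZ (Gl l t) (path_derive_real l); rewrite mulr1.
have cGt l : continuous (Gt l).
  move=> t; apply: (@cvgM _ _ (nbhs t) _ (cst (B l)%:CC) (fun t => itwopi R * ec t)).
    exact: cvg_cst.
  apply: (@cvgM _ _ (nbhs t) _ (cst (itwopi R)) ec); first exact: cvg_cst.
  exact: continuous_unit_circle.
have cGl t : continuous (fun l => Gl l t) by move=> l; exact: cvg_cst.
have itK := @nc_itwopi_le R.
have K0 : 0 <= K by rewrite /K; have := nc_ge0 (p - w); nra.
have GtK l t : 0 <= l <= 1 -> nc (Gt l t) <= K.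
  move=> /B0 /andP[b1 b2]; rewrite /Gt !ncM nc_unit_circle mulr1 nc_real ger0_norm; last lra.
  have := nc_ge0 (p - w); have := nc_ge0 (itwopi R); rewrite /K; nra.
have GlK l t : 0 <= l <= 1 -> nc (Gl l t) <= K.
  move=> _; apply: (le_trans (ncD _ _)); rewrite ncM nc_unit_circle mulr1 nc_real.
  by rewrite lerD2l ger0_norm; nra.
have Glip l t l' t' : 0 <= l <= 1 -> 0 <= l' <= 1 ->
    nc (G l t - G l' t') <= K * (`|l - l'| + `|t - t'|).
  move=> _ /B0 /andP[b1 b2].
  have -> : G l t - G l' t' = (l - l')%:CC * Gl l t + (B l')%:CC * (ec t - ec t').
    rewrite /G /Gl /circle.
    have -> : (B l)%:CC = (B l')%:CC + (l - l')%:CC * (s - e)%:CC :> C.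
      by rewrite -rmorphM -rmorphD /B; congr (_%:CC); ring.
    have -> : (l - l')%:CC = l%:CC - l'%:CC :> C by rewrite rmorphB.
    by ring.
  apply: (le_trans (ncD _ _)); rewrite !ncM !nc_real mulrDr lerD//.
    rewrite mulrC ler_wpM2r// (le_trans (ncD _ _))// ncM nc_unit_circle mulr1 nc_real.
    by rewrite lerD2l ger0_norm; nra.
  rewrite ger0_norm; last lra.
  apply: (@le_trans _ _ ((s + e) * (4 * pi * `|t - t'|))).
    by apply: ler_pM; rewrite ?nc_ge0//; [lra|exact: unit_circle_lip].
  rewrite mulrA ler_wpM2r// /K; have := nc_ge0 (p - w); nra.
have Gw l t : 0 <= l <= 1 -> nc (G l t - p) <= s /\ G l t != w.
  move=> ll; have /andP[b1 b2] := B0 _ ll; move: ll => /andP[l0 l1].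
  split.
    have -> : G l t - p = (1 - l)%:CC * (w - p) + (B l)%:CC * ec t.
      rewrite /G /circle.
      have -> : (1 - l)%:CC = 1 - l%:CC :> C by rewrite rmorphB.
      by ring.
    apply: (le_trans (ncD _ _)); rewrite !ncM nc_unit_circle mulr1 !nc_real !ger0_norm; try lra.
    by rewrite /B; nra.
  apply/eqP => Gw.
  have : nc ((B l)%:CC * ec t) = nc (l%:CC * (p - w)).
    have -> : (B l)%:CC * ec t = - (l%:CC * (p - w)).
      by apply/eqP; rewrite -addr_eq0 addrC; apply/eqP/(addrI w); rewrite addr0 addrA.
    by rewrite ncN.
  rewrite !ncM nc_unit_circle mulr1 !nc_real (ncC p w) !ger0_norm; try lra.
  by rewrite /B; nra.
pose g z := f z / (z - w).
have := goursat K0 dGt dGl cGt cGl GtK GlK Glip (g := g).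
have dg l t : 0 <= l <= 1 -> 0 <= t <= 1 -> differentiable g (G l t).
  by move=> /(Gw l t)[/df dfz zw] _; exact: differentiable_quotient.
move=> /(_ dg); rewrite /rectint.
have per l : G l 0 = G l 1 by rewrite /G /circle unit_circle01.
have perl l : Gl l 0 = Gl l 1 by rewrite /Gl unit_circle01.
have -> : (fun l => g (G l 0) * Gl l 0) = (fun l => g (G l 1) * Gl l 1).
  by apply/funext => l; rewrite per perl.
rewrite subrr subr0 => /eqP; rewrite subr_eq0 => /eqP E.
have B1 : B 1 = s by rewrite /B mul1r addrC subrK.
have Be : B 0 = e by rewrite /B mul0r addr0.
have G1 t : G 1 t = circle p s t.
  by rewrite /G /B mul1r mul1r addrC subrK addrC subrK.
have G0 t : G 0 t = circle w e t.
  by rewrite /G /B mul0r addr0 mul0r addr0.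
have cdf t : 0 <= t <= 1 -> {for circle w e t, continuous f}.
  move=> tt; have l01 : 0 <= (0 : R) <= 1 by rewrite lexx ler01.
  by rewrite -G0; apply/differentiable_continuous/df; have [] := Gw 0 t l01.
have cI : {within `[0, 1], continuous (fun t => f (circle w e t))}.
  apply: within_at => t; rewrite /= in_itv/= => /cdf.
  by apply: (continuous_comp); exact: continuous_circle.
apply: (mulfI (itwopi_neq0 R)).
rewrite -[RHS](pathintZ (itwopi R) cI).
rewrite -pathintZ; last first.
  apply: within_at => t; rewrite /= in_itv/= => tt.
  have l11 : 0 <= (1 : R) <= 1 by rewrite lexx ler01.
  have [h1 h2] := Gw 1 t l11; rewrite G1 in h1 h2.
  have cc := @continuous_circle R p s t.
  apply: cvgM; last first.
    apply: cvgV; first by rewrite subr_eq0.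
    by apply: cvgB; [exact: cc|exact: cvg_cst].
  apply: cvgM; last first.
    by apply: cvgM; [exact: cvg_cst|exact: continuous_unit_circle].
  by apply: (continuous_comp cc); apply/differentiable_continuous/df.
transitivity (pathint 0 1 (fun t => g (G 1 t) * Gt 1 t)).
  apply: eq_pathint => t _; rewrite /g /Gt G1 B1.
  by move: (circle p s t) (ec t) => z c; ring.
rewrite E; apply: eq_pathint => t _; rewrite /g /Gt G0 Be.
have ne : e%:CC != 0 :> C by rewrite -nc_eq0 nc_real normr_eq0 gt_eqF.
have nc0 := unit_circle_neq0 t.
have -> : circle w e t - w = e%:CC * ec t by rewrite /circle addrAC subrr add0r.
move: (f _) (e%:CC) (ec t) ne nc0 => fz e' c ne nc0.
by field; rewrite nc0 ne.
Qed.

End CauchyFormula.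

(** * Cauchy transforms of circle densities *)

Section CauchyTransform.
Variable R : realType.
Local Notation C := (Cplx R).
Local Notation ec := (@unit_circle R).
Variables (p : C) (s : R).
Hypothesis s_gt0 : 0 < s.
Local Notation gamma := (circle p s).
Implicit Types (w k : C).

(** With z = gamma t one has dz = 2 i pi s [unit_circle] t dt, so the transform below is
    the usual 1/(2 i pi) times the integral of u(z) / (z - w)^n dz. *)
Definition cauchy_kernel (u : R -> C) n (w : C) (t : R) : C :=
  u t * (s%:CC * ec t) / (gamma t - w) ^+ n.

Definition cauchy_transform u n w := pathint 0 1 (cauchy_kernel u n w).

Lemma circle_sub_ge w t : s - nc (w - p) <= nc (gamma t - w).
Proof.
have := ncBD w (gamma t) p; rewrite nc_circle (ger0_norm (ltW s_gt0)); lra.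
Qed.

Lemma circle_sub_neq0 w t : nc (w - p) < s -> gamma t - w != 0.
Proof.
by move=> ws; rewrite -nc_gt0 (lt_le_trans _ (circle_sub_ge w t))// subr_gt0.
Qed.

Section Density.
Variable u : R -> C.
Hypothesis cu : {within `[0, 1], continuous u}.

Lemma within_cauchy_kernel n w : nc (w - p) < s ->
  {within `[0, 1], continuous (cauchy_kernel u n w)}.
Proof.
move=> ws; apply: withinM.
  apply: (withinM cu); apply: withinM; first exact: within_cst.
  by apply: within_at => t _; exact: continuous_unit_circle.
apply: within_at => t _; apply: (@cvgV _ _ (nbhs t)).
  by rewrite expf_neq0// circle_sub_neq0.
have cg : gamma x - w @[x --> t] --> gamma t - w.
  by apply: (@cvgB _ _ _ (nbhs t)); [exact: continuous_circle|exact: cvg_cst].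
elim: n => [|n ih]; first by under eq_fun do rewrite expr0; exact: cvg_cst.
under eq_fun do rewrite exprS; rewrite exprS.
exact: (@cvgM _ _ (nbhs t) _ (fun x => gamma x - w) (fun x => (gamma x - w) ^+ n) _ _ cg ih).
Qed.

Variable M : R.
Hypothesis uM : forall t, 0 <= t <= 1 -> nc (u t) <= M.

Lemma density_ge0 : 0 <= M.
Proof. by apply: le_trans (uM (t := 0) _); rewrite ?nc_ge0// lexx ler01. Qed.

Lemma nc_cauchy_kernel n w d t : 0 < d -> d <= s - nc (w - p) -> 0 <= t <= 1 ->
  nc (cauchy_kernel u n w t) <= M * s / d ^+ n.
Proof.
move=> d0 dw tt; have M0 := density_ge0.
rewrite /cauchy_kernel !ncM ncV ncX nc_unit_circle mulr1 nc_real (ger0_norm (ltW s_gt0)).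
have hv : d ^+ n <= nc (gamma t - w) ^+ n.
  by rewrite lerXn2r ?nnegrE ?(ltW d0) ?nc_ge0// (le_trans dw)// circle_sub_ge.
have d0n : 0 < d ^+ n by rewrite exprn_gt0.
apply: ler_pM.
- by rewrite mulr_ge0 ?nc_ge0// (ltW s_gt0).
- by rewrite invr_ge0 exprn_ge0// nc_ge0.
- by rewrite ler_wpM2r ?uM// (ltW s_gt0).
- by rewrite lef_pV2// posrE (lt_le_trans d0n).
Qed.

Lemma nc_cauchy_transform n w d : 0 < d -> d <= s - nc (w - p) ->
  nc (cauchy_transform u n w) <= 2 * (M * s / d ^+ n).
Proof.
move=> d0 dw; have ws : nc (w - p) < s by lra.
have := pathint_le (M := M * s / d ^+ n) ler01 (within_cauchy_kernel (n := n) ws).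
by rewrite subr0 mulr1; apply => t tt; exact: nc_cauchy_kernel.
Qed.

(** The integrand is k^2 / (v^2 (v - k)) times the density, with v = z - w. *)
Lemma cauchy_transform_taylor1 w k d : 0 < d -> d <= s - nc (w - p) -> nc k <= d / 2 ->
  nc (cauchy_transform u 1 (w + k) - cauchy_transform u 1 w - cauchy_transform u 2 w * k)
  <= 4 * M * s * nc k ^+ 2 / d ^+ 3.
Proof.
move=> d0 dw kd; have M0 := density_ge0.
have ws : nc (w - p) < s by lra.
have dwk : d / 2 <= s - nc (w + k - p).
  by have := ncD (w - p) k; rewrite addrAC; lra.
have wks : nc (w + k - p) < s by lra.
have c1 := within_cauchy_kernel (n := 1) wks; have c2 := within_cauchy_kernel (n := 1) ws.
have c3 : {within `[0, 1], continuous (fun t => k * cauchy_kernel u 2 w t)}.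
  by apply: withinM; [exact: within_cst|exact: within_cauchy_kernel].
rewrite /cauchy_transform (mulrC (pathint _ _ _)).
rewrite -(pathintZ k (within_cauchy_kernel (n := 2) ws)) -(pathintB c1 c2).
rewrite -(pathintB (withinB c1 c2) c3).
have := pathint_le (M := 2 * M * s * nc k ^+ 2 / d ^+ 3) ler01 (withinB (withinB c1 c2) c3).
rewrite subr0 mulr1 => H; apply: (le_trans (H _)); last first.
  by rewrite !mulrA -natrM.
move=> t tt.
have v0 := circle_sub_neq0 t ws; have vk0 := circle_sub_neq0 t wks.
have -> : cauchy_kernel u 1 (w + k) t - cauchy_kernel u 1 w t - k * cauchy_kernel u 2 w t =
    k ^+ 2 * (cauchy_kernel u 2 w t / (gamma t - (w + k))).
  rewrite /cauchy_kernel; move: (u t) (s%:CC * ec t) v0 vk0 => ut sc.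
  have -> : gamma t - (w + k) = (gamma t - w) - k by rewrite opprD addrA.
  move: (gamma t - w) => v v0 vk0.
  by field; rewrite vk0 v0.
rewrite (ncM (k ^+ 2)) ncX ncM ncV.
have h1 := nc_cauchy_kernel 2 d0 dw tt.
have h2 : (nc (gamma t - (w + k)))^-1 <= 2 / d.
  have h := le_trans dwk (circle_sub_ge (w + k) t).
  rewrite -[2 / d]invf_div lef_pV2// posrE ?divr_gt0//.
  by rewrite (lt_le_trans _ h)// divr_gt0.
have -> : 2 * M * s * nc k ^+ 2 / d ^+ 3 = nc k ^+ 2 * ((M * s / d ^+ 2) * (2 / d)).
  by field; rewrite gt_eqF.
by rewrite ler_wpM2l ?exprn_ge0 ?nc_ge0// ler_pM ?nc_ge0 ?invr_ge0 ?nc_ge0.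
Qed.

(** The integrand is k^2 (3 v - 2 k) / (v^3 (v - k)^2) times the density, with v = z - w. *)
Lemma cauchy_transform_taylor2 w k d : 0 < d -> d <= s - nc (w - p) -> nc k <= d / 2 ->
  nc (cauchy_transform u 2 (w + k) - cauchy_transform u 2 w
      - 2 * cauchy_transform u 3 w * k)
  <= 32 * M * s * nc k ^+ 2 / d ^+ 4.
Proof.
move=> d0 dw kd; have M0 := density_ge0.
have ws : nc (w - p) < s by lra.
have dwk : d / 2 <= s - nc (w + k - p).
  by have := ncD (w - p) k; rewrite addrAC; lra.
have wks : nc (w + k - p) < s by lra.
have c1 := within_cauchy_kernel (n := 2) wks; have c2 := within_cauchy_kernel (n := 2) ws.
have c3 : {within `[0, 1], continuous (fun t => (2 * k) * cauchy_kernel u 3 w t)}.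
  by apply: withinM; [exact: within_cst|exact: within_cauchy_kernel].
rewrite /cauchy_transform.
have -> : 2 * pathint 0 1 (cauchy_kernel u 3 w) * k = (2 * k) * pathint 0 1 (cauchy_kernel u 3 w).
  by move: (pathint _ _ _) => x; ring.
rewrite -(pathintZ (2 * k) (within_cauchy_kernel (n := 3) ws)) -(pathintB c1 c2).
rewrite -(pathintB (withinB c1 c2) c3).
have := pathint_le (M := 16 * M * s * nc k ^+ 2 / d ^+ 4) ler01 (withinB (withinB c1 c2) c3).
rewrite subr0 mulr1 => H; apply: (le_trans (H _)); last first.
  by rewrite !mulrA -natrM.
move=> t tt.
have v0 := circle_sub_neq0 t ws; have vk0 := circle_sub_neq0 t wks.
have -> : cauchy_kernel u 2 (w + k) t - cauchy_kernel u 2 w t - (2 * k) * cauchy_kernel u 3 w t =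
    k ^+ 2 * (3 * (cauchy_kernel u 2 w t * (gamma t - (w + k))^-1 ^+ 2)
              - 2 * k * (cauchy_kernel u 3 w t * (gamma t - (w + k))^-1 ^+ 2)).
  rewrite /cauchy_kernel; move: (u t) (s%:CC * ec t) v0 vk0 => ut sc.
  have -> : gamma t - (w + k) = (gamma t - w) - k by rewrite opprD addrA.
  move: (gamma t - w) => v v0 vk0.
  by field; rewrite vk0 v0.
have h1 := nc_cauchy_kernel 2 d0 dw tt; have h3 := nc_cauchy_kernel 3 d0 dw tt.
have h2 : nc ((gamma t - (w + k))^-1 ^+ 2) <= (2 / d) ^+ 2.
  have h := le_trans dwk (circle_sub_ge (w + k) t).
  rewrite ncX ncV lerXn2r ?nnegrE ?invr_ge0 ?nc_ge0 ?divr_ge0// ?(ltW d0)//.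
  rewrite -[2 / d]invf_div lef_pV2// posrE ?divr_gt0//.
  by rewrite (lt_le_trans _ h)// divr_gt0.
rewrite (ncM (k ^+ 2)) ncX.
have -> : 16 * M * s * nc k ^+ 2 / d ^+ 4 = nc k ^+ 2 *
    (3 * ((M * s / d ^+ 2) * (2 / d) ^+ 2) + (2 * (d / 2)) * ((M * s / d ^+ 3) * (2 / d) ^+ 2)).
  by field; rewrite gt_eqF.
rewrite ler_wpM2l ?exprn_ge0 ?nc_ge0//.
apply: (le_trans (ncB _ _)).
have nat_nc n : nc (n%:R : C) = n%:R.
  by rewrite -(rmorph_nat (real_complex R)) nc_real ger0_norm.
move: (cauchy_kernel u 2 w t) (cauchy_kernel u 3 w t) ((gamma t - (w + k))^-1 ^+ 2) h1 h2 h3 => x1 x3 y h1 h2 h3.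
rewrite !ncM !nat_nc lerD//.
  by rewrite ler_wpM2l// ler_pM ?nc_ge0.
rewrite ler_pM ?mulr_ge0 ?nc_ge0//; first by rewrite ler_wpM2l.
by rewrite ler_pM ?nc_ge0.
Qed.

Lemma cauchy_transform_derive w : nc (w - p) < s ->
  differentiable (cauchy_transform u 1) w /\
  (cauchy_transform u 1)^`()%classic w = cauchy_transform u 2 w.
Proof.
move=> ws; have M0 := density_ge0.
pose d := s - nc (w - p); have d0 : 0 < d by rewrite subr_gt0.
apply: differentiable1_eps => e e0.
pose c := 4 * M * s / d ^+ 3.
have c0 : 0 <= c by rewrite /c !mulr_ge0 ?invr_ge0 ?exprn_ge0// ltW.
exists (Num.min (d / 2) (e / (c + 1))).
  by rewrite lt_min !divr_gt0// ltr_wpDl.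
move=> k; rewrite lt_min => /andP[/ltW kd ke].
apply: (le_trans (cauchy_transform_taylor1 d0 (lexx d) kd)).
have -> : 4 * M * s * nc k ^+ 2 / d ^+ 3 = c * nc k * nc k by rewrite /c; ring.
rewrite ler_wpM2r ?nc_ge0//.
move: ke; rewrite ltr_pdivlMr; last by rewrite ltr_wpDl.
by have := nc_ge0 k; lra.
Qed.

End Density.

End CauchyTransform.

Section CauchyFormula2.
Variable R : realType.
Local Notation C := (Cplx R).

(** Cauchy's formula: the value of the integral is the same over all small circles
    about w, where it tends to f w by continuity alone. *)
Lemma cauchy_formula (f : C -> C) (p w : C) (s : R) : nc (w - p) < s ->
  (forall z, nc (z - p) <= s -> differentiable f z) ->
  f w = cauchy_transform p s (fun t => f (circle p s t)) 1 w.
Proof.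
move=> ws df; set Q := cauchy_transform _ _ _ _ _.
apply/eqP; rewrite eq_sym -subr_eq0 -nc_eq0; apply/negPn/negP => neq.
set eta := nc (Q - f w) in neq.
have eta0 : 0 < eta by rewrite lt_def neq nc_ge0.
have dfw : differentiable f w by apply: df; exact: ltW.
have e0 : 0 < eta / 4 by rewrite divr_gt0.
have := @differentiable_continuous _ _ _ w f dfw.
move=> /(cvg_ncP f (f w) (nbhs_filter w)).1 /(_ _ e0) /nbhs_ncP[dl dl0 hdl].
pose e := Num.min (dl / 2) (s - nc (w - p)).
have ee : 0 < e by rewrite lt_min divr_gt0//= subr_gt0.
have [e1 e2] : e < dl /\ nc (w - p) + e <= s.
  have h1 : e <= dl / 2 by rewrite ge_min lexx.
  have h2 : e <= s - nc (w - p) by rewrite ge_min lexx orbT.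
  by split; lra.
have E : Q = pathint 0 1 (fun t => f (circle w e t)).
  rewrite -(circle_homotopy ee e2 df); apply: eq_pathint => t _.
  by rewrite /cauchy_kernel expr1.
have near_w t : nc (circle w e t - w) <= e by rewrite nc_circle ger0_norm// ltW.
have cI : {within `[0, 1], continuous (fun t => f (circle w e t))}.
  apply: within_at => t _; apply: (continuous_comp (@continuous_circle R w e t)).
  apply/differentiable_continuous/df.
  by have := ncBD w (circle w e t) p; have := near_w t; lra.
have E2 : f w = pathint 0 1 (fun=> f w).
  by rewrite pathint_cst// subr0 mulr1.
have cw : {within `[(0 : R), 1], continuous (fun=> f w)} by exact: within_cst.
have : eta <= 2 * (eta / 4).
  rewrite {1}/eta E E2 -(pathintB cI cw).
  have := pathint_le (M := eta / 4) ler01 (withinB cI cw).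
  rewrite subr0 mulr1; apply => t _.
  by apply: ltW; apply: hdl; exact: le_lt_trans (near_w t) _.
lra.
Qed.

End CauchyFormula2.

(** * Cauchy estimates and isolated zeros on a disc *)

Section Disc.
Variable R : realType.
Local Notation C := (Cplx R).
Variables (p : C) (s : R).
Hypothesis s_gt0 : 0 < s.
Implicit Types (f g : C -> C) (w k : C).

Definition holo_disc f := forall z, nc (z - p) <= s -> differentiable f z.

Definition trace f (t : R) : C := f (circle p s t).

Lemma nc_circle_le t : nc (circle p s t - p) <= s.
Proof. by rewrite nc_circle ger0_norm// ltW. Qed.

Lemma within_trace f : holo_disc f -> {within `[0, 1], continuous (trace f)}.
Proof.
move=> df; apply: within_at => t _; apply: (continuous_comp (@continuous_circle R p s t)).
exact/differentiable_continuous/df/nc_circle_le.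
Qed.

Lemma nc_pp : nc (p - p) < s. Proof. by rewrite subrr nc0. Qed.

(** Near w, f coincides with the Cauchy transform of its boundary values, whose
    derivative is known. *)
Lemma derive_cauchy f w : holo_disc f -> nc (w - p) < s ->
  f^`()%classic w = cauchy_transform p s (trace f) 2 w.
Proof.
move=> df ws.
have [M fM] : exists M, forall t, 0 <= t <= 1 -> nc (trace f t) <= M.
  have cn : {within `[0, 1], continuous (fun t => Rep `|trace f t|)}.
    apply: (@within_comp _ _ _ _ (trace f) (fun z : C => Rep `|z|)) (within_trace df) _.
    move=> x _; apply: (continuous_comp (@norm_continuous _ C (trace f x))).
    exact: continuous_Re.
  have [c _ h] := EVT_max ler01 cn.
  by exists (Rep `|trace f c|) => t tt; apply: h; rewrite in_itv.
have [d1 d2] := cauchy_transform_derive s_gt0 (within_trace df) fM ws.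
rewrite -d2; apply: (proj2 (differentiable1_eps _)) => e e0.
have [dl dl0 hdl] := differentiable1_epsP d1 e0.
exists (Num.min dl (s - nc (w - p))); first by rewrite lt_min dl0 subr_gt0.
move=> k; rewrite lt_min => /andP[kdl ks].
have wks : nc (w + k - p) < s by have := ncD (w - p) k; rewrite addrAC; lra.
by rewrite (cauchy_formula ws df) (cauchy_formula wks df); exact: hdl.
Qed.

Section Bounded.
Variables (f : C -> C) (M : R).
Hypothesis df : holo_disc f.
Hypothesis fM : forall z, nc (z - p) <= s -> nc (f z) <= M.

Let M_ge0 : 0 <= M. Proof. by apply: le_trans (fM (ltW nc_pp)); exact: nc_ge0. Qed.

Let traceM t : 0 <= t <= 1 -> nc (trace f t) <= M.
Proof. by move=> _; apply: fM; exact: nc_circle_le. Qed.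

Let scenter : s <= s - nc (p - p). Proof. by rewrite subrr nc0 subr0. Qed.

(** The second derivative at the centre, given by Cauchy's formula. *)
Definition derive2 g : C := 2 * cauchy_transform p s (trace g) 3 p.

Lemma cauchy_estimate : nc (f^`()%classic p) <= 2 * M / s.
Proof.
rewrite (derive_cauchy df nc_pp).
apply: (le_trans (nc_cauchy_transform s_gt0 (within_trace df) traceM 2 s_gt0 scenter)).
by rewrite le_eqVlt; apply/orP; left; apply/eqP; field; rewrite gt_eqF.
Qed.

Lemma cauchy_estimate2 : nc (derive2 f) <= 4 * M / s ^+ 2.
Proof.
rewrite ncM -(rmorph_nat (real_complex R)) nc_real ger0_norm//.
have := nc_cauchy_transform s_gt0 (within_trace df) traceM 3 s_gt0 scenter.
have -> : 2 * (M * s / s ^+ 3) = 2 * M / s ^+ 2 by field; rewrite gt_eqF.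
lra.
Qed.

Lemma taylor1 k : nc k <= s / 2 ->
  nc (f (p + k) - f p - f^`()%classic p * k) <= 4 * M * nc k ^+ 2 / s ^+ 2.
Proof.
move=> ks; have pk : nc (p + k - p) < s by rewrite addrC addKr (le_lt_trans ks)//; have := s_gt0; lra.
rewrite (cauchy_formula nc_pp df) (cauchy_formula pk df) (derive_cauchy df nc_pp).
apply: (le_trans (cauchy_transform_taylor1 s_gt0 (within_trace df) traceM s_gt0 scenter ks)).
by rewrite le_eqVlt; apply/orP; left; apply/eqP; field; rewrite gt_eqF.
Qed.

Lemma lipschitz1 k : nc k <= s / 2 -> nc (f (p + k) - f p) <= 4 * M / s * nc k.
Proof.
move=> ks; have h1 := taylor1 ks; have h2 := cauchy_estimate.
have -> : f (p + k) - f p = (f (p + k) - f p - f^`()%classic p * k) + f^`()%classic p * k.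
  by rewrite subrK.
apply: (le_trans (ncD _ _)); rewrite ncM.
have h3 : 4 * M * nc k ^+ 2 / s ^+ 2 <= 2 * M / s * nc k.
  have -> : 4 * M * nc k ^+ 2 / s ^+ 2 = (4 * M / s ^+ 2 * nc k) * nc k by ring.
  rewrite ler_wpM2r ?nc_ge0//.
  have -> : 2 * M / s = 4 * M / s ^+ 2 * (s / 2) by field; rewrite gt_eqF.
  by rewrite ler_wpM2l// divr_ge0 ?exprn_ge0 ?mulr_ge0// ltW.
have h4 : nc (f^`()%classic p) * nc k <= 2 * M / s * nc k by rewrite ler_wpM2r ?nc_ge0.
apply: (le_trans (lerD (le_trans h1 h3) h4)).
by rewrite -mulrDl -mulrDl -mulrDl -natrD.
Qed.

Lemma taylor2 k : nc k <= s / 2 ->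
  nc (f^`()%classic (p + k) - f^`()%classic p - derive2 f * k) <= 32 * M * nc k ^+ 2 / s ^+ 3.
Proof.
move=> ks; have pk : nc (p + k - p) < s by rewrite addrC addKr (le_lt_trans ks)//; have := s_gt0; lra.
rewrite (derive_cauchy df pk) (derive_cauchy df nc_pp).
apply: (le_trans (cauchy_transform_taylor2 s_gt0 (within_trace df) traceM s_gt0 scenter ks)).
by rewrite le_eqVlt; apply/orP; left; apply/eqP; field; rewrite gt_eqF.
Qed.

Lemma derive_lipschitz k : nc k <= s / 2 ->
  nc (f^`()%classic (p + k) - f^`()%classic p) <= 20 * M / s ^+ 2 * nc k.
Proof.
move=> ks; have h1 := taylor2 ks; have h2 := cauchy_estimate2.
have -> : f^`()%classic (p + k) - f^`()%classic p =
  (f^`()%classic (p + k) - f^`()%classic p - derive2 f * k) + derive2 f * k.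
  by rewrite subrK.
apply: (le_trans (ncD _ _)); rewrite ncM.
have h3 : 32 * M * nc k ^+ 2 / s ^+ 3 <= 16 * M / s ^+ 2 * nc k.
  have -> : 32 * M * nc k ^+ 2 / s ^+ 3 = (32 * M / s ^+ 3 * nc k) * nc k by ring.
  rewrite ler_wpM2r ?nc_ge0//.
  have -> : 16 * M / s ^+ 2 = 32 * M / s ^+ 3 * (s / 2) by field; rewrite gt_eqF.
  by rewrite ler_wpM2l// divr_ge0 ?exprn_ge0 ?mulr_ge0// ltW.
have h4 : nc (derive2 f) * nc k <= 4 * M / s ^+ 2 * nc k by rewrite ler_wpM2r ?nc_ge0.
apply: (le_trans (lerD (le_trans h1 h3) h4)).
by rewrite -mulrDl -mulrDl -mulrDl -natrD.
Qed.

(** Dividing the boundary values by powers of z - p: as long as the Cauchy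
    transform vanishes at p, f gains a factor w - p. *)
Lemma vanish_of_cluster_zero :
  (forall e, 0 < e -> exists z, [/\ z != p, nc (z - p) < e & f z = 0]) ->
  forall w, nc (w - p) < s -> f w = 0.
Proof.
move=> zeros.
pose u n t := trace f t / (circle p s t - p) ^+ n.
have s_ge0 := ltW s_gt0.
have cp0 t : circle p s t - p != 0 by rewrite -nc_gt0 nc_circle ger0_norm.
have cu n : {within `[0, 1], continuous (u n)}.
  apply: (withinM (within_trace df)); apply: within_at => t _.
  apply: (@cvgV _ _ (nbhs t)); first by rewrite expf_neq0.
  have cg : circle p s x - p @[x --> t] --> circle p s t - p.
    by apply: (@cvgB _ _ _ (nbhs t)); [exact: continuous_circle|exact: cvg_cst].
  elim: n => [|n ih]; first by under eq_fun do rewrite expr0; exact: cvg_cst.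
  under eq_fun do rewrite exprS; rewrite exprS.
  exact: (@cvgM _ _ (nbhs t) _ (fun x => circle p s x - p)
    (fun x => (circle p s x - p) ^+ n) _ _ cg ih).
have uM n t : 0 <= t <= 1 -> nc (u n t) <= M / s ^+ n.
  move=> tt; rewrite /u ncM ncV ncX nc_circle ger0_norm//.
  by rewrite ler_wpM2r ?invr_ge0 ?exprn_ge0// traceM.
have divided n w : nc (w - p) < s -> cauchy_transform p s (u n) 1 w -
    cauchy_transform p s (u n) 1 p = (w - p) * cauchy_transform p s (u n.+1) 1 w.
  move=> ws; rewrite /cauchy_transform.
  rewrite -(pathintZ (w - p) (within_cauchy_kernel s_gt0 (cu n.+1) ws)).
  rewrite -(pathintB (within_cauchy_kernel s_gt0 (cu n) ws)
                     (within_cauchy_kernel s_gt0 (cu n) nc_pp)).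
  apply: eq_pathint => t _; rewrite /cauchy_kernel /u.
  have := circle_sub_neq0 s_gt0 t ws; have := cp0 t.
  have -> : circle p s t - w = (circle p s t - p) - (w - p) by rewrite opprB addrA subrK.
  move: (s%:CC * _) (trace f t) => sc ft.
  move: (circle p s t - p) (w - p) => v k v0 vk.
  rewrite !expr1 exprS; have vn : v ^+ n != 0 by rewrite expf_neq0.
  by move: (v ^+ n) vn => vn vn0; field; rewrite vn0 v0 vk.
have fn n w : nc (w - p) < s -> f w = (w - p) ^+ n * cauchy_transform p s (u n) 1 w.
  elim: n w => [|n ih] w ws.
    have -> : u 0%N = trace f by apply/funext => t; rewrite /u expr0 divr1.
    by rewrite expr0 mul1r; exact: (cauchy_formula ws df).
  suff c0 : cauchy_transform p s (u n) 1 p = 0.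
    by rewrite ih// exprSr -mulrA -divided// c0 subr0.
  apply/eqP; rewrite -nc_eq0; apply/negPn/negP => ne0.
  set eta := nc _ in ne0; have eta0 : 0 < eta by rewrite lt_def ne0 nc_ge0.
  have [dCT _] := cauchy_transform_derive s_gt0 (cu n) (@uM n) nc_pp.
  have := @differentiable_continuous _ _ _ p _ dCT.
  move=> /(cvg_ncP _ _ (nbhs_filter p)).1 /(_ _ eta0) /nbhs_ncP[dl dl0 hdl].
  have [] := zeros (Num.min dl s); first by rewrite lt_min dl0.
  move=> z [zp + fz]; rewrite lt_min => /andP[zdl zs].
  have := hdl z zdl.
  have -> : cauchy_transform p s (u n) 1 z = 0.
    have := ih z zs; rewrite fz => /esym/eqP; rewrite mulf_eq0 expf_eq0 subr_eq0.
    by rewrite (negbTE zp) andbF => /eqP.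
  by rewrite sub0r ncN -/eta ltxx.
move=> w ws.
apply/eqP; rewrite -nc_eq0; apply/negPn/negP => ne0.
set eta := nc _ in ne0; have eta0 : 0 < eta by rewrite lt_def ne0 nc_ge0.
pose d := s - nc (w - p); have d0 : 0 < d by rewrite subr_gt0.
pose q := nc (w - p) / s.
have q1 : `|q| < 1 by rewrite /q ger0_norm ?divr_ge0 ?nc_ge0// ltr_pdivrMr// mul1r.
pose c := 2 * M * s / d + 1.
have c0 : 0 < c by rewrite /c ltr_wpDl// divr_ge0 ?mulr_ge0// ltW.
have := cvg_expr q1; move=> /cvgrPdist_lt /(_ (eta / c)).
rewrite divr_gt0// => /(_ isT) [n _ /(_ n (leqnn n))].
rewrite /= sub0r normrN ger0_norm ?exprn_ge0 ?divr_ge0 ?nc_ge0// ltr_pdivlMr// => hn.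
have : eta <= q ^+ n * (2 * M * s / d).
  rewrite /eta (fn n w ws) ncM ncX.
  apply: (@le_trans _ _ (nc (w - p) ^+ n * (2 * (M / s ^+ n * s / d ^+ 1)))).
    rewrite ler_wpM2l ?exprn_ge0 ?nc_ge0//.
    exact: (nc_cauchy_transform s_gt0 (cu n) (@uM n) 1 d0 (lexx d)).
  rewrite le_eqVlt; apply/orP; left; apply/eqP; rewrite expr1 /q expr_div_n.
  have sn : s ^+ n != 0 by rewrite expf_neq0// gt_eqF.
  by move: (s ^+ n) (nc _ ^+ n) sn => sn x sn0; field; rewrite sn0 gt_eqF.
apply/negP; rewrite -ltNge; apply: le_lt_trans hn.
by rewrite ler_wpM2l ?exprn_ge0 ?divr_ge0 ?nc_ge0// /c lerDl.
Qed.

End Bounded.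

Lemma derive2B f g : holo_disc f -> holo_disc g ->
  derive2 (fun z => f z - g z) = derive2 f - derive2 g.
Proof.
move=> df dg; rewrite /derive2 -mulrBr; congr (_ * _).
rewrite /cauchy_transform.
rewrite -(pathintB (within_cauchy_kernel s_gt0 (within_trace df) nc_pp)
                   (within_cauchy_kernel s_gt0 (within_trace dg) nc_pp)).
by apply: eq_pathint => t _; rewrite /cauchy_kernel /trace !mulrBl.
Qed.

End Disc.

(** * Compactness and the identity theorem *)

Section Compactness.
Variable R : realType.
Local Notation C := (Cplx R).

Lemma bounded_ncP (A : set C) : bounded_set A -> exists2 M : R, 0 < M & forall z, A z -> nc z <= M.
Proof.
move=> [M0 [M0r hM]].
have e : M0 = (Rep M0)%:C%C by rewrite RRe_real.
exists (`|Rep M0| + 1); first by rewrite ltr_wpDl.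
move=> z Az; have := hM ((`|Rep M0| + 1)%:C%C).
rewrite {1}e ltcR (le_lt_trans (ler_norm _)) ?ltrDl// => /(_ isT z Az) /=.
by rewrite ncE lecR.
Qed.

Lemma compact_nc (K : set C) M : closed K -> (forall z, K z -> nc z <= M) -> compact K.
Proof.
move=> cK KM.
pose Q : set (R * R) := `[-M, M] `*` `[-M, M].
have cQ : compact Q by apply: compact_setX; exact: segment_compact.
pose F (q : R * R) : C := Complex q.1 q.2.
have cF : continuous F.
  by move=> q; apply: cvg_Complex; [exact: cvg_fst|exact: cvg_snd].
have cFQ : compact (F @` Q).
  by apply: continuous_compact => //; exact: continuous_subspaceT.
apply: (subclosed_compact cK cFQ) => z /KM zM.
exists (Rep z, Imp z); last by rewrite /F; case: z {zM}.
by split; rewrite /= in_itv/= -ler_norml; apply: le_trans zM; [exact: nc_Re|exact: nc_Im].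
Qed.

(** Compactness of the closure leaves a uniform margin around the set. *)
Lemma uniform_margin (S W : set C) M : open W -> closure S `<=` W ->
  (forall z, W z -> nc z <= M) ->
  exists2 e : R, 0 < e & forall x y, S x -> nc (y - x) <= e -> W y.
Proof.
move=> oW SW WM.
have cS : compact (closure S).
  by apply: (compact_nc (M := M)); [exact: closed_closure|move=> z /SW/WM].
have /compact_near_coveringP := cS.
move=> /(_ R (0^'+)%R (fun e x => forall y, nc (y - x) <= e -> W y) _) H.
have {}H : \forall e \near (0 : R)^'+, closure S `<=` (fun x => forall y, nc (y - x) <= e -> W y).
  apply: H => x /SW Wx.
  have [r r0 hr] := (nbhs_ncP x W).1 (oW x Wx).
  exists ([set x' : C | nc (x' - x) < r / 2], [set e : R | e < r / 2]) => /=.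
    split; first by apply/nbhs_ncP; exists (r / 2); rewrite ?divr_gt0.
    by apply: nbhs_right_lt; rewrite divr_gt0.
  move=> [x' e] [/= xx' er] y yx'; apply: hr.
  by have := ncBD x' y x; lra.
near (0 : R)^'+ => e.
exists e; first by near: e; exact: nbhs_right_gt.
move=> x y /subset_closure Sx.
have : closure S `<=` (fun x => forall y, nc (y - x) <= e -> W y) by near: e.
by move=> /(_ x Sx); apply.
Unshelve. all: by end_near. Qed.

End Compactness.

Section Identity.
Variable R : realType.
Local Notation C := (Cplx R).

Lemma open_disc (W : set C) x : open W -> W x ->
  exists2 r : R, 0 < r & forall y, nc (y - x) <= r -> W y.
Proof.
move=> oW Wx; have [r r0 hr] := (nbhs_ncP x W).1 (oW x Wx).
exists (r / 2); first by rewrite divr_gt0.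
by move=> y yx; apply: hr; rewrite (le_lt_trans yx)// ltr_pdivrMr// ltr_pMr// ltr1n.
Qed.

(** The points near which f vanishes form a relatively clopen part of W: a disc
    centred at such a point close to a limit point contains the limit point. *)
Lemma identity_theorem (W A : set C) (f : C -> C) (M : R) (p : C) :
  open W -> (forall z, W z -> differentiable f z) -> (forall z, W z -> nc (f z) <= M) ->
  connected A -> A `<=` W -> A p ->
  (forall e : R, 0 < e -> exists z, [/\ z != p, nc (z - p) < e & f z = 0]) ->
  forall x, A x -> f x = 0.
Proof.
move=> oW df fM cA AW Ap zp.
pose Z := [set z : C | exists2 e : R, 0 < e & forall y, nc (y - z) < e -> f y = 0].
have disc0 q s : 0 < s -> (forall y, nc (y - q) <= s -> W y) ->
    (forall e : R, 0 < e -> exists z, [/\ z != q, nc (z - q) < e & f z = 0]) ->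
    forall w, nc (w - q) < s -> f w = 0.
  move=> s0 qW; apply: (vanish_of_cluster_zero s0 (M := M)).
    by move=> z /qW/df.
  by move=> z /qW/fM.
have oZ : open Z.
  move=> z [e e0 he]; apply/nbhs_ncP; exists (e / 2); first by rewrite divr_gt0.
  move=> y yz; exists (e / 2); first by rewrite divr_gt0.
  by move=> x xy; apply: he; have := ncBD y x z; lra.
have Zp : Z p.
  have [r r0 hr] := open_disc oW (AW _ Ap).
  by exists r => //; exact: disc0.
have ZA : A `&` closure Z `<=` Z.
  move=> x [Ax Zx]; have [r r0 hr] := open_disc oW (AW _ Ax).
  have r2 : 0 < r / 2 by rewrite divr_gt0.
  have [z [[e e0 he] zx]] : Z `&` [set y : C | nc (y - x) < r / 4] !=set0.
    by apply: Zx; apply/nbhs_ncP; exists (r / 4); rewrite ?divr_gt0.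
  rewrite /= in zx.
  exists (r / 4); first by rewrite divr_gt0.
  move=> y yx; apply: (disc0 z (r / 2)) => //.
  - by move=> w wz; apply: hr; have := ncBD z w x; lra.
  - move=> e' e'0; pose m := Num.min e e' / 2.
    have m0 : 0 < m by rewrite divr_gt0// lt_min e0.
    have me : m < e /\ m < e'.
      have h1 : Num.min e e' <= e by rewrite ge_min lexx.
      have h2 : Num.min e e' <= e' by rewrite ge_min lexx orbT.
      have : Num.min e e' = m * 2 by rewrite /m divfK.
      by split; lra.
    have nm : nc (z + m%:CC - z) = m by rewrite addrC addKr nc_real ger0_norm// ltW.
    exists (z + m%:CC); split.
    + by rewrite -subr_eq0 -nc_eq0 nm gt_eqF.
    + by rewrite nm; case: me.
    + by apply: he; rewrite nm; case: me.
  - by have := ncBD x y z; rewrite (ncC x z); lra.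
have AZ : A `&` Z = A.
  apply: cA; first by exists p.
    by exists Z.
  exists (closure Z); first exact: closed_closure.
  apply/seteqP; split => x [Ax Zx]; split => //; first exact: subset_closure.
  by apply: ZA.
move=> x; rewrite -AZ => -[_ [e e0 he]]; apply: he.
by rewrite subrr nc0.
Qed.

End Identity.

(** * Boundedness and slices of the elements of B *)

Section PairTopology.
Variable R : realType.
Local Notation C := (Cplx R).

Lemma nbhs2_ncP (z : C * C) (A : set (C * C)) :
  nbhs z A <-> exists2 e : R, 0 < e &
    forall y, nc (y.1 - z.1) < e -> nc (y.2 - z.2) < e -> A y.
Proof.
split.
  move=> [[A1 A2] /= [/nbhs_ncP[e1 e10 h1] /nbhs_ncP[e2 e20 h2]] hA].
  exists (Num.min e1 e2); first by rewrite lt_min e10.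
  move=> y; rewrite !lt_min => /andP[y1 _] /andP[_ y2]; apply: hA; split => /=.
    exact: h1.
  exact: h2.
move=> [e e0 he]; exists ([set y | nc (y - z.1) < e], [set y | nc (y - z.2) < e]) => /=.
  by split; apply/nbhs_ncP; exists e.
by move=> y [/=] /he; apply.
Qed.

Lemma cvg_within2P (A : set (C * C)) (z : C * C) (f : C * C -> C) (l : C) :
  (f y @[y --> within A (nbhs z)] --> l) <->
  forall e : R, 0 < e -> exists2 d : R, 0 < d & forall y, A y ->
    nc (y.1 - z.1) < d -> nc (y.2 - z.2) < d -> nc (f y - l) < e.
Proof.
have FF : Filter (within A (nbhs z)) by exact: within_filter.
split=> [/(cvg_ncP _ _ FF) h e /h /nbhs2_ncP[d d0 hd]|h].
  by exists d => // y Ay y1 y2; exact: hd.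
apply/(cvg_ncP _ _ FF) => e /h[d d0 hd].
by apply/nbhs2_ncP; exists d => // y y1 y2 Ay; exact: hd.
Qed.

Lemma within_closure_le (A : set (C * C)) (f : C * C -> C) M :
  {within closure A, continuous f} -> (forall z, A z -> nc (f z) <= M) ->
  forall z, closure A z -> nc (f z) <= M.
Proof.
move=> /withinP cf fM z Az; rewrite leNgt; apply/negP => Mf.
have e0 : 0 < nc (f z) - M by rewrite subr_gt0.
have [d d0 hd] := (cvg_within2P _ _ _ _).1 (cf z Az) _ e0.
have [y [Ay [y1 y2]]] : A `&` [set y | nc (y.1 - z.1) < d /\ nc (y.2 - z.2) < d] !=set0.
  by apply: Az; apply/nbhs2_ncP; exists d.
have := hd y (subset_closure Ay) y1 y2; have := fM y Ay.
by have := ncBD (f y) (f z) 0; rewrite !subr0 (ncC (f z)); lra.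
Qed.

End PairTopology.

Section SpaceB.
Variables (R : realType) (rho : R) (W : set (Cplx R)) (MW : R).
Local Notation C := (Cplx R).
Hypothesis rho_gt0 : 0 < rho.
Hypothesis W_open : open W.
Hypothesis W_le : forall z, W z -> nc z <= MW.
Local Notation D := (strip rho `*` W).
Implicit Types (f g h : C * C -> C) (theta x y : C).

Definition closed_strip : set C := [set z : C | `|Imp z| <= rho].

Lemma Im_real_shift theta (o : R) : Imp (theta + o%:CC) = Imp theta.
Proof. by case: theta => a b /=; rewrite addr0. Qed.

Lemma strip_shift theta (o : R) : strip rho theta -> strip rho (theta + o%:CC).
Proof. by rewrite /strip/= Im_real_shift. Qed.

Lemma closed_strip_shift theta (o : R) : closed_strip theta -> closed_strip (theta + o%:CC).
Proof. by rewrite /closed_strip/= Im_real_shift. Qed.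

Lemma strip_real (t : R) : strip rho t%:CC.
Proof. by rewrite /strip /= normr0. Qed.

Lemma strip_closed_strip theta : strip rho theta -> closed_strip theta.
Proof. exact: ltW. Qed.

Lemma strip_room theta : strip rho theta ->
  exists2 s : R, 0 < s & forall z, nc (z - theta) <= s -> strip rho z.
Proof.
move=> st; exists ((rho - `|Imp theta|) / 2); first by rewrite divr_gt0// subr_gt0.
move=> z zs; rewrite /strip /=.
have h1 := le_trans (nc_Im _) zs.
have h2 : Imp z = Imp (z - theta) + Imp theta by rewrite -raddfD subrK.
have h3 := ler_normD (Imp (z - theta)) (Imp theta).
rewrite /strip/= in st; rewrite h2; lra.
Qed.

Lemma open_strip : open (strip rho : set C).
Proof.
move=> z /strip_room[s s0 hs]; apply/nbhs_ncP; exists s => // y /ltW; exact: hs.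
Qed.

Lemma closure_D theta x : closure D (theta, x) <-> closed_strip theta /\ closure W x.
Proof.
split.
  move=> cD; split.
    rewrite /closed_strip /= leNgt; apply/negP => rI.
    have e0 : 0 < `|Imp theta| - rho by rewrite subr_gt0.
    have [y [[/= y1 _]]] : D `&` [set y | nc (y.1 - theta) < `|Imp theta| - rho] !=set0.
      by apply: cD; apply/nbhs2_ncP; exists (`|Imp theta| - rho).
    have h1 := nc_Im (theta - y.1); rewrite ncC => h2.
    have h3 := ler_normD (Imp (theta - y.1)) (Imp y.1).
    rewrite -raddfD subrK in h3; rewrite /strip/= in y1; lra.
  move=> A /nbhs_ncP[e e0 he].
  have [y [[/= _ y2] yx]] : D `&` [set y | nc (y.2 - x) < e] !=set0.
    by apply: cD; apply/nbhs2_ncP; exists e.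
  by exists y.2; split => //; exact: he.
move=> [ct cx] A /nbhs2_ncP[e e0 he].
have [y [Wy yx]] : W `&` [set y | nc (y - x) < e] !=set0.
  by apply: cx; apply/nbhs_ncP; exists e.
pose r := Num.min (1 / 2) (e / (2 * rho)).
have r0 : 0 < r by rewrite lt_min !divr_gt0// mulr_gt0.
have r1 : r <= 1 / 2 by rewrite ge_min lexx.
have r2 : r * (2 * rho) <= e.
  by rewrite -ler_pdivlMr ?mulr_gt0// ge_min lexx orbT.
have ct' : `|Imp theta| <= rho by exact: ct.
(* Shrinking the imaginary part moves theta into the open strip. *)
pose th : C := Complex (Rep theta) ((1 - r) * Imp theta).
exists (th, y); split.
  split => //=; rewrite /strip /= normrM ger0_norm; last lra.
  apply: (@le_lt_trans _ _ ((1 - r) * rho)); first by rewrite ler_wpM2l//; lra.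
  by rewrite gtr_pMl//; lra.
apply: he => //=.
have -> : th - theta = Complex 0 (- r * Imp theta).
  rewrite /th; case: (theta) => a b; apply/eqP; rewrite eq_complex /=.
  by apply/andP; split; apply/eqP; ring.
apply: (le_lt_trans (nc_le _)) => /=; rewrite normr0 add0r normrM normrN (gtr0_norm r0).
apply: (@le_lt_trans _ _ (r * rho)); first by rewrite ler_wpM2l// ltW.
lra.
Qed.

Lemma subset_closure_D theta x : closed_strip theta -> W x -> closure D (theta, x).
Proof. by move=> ct Wx; apply/closure_D; split => //; exact: subset_closure. Qed.

Lemma closed_strip_real (t : R) : closed_strip t%:CC.
Proof. exact/strip_closed_strip/strip_real. Qed.

(** By periodicity it is enough to bound f over one compact period. *)
Lemma inB_bounded f : inB rho W f -> exists2 M : R, 0 <= M & forall z, D z -> nc (f z) <= M.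
Proof.
move=> [_ cf _ pf].
pose K1 := [set z : C | 0 <= Rep z <= 1 /\ `|Imp z| <= rho].
have cK1 : compact K1.
  apply: (compact_nc (M := 1 + rho)).
    have -> : K1 = (@complex.Re R @^-1` `[0, 1]) `&` (@complex.Im R @^-1` `[-rho, rho]).
      by apply/seteqP; split => z; rewrite /K1 /= !in_itv/= ler_norml.
    apply: closedI.
      by apply: ((continuous_closedP _).1 (@continuous_Re R)); exact: interval_closed.
    by apply: ((continuous_closedP _).1 (@continuous_Im R)); exact: interval_closed.
  move=> z [/andP[z0 z1] zr]; apply: (le_trans (nc_le _)).
  by rewrite lerD// ger0_norm.
have cW : compact (closure W).
  apply: (compact_nc (M := MW)); first exact: closed_closure.
  move=> z Wz; rewrite leNgt; apply/negP => h.
  have e0 : 0 < nc z - MW by rewrite subr_gt0.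
  have [y [Wy /= yz]] : W `&` [set y | nc (y - z) < nc z - MW] !=set0.
    by apply: Wz; apply/nbhs_ncP; exists (nc z - MW).
  have := W_le Wy; have := ncBD y z 0; rewrite !subr0 (ncC z); lra.
have cK : compact (K1 `*` closure W) by exact: compact_setX.
have KD : K1 `*` closure W `<=` closure D.
  by move=> [theta x] [/= [_ h1] h2]; apply/closure_D.
have cfn : {within K1 `*` closure W, continuous (fun z => Rep `|f z|)}.
  apply: (@within_comp _ _ _ _ f (fun z : C => Rep `|z|)) => [|z _].
    exact: continuous_subspaceW KD cf.
  apply: (continuous_comp (@norm_continuous _ C (f z))); exact: continuous_Re.
have cI := continuous_compact cfn cK.
have [M [_ hM]] := compact_bounded cI.
exists (`|M| + 1); first by rewrite addr_ge0.
have bound theta x : K1 theta -> W x -> nc (f (theta, x)) <= `|M| + 1.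
  move=> K1t Wx.
  have := hM (`|M| + 1); rewrite (le_lt_trans (ler_norm _)) ?ltrDl// => /(_ isT).
  move=> /(_ (nc (f (theta, x)))) /=; rewrite ger0_norm ?nc_ge0//; apply.
  by exists (theta, x) => //; split => //=; exact: subset_closure.
have shift (n : nat) theta x : strip rho theta -> W x ->
    f (theta + n%:R%:CC, x) = f (theta, x).
  move=> st Wx; elim: n => [|n ih]; first by rewrite addr0.
  rewrite -ih -[in LHS]natr1 rmorphD /= addrA.
  by rewrite -[RHS]pf//; exact: (strip_shift n%:R st).
move=> [theta x] [/= st Wx].
(* theta is translated into the period 0 <= Re theta <= 1. *)
pose fl := Num.floor (Rep theta).
have [fl1 fl2] : fl%:~R <= Rep theta /\ Rep theta < fl%:~R + 1.
  by have /andP[h1 h2] := floor_itv (Rep theta); rewrite intrD in h2.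
have stt : strip rho (theta + (- fl%:~R)%:CC) by exact: strip_shift.
have -> : f (theta, x) = f (theta + (- fl%:~R)%:CC, x).
  case: fl fl1 fl2 stt => n fl1 fl2 stt.
    rewrite -(shift n _ x stt Wx); congr (f (_, _)).
    by rewrite -addrA -(rmorphD (real_complex R)) addNr addr0.
  rewrite NegzE mulrNz opprK in stt *.
  by rewrite (shift n.+1 _ x st Wx).
apply: bound => //; split; last first.
  by rewrite Im_real_shift; exact: ltW.
have -> : Rep (theta + (- fl%:~R)%:CC) = Rep theta - fl%:~R by case: (theta).
by apply/andP; split; lra.
Qed.

Lemma slice_x f theta x : inB rho W f -> strip rho theta -> W x ->
  differentiable (fun y => f (theta, y)) x.
Proof.
move=> [df _ _ _] st Wx.
have dp : differentiable (fun y : C => (theta, y)) x.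
  by apply: differentiable_pair; [exact: differentiable_cst|exact: ex_diff].
exact: (@differentiable_comp _ _ _ _ (fun y : C => (theta, y)) f x dp (df (theta, x) (conj st Wx))).
Qed.

Lemma slice_theta f theta x : inB rho W f -> strip rho theta -> W x ->
  differentiable (fun y => f (y, x)) theta.
Proof.
move=> [df _ _ _] st Wx.
have dp : differentiable (fun y : C => (y, x)) theta.
  by apply: differentiable_pair; [exact: ex_diff|exact: differentiable_cst].
exact: (@differentiable_comp _ _ _ _ (fun y : C => (y, x)) f theta dp (df (theta, x) (conj st Wx))).
Qed.

End SpaceB.

(** * Holomorphy and boundary continuity of the derivative in x *)

Lemma quadratic_le (R : realFieldType) (c1 c2 c3 a b e : R) :
  0 <= c1 -> 0 <= c2 -> 0 <= c3 -> 0 <= a -> 0 <= b ->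
  a * (c1 + c2 + c3) <= e -> b * (c1 + c2 + c3) <= e ->
  c1 * b ^+ 2 + c2 * a * b + c3 * a ^+ 2 <= e * (a + b).
Proof.
move=> c10 c20 c30 a0 b0 ha hb.
have q1 := ler_wpM2l a0 ha; have q2 := ler_wpM2l b0 hb.
have q3 : 0 <= c2 * (a ^+ 2 + b ^+ 2 - a * b) by rewrite mulr_ge0//; nra.
have q4 : 0 <= c1 * a ^+ 2 by rewrite mulr_ge0// sqr_ge0.
have q5 : 0 <= c3 * b ^+ 2 by rewrite mulr_ge0// sqr_ge0.
lra.
Qed.

Section Slices.
Variables (R : realType) (rho : R) (W : set (Cplx R)).
Local Notation C := (Cplx R).
Local Notation ec := (@unit_circle R).
Hypothesis rho_gt0 : 0 < rho.
Local Notation D := (strip rho `*` W).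
Variables (f : C * C -> C) (M : R).
Hypothesis fB : inB rho W f.
Hypothesis fM : forall z, D z -> nc (f z) <= M.
Implicit Types (theta x y w k : C).

Let cf : {within closure D, continuous f}. Proof. by case: fB. Qed.

Lemma bound_closed theta x : closed_strip rho theta -> W x -> nc (f (theta, x)) <= M.
Proof.
by move=> ct Wx; apply: (within_closure_le cf fM); exact: subset_closure_D.
Qed.

Section OneDisc.
Variables (y0 : C) (s : R).
Hypothesis s_gt0 : 0 < s.
Hypothesis discW : forall y, nc (y - y0) <= s -> W y.

Definition slice_trace theta (t : R) : C := f (theta, circle y0 s t).

Let circleW t : W (circle y0 s t).
Proof. by apply: discW; exact: nc_circle_le. Qed.

Lemma within_slice_trace theta : closed_strip rho theta ->
  {within `[0, 1], continuous (slice_trace theta)}.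
Proof.
move=> ct; apply: within_at => t _; apply/(cvg_ncP _ _ (nbhs_filter t)) => e e0.
have /withinP/(_ _ (subset_closure_D rho_gt0 ct (circleW t))) := cf.
move=> /cvg_within2P/(_ _ e0)[d d0 hd].
have := @continuous_circle R y0 s t; move=> /(cvg_ncP _ _ (nbhs_filter t))/(_ d d0).
apply: filterS => t' tt'; apply: hd => //=.
  exact: subset_closure_D.
by rewrite subrr nc0.
Qed.

Lemma slice_traceM theta t : closed_strip rho theta -> nc (slice_trace theta t) <= M.
Proof. by move=> ct; apply: bound_closed. Qed.

(** On the compact circle f is uniformly continuous up to the edges of the strip. *)
Lemma cauchy_transform_cvg theta0 n w : closed_strip rho theta0 -> nc (w - y0) < s ->
  cauchy_transform y0 s (slice_trace theta) n w @[theta --> within (closed_strip rho) (nbhs theta0)]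
  --> cauchy_transform y0 s (slice_trace theta0) n w.
Proof.
move=> ct ws.
have d0 : 0 < s - nc (w - y0) by rewrite subr_gt0.
set d := s - nc (w - y0) in d0.
apply: pathint_cvg.
- exact: ler01.
- near=> theta; apply: (within_cauchy_kernel s_gt0) ws; apply: within_slice_trace.
  by near: theta; exact: withinT.
- by apply: (within_cauchy_kernel s_gt0) ws; exact: within_slice_trace.
- move=> t tt e e0.
  pose c := s / d ^+ n + 1.
  have c0 : 0 < c by rewrite ltr_wpDl// divr_ge0 ?exprn_ge0// ltW.
  have ec0 : 0 < e / c / 2 by rewrite !divr_gt0.
  have /withinP/(_ _ (subset_closure_D rho_gt0 ct (circleW t))) := cf.
  move=> /cvg_within2P/(_ _ ec0)[r r0 hr].
  exists ([set t' : R | nc (circle y0 s t' - circle y0 s t) < r],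
          [set theta : C | closed_strip rho theta /\ nc (theta - theta0) < r]) => /=.
    split.
      exact: (cvg_ncP _ _ (nbhs_filter t)).1 (@continuous_circle R y0 s t) r r0.
    by apply/nbhs_ncP; exists r.
  move=> [t' theta] [/= tr [cth thr]] tt'.
  have h1 := hr (theta, circle y0 s t') (subset_closure_D rho_gt0 cth (circleW t')) thr tr.
  have h2 := hr (theta0, circle y0 s t') (subset_closure_D rho_gt0 ct (circleW t')).
  rewrite /= subrr nc0 in h2; have {}h2 := h2 r0 tr.
  have h3 : nc (slice_trace theta t' - slice_trace theta0 t') <= e / c.
    have := ncBD (f (theta0, circle y0 s t)) (f (theta, circle y0 s t')) (f (theta0, circle y0 s t')).
    by rewrite (ncC (f (theta0, circle y0 s t))) /slice_trace; lra.
  rewrite /cauchy_kernel -!mulrA -mulrBl ncM.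
  have h4 : nc (s%:CC * (ec t' / (circle y0 s t' - w) ^+ n)) <= c.
    rewrite !ncM nc_unit_circle mul1r ncV ncX nc_real (ger0_norm (ltW s_gt0)).
    apply: (@le_trans _ _ (s / d ^+ n)); last by rewrite lerDl.
    rewrite ler_wpM2l ?(ltW s_gt0)//.
    have h := @circle_sub_ge R y0 s s_gt0 w t'.
    have h' : d ^+ n <= nc (circle y0 s t' - w) ^+ n.
      by rewrite lerXn2r ?nnegrE ?(ltW d0) ?nc_ge0.
    by rewrite lef_pV2// posrE ?(lt_le_trans _ h') ?exprn_gt0.
  apply: (le_trans (ler_pM (nc_ge0 _) (nc_ge0 _) h3 h4)).
  by rewrite divfK// gt_eqF.
Unshelve. all: by end_near. Qed.

(** Holomorphy in x passes to the edges of the strip, through the integral formula. *)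
Lemma slice_cauchy theta w : closed_strip rho theta -> nc (w - y0) < s ->
  f (theta, w) = cauchy_transform y0 s (slice_trace theta) 1 w.
Proof.
move=> ct ws; apply/eqP; rewrite -subr_eq0 -nc_eq0; apply/negPn/negP => ne0.
set eta := nc _ in ne0; have eta0 : 0 < eta by rewrite lt_def ne0 nc_ge0.
have e2 : 0 < eta / 2 by rewrite divr_gt0.
have Ww : W w by apply: discW; exact: ltW.
have FF : Filter (within (closed_strip rho) (nbhs theta)) by exact: within_filter.
have := cauchy_transform_cvg (n := 1) ct ws.
move=> /(cvg_ncP _ _ FF)/(_ _ e2)/nbhs_ncP[d1 d10 h1].
have /withinP/(_ _ (subset_closure_D rho_gt0 ct Ww)) := cf.
move=> /cvg_within2P/(_ _ e2)[d2 d20 h2].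
have [[theta' w'] [[/= st _] [t1 t2]]] : D `&`
    [set z | nc (z.1 - theta) < d1 /\ nc (z.1 - theta) < d2] !=set0.
  apply: (subset_closure_D rho_gt0 ct Ww); apply/nbhs2_ncP; exists (Num.min d1 d2).
    by rewrite lt_min d10.
  by move=> z; rewrite lt_min => /andP[].
have ct' := strip_closed_strip st.
have {}h1 := h1 _ t1 ct'.
have := h2 (theta', w) (subset_closure_D rho_gt0 ct' Ww) t2.
rewrite /= subrr nc0 => /(_ d20) {}h2.
have E : f (theta', w) = cauchy_transform y0 s (slice_trace theta') 1 w.
  apply: (@cauchy_formula _ (fun x => f (theta', x)) y0 w s ws) => z zs.
  by apply: (slice_x fB st); exact: discW.
move: h1 h2; rewrite E => h1 h2.
have := ncBD (cauchy_transform y0 s (slice_trace theta') 1 w) (f (theta, w))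
   (cauchy_transform y0 s (slice_trace theta) 1 w).
by rewrite -/eta (ncC (f (theta, w))); lra.
Qed.

(** Up to the edges of the strip, f(theta, .) is a Cauchy transform, hence holomorphic. *)
Lemma slice_differentiable_center theta : closed_strip rho theta ->
  differentiable (fun x => f (theta, x)) y0.
Proof.
move=> ct.
have ws : nc (y0 - y0) < s by rewrite subrr nc0.
have [d1 d2] := cauchy_transform_derive s_gt0 (within_slice_trace ct)
  (fun t _ => slice_traceM t ct) ws.
apply: (proj1 (differentiable1_eps (d := (cauchy_transform y0 s (slice_trace theta) 1)^`()%classic y0) _)) => e e0.
have [dl dl0 hdl] := differentiable1_epsP d1 e0.
exists (Num.min dl s); first by rewrite lt_min dl0.
move=> k; rewrite lt_min => /andP[kdl ks].
have wks : nc (y0 + k - y0) < s by rewrite addrC addKr.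
by rewrite (slice_cauchy ct ws) (slice_cauchy ct wks); exact: hdl.
Qed.

End OneDisc.

Hypothesis W_open : open W.

Lemma slice_differentiable theta x : closed_strip rho theta -> W x ->
  differentiable (fun x => f (theta, x)) x.
Proof.
move=> ct Wx; have [s s0 hs] := open_disc W_open Wx.
exact: (slice_differentiable_center s0 hs ct).
Qed.

Lemma slice_holo theta y s : closed_strip rho theta -> (forall x, nc (x - y) <= s -> W x) ->
  holo_disc y s (fun x => f (theta, x)).
Proof. by move=> ct hs z /hs; exact: slice_differentiable. Qed.

Section Estimates.
Variables (theta y : C) (s : R).
Hypothesis ct : closed_strip rho theta.
Hypothesis s_gt0 : 0 < s.
Hypothesis discW : forall x, nc (x - y) <= s -> W x.

Let hb z : nc (z - y) <= s -> nc (f (theta, z)) <= M.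
Proof. by move=> /discW; exact: bound_closed. Qed.

Lemma dx_le : nc (dx f (theta, y)) <= 2 * M / s.
Proof. exact: (cauchy_estimate s_gt0 (slice_holo ct discW) hb). Qed.

Lemma slice_lipschitz k : nc k <= s / 2 ->
  nc (f (theta, y + k) - f (theta, y)) <= 4 * M / s * nc k.
Proof. exact: (lipschitz1 s_gt0 (slice_holo ct discW) hb). Qed.

Lemma slice_taylor k : nc k <= s / 2 ->
  nc (f (theta, y + k) - f (theta, y) - dx f (theta, y) * k) <= 4 * M * nc k ^+ 2 / s ^+ 2.
Proof. exact: (taylor1 s_gt0 (slice_holo ct discW) hb). Qed.

Lemma dx_lipschitz k : nc k <= s / 2 ->
  nc (dx f (theta, y + k) - dx f (theta, y)) <= 20 * M / s ^+ 2 * nc k.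
Proof. exact: (derive_lipschitz s_gt0 (slice_holo ct discW) hb). Qed.

Lemma dx_cauchy : dx f (theta, y) = cauchy_transform y s (slice_trace y s theta) 2 y.
Proof.
by apply: (derive_cauchy s_gt0 (slice_holo ct discW)); rewrite subrr nc0.
Qed.

End Estimates.

(** In x the derivative is Lipschitz with a constant common to all theta; at fixed x
    it is a Cauchy transform, which depends continuously on theta. *)
Lemma dx_continuous theta0 y0 : closed_strip rho theta0 -> W y0 ->
  dx f z @[z --> within (closed_strip rho `*` W) (nbhs (theta0, y0))] --> dx f (theta0, y0).
Proof.
move=> ct Wy; have [s s0 hs] := open_disc W_open Wy.
apply/cvg_within2P => e e0.
have M0 : 0 <= M by apply: le_trans (bound_closed ct Wy); exact: nc_ge0.
have ws : nc (y0 - y0) < s by rewrite subrr nc0.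
have e2 : 0 < e / 2 by rewrite divr_gt0.
have FF : Filter (within (closed_strip rho) (nbhs theta0)) by exact: within_filter.
have := cauchy_transform_cvg s0 hs (n := 2) ct ws.
move=> /(cvg_ncP _ _ FF)/(_ _ e2)/nbhs_ncP[d1 d10 h1].
pose c := 20 * M / s ^+ 2 + 1.
have c0 : 0 < c by rewrite ltr_wpDl// divr_ge0 ?mulr_ge0 ?exprn_ge0// ltW.
exists (Num.min d1 (Num.min (s / 2) (e / 2 / c))).
  by rewrite !lt_min d10 !divr_gt0.
move=> [theta y] [/= cth Wy']; rewrite !lt_min => /andP[t1 _] /and3P[_ y1 y2].
have {}h1 := h1 _ t1 cth.
rewrite -(dx_cauchy cth s0 hs) -(dx_cauchy ct s0 hs) in h1.
have h2 := dx_lipschitz cth s0 hs (ltW y1).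
rewrite (addrC y0) subrK in h2.
have h3 : 20 * M / s ^+ 2 * nc (y - y0) <= e / 2.
  move: y2; rewrite ltr_pdivlMr// => y2.
  apply: le_trans (ltW y2); rewrite mulrC ler_wpM2l ?nc_ge0//.
  by rewrite lerDl.
move: h1 (le_trans h2 h3) => {h2 h3}.
move: (dx f (theta, y)) (dx f (theta, y0)) (dx f (theta0, y0)) => a b c' h1 h2.
by have := ncBD b a c'; lra.
Qed.

Definition dtheta (z : C * C) : C := (fun th : C => f (th, z.2))^`()%classic z.1.

Section Theta.
Variables (theta0 : C) (sg : R).
Hypothesis sg_gt0 : 0 < sg.
Hypothesis discS : forall z, nc (z - theta0) <= sg -> strip rho z.

Let holo_theta x : W x -> holo_disc theta0 sg (fun th => f (th, x)).
Proof. by move=> Wx z /discS st; exact: (slice_theta fB st Wx). Qed.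

Let boundth x : W x -> forall z, nc (z - theta0) <= sg -> nc (f (z, x)) <= M.
Proof. by move=> Wx z /discS st; exact: (@fM (z, x) (conj st Wx)). Qed.

(** Cauchy's estimate in theta, applied to the difference of two slices. *)
Lemma dtheta_continuous x : W x -> {for x, continuous (fun x => dtheta (theta0, x))}.
Proof.
move=> Wx; have [s s0 hs] := open_disc W_open Wx.
apply/(cvg_ncP _ _ (nbhs_filter x)) => e e0.
have st0 : strip rho theta0 by apply: discS; rewrite subrr nc0 ltW.
have M0 : 0 <= M.
  by apply: le_trans (@fM (theta0, x) (conj st0 Wx)); exact: nc_ge0.
pose c := 2 * (4 * M / s) / sg + 1.
have c0 : 0 < c by rewrite ltr_wpDl// !(divr_ge0, mulr_ge0)// ltW.
apply/nbhs_ncP; exists (Num.min (s / 2) (e / c)); first by rewrite lt_min !divr_gt0.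
move=> x'; rewrite lt_min => /andP[x1 x2].
have Wx' : W x' by apply: hs; rewrite (le_trans (ltW x1))// ler_pdivrMr// ler_pMr// ler1n.
pose g th := f (th, x') - f (th, x).
have dg : holo_disc theta0 sg g.
  by move=> z zs; apply: differentiableB; exact: holo_theta.
have st00 : nc (theta0 - theta0) <= sg by rewrite subrr nc0 ltW.
have -> : dtheta (theta0, x') - dtheta (theta0, x) = g^`()%classic theta0.
  rewrite /dtheta /= !derive1E.
  have := @deriveB _ _ _ (fun th : C => f (th, x')) (fun th : C => f (th, x)) theta0 1.
  move=> ->//; apply: diff_derivable; exact: holo_theta.
have gM z : nc (z - theta0) <= sg -> nc (g z) <= 4 * M / s * nc (x' - x).
  move=> /discS st; have := slice_lipschitz (strip_closed_strip st) s0 hs (ltW x1).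
  by rewrite (addrC x) subrK.
apply: (le_lt_trans (cauchy_estimate sg_gt0 dg gM)).
move: x2; rewrite ltr_pdivlMr// => x2; apply: le_lt_trans x2.
have -> : 2 * (4 * M / s * nc (x' - x)) / sg = nc (x' - x) * (2 * (4 * M / s) / sg) by ring.
by rewrite ler_wpM2l ?nc_ge0// lerDl.
Qed.

Lemma theta_lipschitz x k : W x -> nc k <= sg / 2 ->
  nc (f (theta0 + k, x) - f (theta0, x)) <= 4 * M / sg * nc k.
Proof. by move=> Wx; exact: (lipschitz1 sg_gt0 (holo_theta Wx) (boundth Wx)). Qed.

Lemma theta_taylor x k : W x -> nc k <= sg / 2 ->
  nc (f (theta0 + k, x) - f (theta0, x) - dtheta (theta0, x) * k)
  <= 4 * M * nc k ^+ 2 / sg ^+ 2.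
Proof. by move=> Wx; exact: (taylor1 sg_gt0 (holo_theta Wx) (boundth Wx)). Qed.

End Theta.

(** Differentiation in theta under Cauchy's integral in x; Cauchy's estimates in theta
    bound the remainder uniformly on the circle, and the cross term is controlled
    by the Lipschitz dependence of the second x-derivative on theta. *)
Lemma dx_differentiable z : D z -> differentiable (dx f) z.
Proof.
case: z => theta0 y0 [/= st Wy].
have [s s0 hs] := open_disc W_open Wy; have [sg sg0 hsg] := strip_room st.
have ct := strip_closed_strip st.
have M0 : 0 <= M by apply: le_trans (bound_closed ct Wy); exact: nc_ge0.
have ws : nc (y0 - y0) < s by rewrite subrr nc0.
have ss : s <= s - nc (y0 - y0) by rewrite subrr nc0 subr0.
have circleW t : W (circle y0 s t) by apply: hs; exact: nc_circle_le.
pose P t := dtheta (theta0, circle y0 s t).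
have cP : {within `[0, 1], continuous P}.
  apply: within_at => t _.
  exact: (@continuous_comp _ _ _ (circle y0 s) (fun x => dtheta (theta0, x)) t
    (@continuous_circle R y0 s t) (dtheta_continuous sg0 hsg (circleW t))).
(* The mixed derivative, obtained by differentiating [dx_cauchy] in theta. *)
pose alpha := cauchy_transform y0 s P 2 y0.
pose beta th := derive2 y0 s (fun x => f (th, x)).
have step1 k1 : nc k1 <= sg / 2 ->
    nc (dx f (theta0 + k1, y0) - dx f (theta0, y0) - alpha * k1)
    <= 8 * M / (sg ^+ 2 * s) * nc k1 ^+ 2.
  move=> k1s.
  have k1sg : nc (theta0 + k1 - theta0) <= sg.
    by rewrite addrC addKr (le_trans k1s)// ler_pdivrMr// ler_pMr// ler1n.
  have ct1 := strip_closed_strip (hsg _ k1sg).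
  rewrite (dx_cauchy ct1 s0 hs) (dx_cauchy ct s0 hs) /alpha (mulrC _ k1) /cauchy_transform.
  have c1 := within_cauchy_kernel s0 (within_slice_trace s0 hs ct1) (n := 2) ws.
  have c2 := within_cauchy_kernel s0 (within_slice_trace s0 hs ct) (n := 2) ws.
  have c3 := within_cauchy_kernel s0 cP (n := 2) ws.
  have c3' : {within `[0, 1], continuous (fun t => k1 * cauchy_kernel y0 s P 2 y0 t)}.
    by apply: withinM; [exact: within_cst|].
  rewrite -(pathintZ k1 c3) -(pathintB c1 c2) -(pathintB (withinB c1 c2) c3').
  pose u t := slice_trace y0 s (theta0 + k1) t - slice_trace y0 s theta0 t - P t * k1.
  have cu : {within `[0, 1], continuous u}.
    have cst_k1 : {within `[(0 : R), 1], continuous (fun=> k1)} by exact: within_cst.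
    exact: (withinB (withinB (within_slice_trace s0 hs ct1) (within_slice_trace s0 hs ct))
      (withinM cP cst_k1)).
  have uM t : 0 <= t <= 1 -> nc (u t) <= 4 * M * nc k1 ^+ 2 / sg ^+ 2.
    by move=> _; exact: (theta_taylor sg0 hsg).
  have -> : pathint 0 1 (fun t => cauchy_kernel y0 s (slice_trace y0 s (theta0 + k1)) 2 y0 t -
      cauchy_kernel y0 s (slice_trace y0 s theta0) 2 y0 t - k1 * cauchy_kernel y0 s P 2 y0 t) =
      cauchy_transform y0 s u 2 y0.
    apply: eq_pathint => t _; rewrite /cauchy_kernel /u.
    by move: (slice_trace y0 s (theta0 + k1) t) (slice_trace y0 s theta0 t) (P t)
      (s%:CC * _) (_^-1) => x1 x2 x3 x4 x5; ring.
  apply: (le_trans (nc_cauchy_transform s0 cu uM 2 s0 ss)).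
  by rewrite le_eqVlt; apply/orP; left; apply/eqP; field; rewrite !gt_eqF.
have step2 k1 : nc k1 <= sg / 2 ->
    nc (beta (theta0 + k1) - beta theta0) <= 16 * M / (sg * s ^+ 2) * nc k1.
  move=> k1s.
  have k1sg : nc (theta0 + k1 - theta0) <= sg.
    by rewrite addrC addKr (le_trans k1s)// ler_pdivrMr// ler_pMr// ler1n.
  have ct1 := strip_closed_strip (hsg _ k1sg).
  have hd1 := slice_holo ct1 hs; have hd0 := slice_holo ct hs.
  rewrite /beta -(derive2B s0 hd1 hd0).
  have hd : holo_disc y0 s (fun x => f (theta0 + k1, x) - f (theta0, x)).
    by move=> z zs; apply: differentiableB; [exact: hd1|exact: hd0].
  have hM z : nc (z - y0) <= s -> nc (f (theta0 + k1, z) - f (theta0, z)) <= 4 * M / sg * nc k1.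
    by move=> /hs Wz; exact: theta_lipschitz.
  apply: (le_trans (cauchy_estimate2 s0 hd hM)).
  by rewrite le_eqVlt; apply/orP; left; apply/eqP; field; rewrite !gt_eqF.
pose c1 := 32 * M / s ^+ 3; pose c2 := 16 * M / (sg * s ^+ 2); pose c3 := 8 * M / (sg ^+ 2 * s).
have c10 : 0 <= c1 by rewrite !(divr_ge0, mulr_ge0, exprn_ge0)// ltW.
have c20 : 0 <= c2 by rewrite !(divr_ge0, mulr_ge0, exprn_ge0)// ltW.
have c30 : 0 <= c3 by rewrite !(divr_ge0, mulr_ge0, exprn_ge0)// ltW.
pose c := c1 + c2 + c3.
apply: (@differentiable2_eps _ _ (theta0, y0) alpha (beta theta0)) => e e0.
exists (Num.min (sg / 2) (Num.min (s / 2) (e / (c + 1)))).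
  by rewrite !lt_min !divr_gt0// ltr_wpDl// !addr_ge0.
move=> k1 k2; rewrite !lt_min => /and3P[k1s _ k1e] /and3P[_ k2s k2e].
have c0 : 0 <= c by rewrite /c !addr_ge0.
have {}k1e : nc k1 * c <= e.
  move: k1e; rewrite ltr_pdivlMr ?ltr_wpDl// mulrDr => h.
  by have := nc_ge0 k1; lra.
have {}k2e : nc k2 * c <= e.
  move: k2e; rewrite ltr_pdivlMr ?ltr_wpDl// mulrDr => h.
  by have := nc_ge0 k2; lra.
have k1sg : nc (theta0 + k1 - theta0) <= sg.
  by rewrite addrC addKr (le_trans (ltW k1s))// ler_pdivrMr// ler_pMr// ler1n.
have ct1 := strip_closed_strip (hsg _ k1sg).
have h1 : nc (dx f (theta0 + k1, y0 + k2) - dx f (theta0 + k1, y0) - beta (theta0 + k1) * k2)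
    <= c1 * nc k2 ^+ 2.
  have hM z : nc (z - y0) <= s -> nc (f (theta0 + k1, z)) <= M.
    by move=> /hs Wz; exact: bound_closed.
  have := taylor2 s0 (slice_holo ct1 hs) hM (ltW k2s).
  by rewrite [32 * M * _ / _]mulrAC.
have h2 := step2 k1 (ltW k1s); have h3 := step1 k1 (ltW k1s).
rewrite -/c2 in h2; rewrite -/c3 in h3.
have h2' : nc ((beta (theta0 + k1) - beta theta0) * k2) <= c2 * nc k1 * nc k2.
  by rewrite ncM ler_wpM2r ?nc_ge0.
have -> : dx f ((theta0, y0).1 + k1, (theta0, y0).2 + k2) - dx f (theta0, y0) -
   (alpha * k1 + beta theta0 * k2) =
   (dx f (theta0 + k1, y0 + k2) - dx f (theta0 + k1, y0) - beta (theta0 + k1) * k2) +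
   (beta (theta0 + k1) - beta theta0) * k2 +
   (dx f (theta0 + k1, y0) - dx f (theta0, y0) - alpha * k1).
  rewrite /=; move: (dx f (theta0 + k1, y0 + k2)) (dx f (theta0 + k1, y0)) (dx f (theta0, y0)).
  by move: (beta (theta0 + k1)) (beta theta0) => b1 b2 x1 x2 x3; ring.
apply: (le_trans (ncD _ _)); apply: (le_trans (lerD (ncD _ _) (lexx _))).
move: h1 h2' h3 k1e k2e (nc_ge0 k1) (nc_ge0 k2); rewrite /c.
move: (nc k1) (nc k2) => a b.
move: (nc _) (nc _) (nc _) => n1 n2 n3 h1 h2' h3 a1 b1 a0 b0.
apply: le_trans (quadratic_le c10 c20 c30 a0 b0 a1 b1).
by rewrite !lerD.
Qed.

End Slices.

(** * Stability of B under the operations in T and DT *)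

Section RealValued.
Variable R : realType.
Local Notation C := (Cplx R).
Implicit Types z w : C.

Lemma Im0E z : Imp z = 0 -> z = (Rep z)%:CC.
Proof. by case: z => a b /= ->. Qed.
Lemma Im0D z w : Imp z = 0 -> Imp w = 0 -> Imp (z + w) = 0.
Proof. by rewrite raddfD /= => -> ->; rewrite addr0. Qed.
Lemma Im0N z : Imp z = 0 -> Imp (- z) = 0.
Proof. by rewrite raddfN /= => ->; rewrite oppr0. Qed.
Lemma Im0M z w : Imp z = 0 -> Imp w = 0 -> Imp (z * w) = 0.
Proof. by case: z => a b; case: w => c d /= -> ->; rewrite mulr0 mul0r addr0. Qed.
Lemma Im0V z : Imp z = 0 -> Imp z^-1 = 0.
Proof. by case: z => a b /= ->; rewrite mul0r oppr0. Qed.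

End RealValued.

Section Projections.
Variable R : realType.
Local Notation C := (Cplx R).

Lemma differentiable_fst (z : C * C) : differentiable (fun z : C * C => z.1) z.
Proof.
pose L : {linear (C * C)%type -> C} := fst.
have cL : continuous L by move=> y; exact: cvg_fst.
exact (linear_differentiable z cL).
Qed.

Lemma differentiable_snd (z : C * C) : differentiable (fun z : C * C => z.2) z.
Proof.
pose L : {linear (C * C)%type -> C} := snd.
have cL : continuous L by move=> y; exact: cvg_snd.
exact (linear_differentiable z cL).
Qed.

End Projections.

Section Operators.
Variables (R : realType) (rho : R) (W : set (Cplx R)) (MW : R).
Local Notation C := (Cplx R).
Hypothesis rho_gt0 : 0 < rho.
Hypothesis W_open : open W.
Hypothesis W_le : forall z, W z -> nc z <= MW.
Hypothesis W1 : W 1.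
Local Notation D := (strip rho `*` W).
Implicit Types (f g h : C * C -> C) (theta x y : C).

Lemma D01 : D (0 : C, 1 : C).
Proof. by split => //; exact: strip_real. Qed.

Lemma normB_le f M : (forall z, D z -> nc (f z) <= M) -> (normB rho W f <= M%:E)%E.
Proof. by move=> fM; apply: ge_ereal_sup => _ [z Dz <-]; rewrite lee_fin; exact: fM. Qed.

Lemma normB_ub f z : D z -> ((nc (f z))%:E <= normB rho W f)%E.
Proof. by move=> Dz; apply: ereal_sup_ubound; exists z. Qed.

Lemma normB_fin f M : (normB rho W f <= M%:E)%E -> exists N : R,
  [/\ 0 <= N, normB rho W f = N%:E & forall z, D z -> nc (f z) <= N].
Proof.
move=> fM; have h0 := normB_ub f D01.
case E : (normB rho W f) => [N| |]; last first.
- by move: h0; rewrite E.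
- by move: fM; rewrite E.
exists N; split => //.
  by have := le_trans _ h0; rewrite E => /(_ 0%E); rewrite !lee_fin nc_ge0 => /(_ isT).
by move=> z Dz; have := normB_ub f Dz; rewrite E lee_fin.
Qed.

Lemma inB_fin f : inB rho W f -> exists N : R,
  [/\ 0 <= N, normB rho W f = N%:E & forall z, D z -> nc (f z) <= N].
Proof. by move=> /(inB_bounded rho_gt0 W_le)[M _ /normB_le]; exact: normB_fin. Qed.

Lemma inB_comb (c : R) f g : inB rho W f -> inB rho W g ->
  inB rho W (fun z => c%:CC * f z + g z).
Proof.
move=> [df cf rf pf] [dg cg rg pg]; split.
- move=> z Dz; apply: (@differentiableD _ _ _ (fun z => c%:CC * f z) g _ _ (dg z Dz)).
  apply: (@differentiableM _ _ (cst c%:CC) f _ _ (df z Dz)); exact: differentiable_cst.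
- by apply: (withinD _ cg); apply: (withinM _ cf); exact: within_cst.
- by move=> theta x Wx; apply: Im0D; [apply: Im0M; [|exact: rf]|exact: rg].
- by move=> theta x st Wx; rewrite pf// pg.
Qed.

Lemma inBD f g : inB rho W f -> inB rho W g -> inB rho W (f + g).
Proof.
move=> fB gB; have -> : f + g = (fun z => 1%:CC * f z + g z); last exact: inB_comb.
by apply/funext => z; rewrite fctE mul1r.
Qed.

Section P0.

Lemma within_real_trace f x : inB rho W f -> W x ->
  {within `[0, 1], continuous (fun t : R => f (t%:CC, x))}.
Proof.
move=> [_ cf _ _] Wx; apply: within_at => t _.
have Dt (s : R) : closure D (s%:CC, x).
  by apply: (subset_closure_D rho_gt0) Wx; exact: closed_strip_real.
apply/(cvg_ncP _ _ (nbhs_filter t)) => e e0.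
have /withinP/(_ _ (Dt t))/cvg_within2P/(_ e e0)[d d0 hd] := cf.
have := @continuous_real_complex R t; move=> /(cvg_ncP _ _ (nbhs_filter t))/(_ d d0).
by apply: filterS => t' tt'; apply: hd => //=; rewrite subrr nc0.
Qed.

Lemma p0CE f x : p0C f x = pathint 0 1 (fun t : R => f (t%:CC, x)).
Proof. by []. Qed.

Lemma p0C_comb (c : C) f g x : inB rho W f -> inB rho W g -> W x ->
  p0C (fun z => c * f z + g z) x = c * p0C f x + p0C g x.
Proof.
move=> fB gB Wx; rewrite !p0CE.
have cf := within_real_trace fB Wx; have cg := within_real_trace gB Wx.
have ccf : {within `[(0 : R), 1], continuous (fun t : R => c * f (t%:CC, x))}.
  by apply: (withinM _ cf); exact: within_cst.
by rewrite -(pathintZ c cf); exact: (pathintD ccf cg).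
Qed.

Lemma p0CD f g x : inB rho W f -> inB rho W g -> W x -> p0C (f + g) x = p0C f x + p0C g x.
Proof.
by move=> fB gB Wx; exact: (pathintD (within_real_trace fB Wx) (within_real_trace gB Wx)).
Qed.

Lemma p0C_le f x N : inB rho W f -> W x -> (forall z, D z -> nc (f z) <= N) ->
  nc (p0C f x) <= 2 * N.
Proof.
move=> fB Wx fN; have := pathint_le (M := N) ler01 (within_real_trace fB Wx).
rewrite subr0 mulr1; apply => t _; apply: (fN (t%:CC, x)); split => //.
exact: strip_real.
Qed.

Lemma p0C_real f (x : R) : inB rho W f -> W x%:CC -> Imp (p0C f x%:CC) = 0.
Proof.
move=> [_ _ rf _] Wx.
have E : (fun t : R => Imp (f (t%:CC, x%:CC))) = (fun=> 0).
  by apply/funext => t; exact: rf.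
rewrite /p0C /= E Rintegral_cst; first by rewrite mul0r.
exact: measurable_itv.
Qed.

End P0.

(** Continuity up to the edges of the strip, but only over interior points of W. *)
Definition regular f := (forall z, D z -> differentiable f z) /\
  forall z, (closed_strip rho `*` W) z ->
    f y @[y --> within (closed_strip rho `*` W) (nbhs z)] --> f z.

(** Membership in B without periodicity and reality, which are not preserved by the
    intermediate factors such as the coordinate x. *)
Definition smooth f := (forall z, D z -> differentiable f z) /\
  {within closure D, continuous f}.

Lemma inB_regular f : inB rho W f -> regular f.
Proof.
move=> [df cf _ _]; split => // -[theta x] [/= ct Wx].
apply/cvg_within2P => e e0.
have /withinP/(_ _ (subset_closure_D rho_gt0 ct Wx))/cvg_within2P/(_ e e0)[d d0 hd] := cf.
exists d => // -[theta' x'] [/= ct' Wx'] h1 h2.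
exact: (hd (theta', x') (subset_closure_D rho_gt0 ct' Wx') h1 h2).
Qed.

Lemma dx_regular f : inB rho W f -> regular (dx f).
Proof.
move=> fB; have [M _ fM] := inB_bounded rho_gt0 W_le fB; split.
  by move=> z; exact: (dx_differentiable rho_gt0 fB fM W_open).
by move=> [theta x] [/= ct Wx]; exact: (dx_continuous rho_gt0 fB fM W_open).
Qed.

Lemma smooth_cst (c : C) : smooth (fun=> c).
Proof. by split => [z _|]; [exact: differentiable_cst|exact: within_cst]. Qed.

Lemma smooth_snd : smooth (fun z => z.2).
Proof.
split => [z _|].
  exact: differentiable_snd.
by apply: within_at => z _; exact: cvg_snd.
Qed.

Lemma smoothD f g : smooth f -> smooth g -> smooth (fun z => f z + g z).
Proof.
move=> [df cf] [dg cg]; split; last exact: (withinD cf cg).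
by move=> z Dz; exact: (differentiableD (df z Dz) (dg z Dz)).
Qed.

Lemma smoothM f g : smooth f -> smooth g -> smooth (fun z => f z * g z).
Proof.
move=> [df cf] [dg cg]; split; last exact: (withinM cf cg).
by move=> z Dz; exact: (differentiableM (df z Dz) (dg z Dz)).
Qed.

(** The factors of T and DT are all of this form: a function that is only controlled
    over W itself, evaluated at an inner function whose values, up to the boundary
    of the domain, lie in W. *)
Lemma smooth_comp (o : R) f (A : C * C -> C) : regular f -> smooth A ->
  (forall z, closure D z -> W (A z)) -> smooth (fun z => f (z.1 + o%:CC, A z)).
Proof.
move=> [df cf] [dA cA] AW; split.
  move=> z Dz.
  have d1 : differentiable (fun z : C * C => z.1 + o%:CC) z.
    apply: (@differentiableD _ _ _ fst (cst o%:CC)); last exact: differentiable_cst.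
    exact: differentiable_fst.
  have d2 := differentiable_pair d1 (dA z Dz).
  have Df : D (z.1 + o%:CC, A z).
    split => /=; first by apply: strip_shift; case: Dz.
    exact/AW/subset_closure.
  exact: (@differentiable_comp _ _ _ _ (fun z => (z.1 + o%:CC, A z)) f z d2 (df _ Df)).
apply/withinP => z Dz; apply/cvg_within2P => e e0.
have cl z' : closure D z' -> (closed_strip rho `*` W) (z'.1 + o%:CC, A z').
  move=> Dz'; split => /=; last exact: AW.
  by apply: closed_strip_shift; case: z' Dz' => a b /(closure_D W rho_gt0)[].
have /cvg_within2P/(_ e e0)[d d0 hd] := cf _ (cl z Dz).
have /withinP/(_ _ Dz)/cvg_within2P/(_ d d0)[d' d'0 hd'] := cA.
exists (Num.min d d'); first by rewrite lt_min d0.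
move=> z' Dz'; rewrite !lt_min => /andP[h1 h2] /andP[_ h3].
apply: hd; first exact: cl.
  rewrite /=; have -> : z'.1 + o%:CC - (z.1 + o%:CC) = z'.1 - z.1; last exact: h1.
  by rewrite opprD addrACA subrr addr0.
by rewrite /=; exact: hd'.
Qed.

Lemma smooth_comp0 f (A : C * C -> C) : regular f -> smooth A ->
  (forall z, closure D z -> W (A z)) -> smooth (fun z => f (z.1, A z)).
Proof.
move=> rf sA AW; have := smooth_comp 0 rf sA AW.
have -> // : (fun z : C * C => f (z.1 + 0%:CC, A z)) = (fun z => f (z.1, A z)).
by apply/funext => z; rewrite addr0.
Qed.

(** A difference quotient along the real axis is real. *)
Lemma dx_real f (theta x : R) : inB rho W f -> W x%:CC -> Imp (dx f (theta%:CC, x%:CC)) = 0.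
Proof.
move=> fB Wx; have [_ _ rf _] := fB.
have st : strip rho (theta%:CC : C) by exact: strip_real.
have df := slice_x fB st Wx.
have [s s0 hs] := open_disc W_open Wx.
apply/eqP; rewrite -normr_le0; apply/ler_addgt0Pr => e e0; rewrite add0r.
have [dl dl0 hdl] := differentiable1_epsP df e0.
pose k : R := Num.min (dl / 2) s.
have k0 : 0 < k by rewrite lt_min divr_gt0.
have kdl : nc (k%:CC : C) < dl.
  rewrite nc_real gtr0_norm// (@le_lt_trans _ _ (dl / 2))//; first by rewrite ge_min lexx.
  by rewrite ltr_pdivrMr// ltr_pMr// ltr1n.
have Wk : W (x + k)%:CC.
  apply: hs; rewrite -(rmorphB (real_complex R)) addrC addKr nc_real gtr0_norm//.
  by rewrite ge_min lexx orbT.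
have := hdl _ kdl; rewrite -(rmorphD (real_complex R)) nc_real gtr0_norm//.
set d := _^`()%classic _ => h.
have := le_trans (nc_Im _) h.
have -> : Imp (f (theta%:CC, (x + k)%:CC) - f (theta%:CC, x%:CC) - d * k%:CC) = - (Imp d * k).
  rewrite !raddfB /= !rf// subr0 sub0r; congr (- _).
  by rewrite /GRing.mul/=; case: (d) => a b /=; rewrite mulr0 add0r.
by rewrite normrN normrM (gtr0_norm k0) ler_pM2r.
Qed.

Lemma dx_periodic f theta x : inB rho W f -> strip rho theta -> W x ->
  dx f (theta + 1, x) = dx f (theta, x).
Proof.
move=> fB st Wx; have [_ _ _ pf] := fB.
have df := slice_x fB st Wx.
have [s s0 hs] := open_disc W_open Wx.
apply: (proj2 (differentiable1_eps _)) => e e0.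
have [dl dl0 hdl] := differentiable1_epsP df e0.
exists (Num.min dl s); first by rewrite lt_min dl0.
move=> k; rewrite lt_min => /andP[kdl ks].
have Wk : W (x + k) by apply: hs; rewrite addrC addKr ltW.
by rewrite (pf _ _ st Wk) (pf _ _ st Wx); exact: hdl.
Qed.

End Operators.

(** * Functions mapping into W with a margin *)

Section Margin.
Variables (R : realType) (rho : R) (W : set (Cplx R)) (MW : R) (omega : R).
Local Notation C := (Cplx R).
Hypothesis rho_gt0 : 0 < rho.
Hypothesis W_open : open W.
Hypothesis W_le : forall z, W z -> nc z <= MW.
Hypothesis W1 : W 1.
Local Notation D := (strip rho `*` W).
Implicit Types (f g h Psi : C * C -> C) (theta x y : C).

(** The points at which Psi, h and the x-derivative of Psi are evaluated in T and DT keep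
    the distance eps to the complement of W, so Cauchy's estimates hold there
    with a common radius. *)
Definition margin Psi (eps : R) : Prop :=
  [/\ p0C Psi 1 != 0,
      forall x y, W x -> nc (y - p0C Psi 1 * x) <= eps -> W y &
      forall theta x y, strip rho theta -> W x ->
        nc (y - Psi (theta, p0C Psi 1 * x)) <= eps -> W y].

Lemma ncM_le (z w : C) (r s : R) : nc z <= r -> nc w <= s -> nc (z * w) <= r * s.
Proof. by move=> h1 h2; rewrite ncM ler_pM ?nc_ge0. Qed.

Lemma ncD_le (z w : C) (r s : R) : nc z <= r -> nc w <= s -> nc (z + w) <= r + s.
Proof. by move=> h1 h2; apply: (le_trans (ncD _ _)); exact: lerD. Qed.

Lemma ncB_le (z w : C) (r s : R) : nc z <= r -> nc w <= s -> nc (z - w) <= r + s.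
Proof. by move=> h1 h2; apply: (le_trans (ncB _ _)); exact: lerD. Qed.

(** The exact second order remainder of T at Psi in the direction h. *)
Lemma remainder_identity (a b x Po Pxo Px Q Ho r1 r2 r3 r4 : C) :
  a != 0 -> a + b != 0 ->
  (a + b)^-1 * ((Po + (Pxo * (Px * (b * x) + Q + r1 + r2) + r3)) + (Ho + r4)) - a^-1 * Po
  - (a^-1 * Pxo * Q + a^-1 * Ho + b / a * Pxo * Px * x - b / a ^+ 2 * Po) =
  Po * (b * b * ((a ^+ 2)^-1 * (a + b)^-1))
  - (Pxo * (Px * (b * x) + Q) + Ho) * (b * (a^-1 * (a + b)^-1))
  + (Pxo * (r1 + r2) + r3 + r4) * (a + b)^-1.
Proof. by move=> a0 ab0; field; rewrite ab0 a0. Qed.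

Section OnePsi.
Variables (Psi : C * C -> C) (eps : R).
Hypothesis eps_gt0 : 0 < eps.
Hypothesis PsiB : inB rho W Psi.
Hypothesis Psi_margin : margin Psi eps.

Local Notation a := (p0C Psi 1).
Let inner1 (z : C * C) : C := a * z.2.
Let inner2 (z : C * C) : C := Psi (z.1, inner1 z).

Let a_neq0 : a != 0. Proof. by case: Psi_margin. Qed.
Let disc1 x : W x -> forall y, nc (y - a * x) <= eps -> W y.
Proof. by case: Psi_margin => _ + _ => /(_ x) H Wx y; exact: H. Qed.
Let disc2 theta x : strip rho theta -> W x ->
  forall y, nc (y - Psi (theta, a * x)) <= eps -> W y.
Proof. by case: Psi_margin => _ _ H st Wx y; exact: (H theta x). Qed.

Let ca : 0 < nc a + 1. Proof. by rewrite ltr_wpDl ?nc_ge0. Qed.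

(** The closure of W is approached from W, at the expense of the margin. *)
Lemma inner1W z : closure D z -> W (inner1 z).
Proof.
case: z => theta x /(closure_D W rho_gt0)[_ cx].
have [x' [Wx' x'x]] : W `&` [set x' | nc (x' - x) < eps / (nc a + 1)] !=set0.
  by apply: cx; apply/nbhs_ncP; exists (eps / (nc a + 1)); rewrite ?divr_gt0.
apply: (disc1 Wx'); rewrite /inner1 /= -mulrBr ncM ncC.
move: x'x; rewrite /= ltr_pdivlMr// => h.
apply: ltW; apply: le_lt_trans h; rewrite mulrC; apply: ler_wpM2l; [exact: nc_ge0|by rewrite lerDl].
Qed.

Lemma inner2W z : closure D z -> W (inner2 z).
Proof.
move=> Dz; have := inner1W Dz; rewrite /inner2 /inner1.
case: z Dz => theta x Dz /= Wax; have [ct _] := (closure_D W rho_gt0 _ _).1 Dz.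
have [_ creg] := inB_regular rho_gt0 PsiB.
have /cvg_within2P/(_ eps eps_gt0)[d d0 hd] := creg (theta, a * x) (conj ct Wax).
have [[theta' x'] [[/= st' Wx'] [/= t1 t2]]] : D `&` [set z | nc (z.1 - theta) < d /\
    nc (z.2 - x) < d / (nc a + 1)] !=set0.
  apply: Dz; apply/nbhs2_ncP; exists (Num.min d (d / (nc a + 1))).
    by rewrite lt_min d0 divr_gt0.
  by move=> z; rewrite !lt_min => /andP[h1 _] /andP[_ h2]; split.
have Wax' : W (a * x') by apply: (disc1 Wx'); rewrite subrr nc0 ltW.
apply: (disc2 st' Wx'); rewrite ncC; apply: ltW.
apply: (hd (theta', a * x')) => //=.
  by split => //=; exact: strip_closed_strip.
rewrite -mulrBr ncM.
move: t2; rewrite ltr_pdivlMr// => h.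
apply: le_lt_trans h; rewrite mulrC; apply: ler_wpM2l; [exact: nc_ge0|by rewrite lerDl].
Qed.

Let smooth1 : smooth rho W inner1.
Proof. by apply: smoothM; [exact: smooth_cst|exact: smooth_snd]. Qed.

Let regPsi := inB_regular rho_gt0 PsiB.
Let regdx := dx_regular rho_gt0 W_open W_le PsiB.

Let smooth2 : smooth rho W inner2.
Proof. exact: (smooth_comp0 rho_gt0 regPsi smooth1 inner1W). Qed.

Let a_real : Imp a = 0.
Proof. exact: (p0C_real (x := 1) PsiB W1). Qed.

Let realW1 (x : R) : W x%:CC -> W (a * x%:CC).
Proof. by move=> Wx; apply: (disc1 Wx); rewrite subrr nc0 ltW. Qed.

Let real1 (x : R) : Imp (a * x%:CC) = 0.
Proof. by apply: Im0M. Qed.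

Let real2 (t x : R) : W x%:CC -> Imp (Psi (t%:CC, a * x%:CC)) = 0.
Proof.
move=> /realW1; rewrite (Im0E (real1 x)) => Wx.
by have [_ _ rP _] := PsiB; exact: rP.
Qed.

Let realW2 (t x : R) : W x%:CC -> W (Psi (t%:CC, a * x%:CC)).
Proof.
move=> Wx; apply: (disc2 (strip_real rho_gt0 t) Wx); by rewrite subrr nc0 ltW.
Qed.

(** Every function occurring in T and its derivative is evaluated at inner points. *)
Let real_comp1 f (t x : R) : (forall s y : R, W y%:CC -> Imp (f (s%:CC, y%:CC)) = 0) ->
  W x%:CC -> Imp (f (t%:CC, a * x%:CC)) = 0.
Proof. by move=> rf /realW1; rewrite (Im0E (real1 x)); exact: rf. Qed.

Let real_comp2 f (t x : R) : (forall s y : R, W y%:CC -> Imp (f (s%:CC, y%:CC)) = 0) ->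
  W x%:CC -> Imp (f (t%:CC + omega%:CC, Psi (t%:CC, a * x%:CC))) = 0.
Proof.
move=> rf Wx; have := realW2 t Wx; rewrite (Im0E (real2 t Wx)).
by rewrite -(rmorphD (real_complex R)); exact: rf.
Qed.

Let per1 f theta x : (forall th y, strip rho th -> W y -> f (th + 1, y) = f (th, y)) ->
  strip rho theta -> W x -> f (theta + 1, a * x) = f (theta, a * x).
Proof.
by move=> pf st Wx; apply: pf => //; apply: (disc1 Wx); rewrite subrr nc0 ltW.
Qed.

Let per2 f theta x : (forall th y, strip rho th -> W y -> f (th + 1, y) = f (th, y)) ->
  strip rho theta -> W x ->
  f (theta + 1 + omega%:CC, Psi (theta + 1, a * x)) = f (theta + omega%:CC, Psi (theta, a * x)).
Proof.
move=> pf st Wx; have [_ _ _ pP] := PsiB; rewrite (per1 pP st Wx) addrAC.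
apply: pf; first exact: strip_shift.
by apply: (disc2 st Wx); rewrite subrr nc0 ltW.
Qed.

Lemma T_op_inB : inB rho W (T_op omega Psi).
Proof.
have [_ _ rP pP] := PsiB.
have [dT cT] : smooth rho W (T_op omega Psi).
  apply: (smoothM (smooth_cst _ _ a^-1)).
  exact: (smooth_comp rho_gt0 omega regPsi smooth2 inner2W).
split => // [t x Wx|theta x st Wx]; rewrite /T_op /=.
  by apply: Im0M; [exact: Im0V|exact: real_comp2].
by congr (_ * _); exact: per2.
Qed.

Lemma margin_T_defined : T_defined rho W omega Psi.
Proof.
split; last exact: T_op_inB.
- exact: a_neq0.
- by move=> x Wx; apply: (disc1 Wx); rewrite subrr nc0 ltW.
by move=> theta x st Wx; apply: (disc2 st Wx); rewrite subrr nc0 ltW.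
Qed.

Lemma DT_inB h : inB rho W h -> inB rho W (DT omega Psi h).
Proof.
move=> hB; have [_ _ rP pP] := PsiB; have [_ _ rh ph] := hB.
have regh := inB_regular rho_gt0 hB.
pose b := p0C h 1.
have b_real : Imp b = 0 by exact: (p0C_real (x := 1) hB W1).
have rdx (s y : R) : W y%:CC -> Imp (dx Psi (s%:CC, y%:CC)) = 0.
  by move=> Wy; exact: (dx_real rho_gt0 W_open s PsiB Wy).
have pdx theta y : strip rho theta -> W y -> dx Psi (theta + 1, y) = dx Psi (theta, y).
  by move=> st Wy; exact: (dx_periodic W_open PsiB st Wy).
have [dT cT] : smooth rho W (DT omega Psi h).
  have -> : DT omega Psi h = (fun z =>
      a^-1 * dx Psi (z.1 + omega%:CC, inner2 z) * h (z.1, inner1 z)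
      + a^-1 * h (z.1 + omega%:CC, inner2 z)
      + b / a * dx Psi (z.1 + omega%:CC, inner2 z) * dx Psi (z.1, inner1 z) * z.2
      + (- (b / a ^+ 2)) * Psi (z.1 + omega%:CC, inner2 z)).
    by apply/funext => -[theta x]; rewrite /DT /= mulNr.
  have sdx := smooth_comp rho_gt0 omega regdx smooth2 inner2W.
  have sP := smooth_comp rho_gt0 omega regPsi smooth2 inner2W.
  have sh := smooth_comp rho_gt0 omega regh smooth2 inner2W.
  have sh1 := smooth_comp0 rho_gt0 regh smooth1 inner1W.
  have sdx1 := smooth_comp0 rho_gt0 regdx smooth1 inner1W.
  have sc (c : C) := smooth_cst rho W c.
  exact: (smoothD (smoothD (smoothD (smoothM (smoothM (sc _) sdx) sh1) (smoothM (sc _) sh))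
    (smoothM (smoothM (smoothM (sc _) sdx) sdx1) (smooth_snd rho W))) (smoothM (sc _) sP)).
split => // [t x Wx|theta x st Wx]; rewrite /DT.
  have ra := Im0V a_real.
  have r1 := real_comp2 t rdx Wx; have r2 := real_comp1 t rh Wx.
  have r3 := real_comp2 t rh Wx; have r4 := real_comp1 t rdx Wx.
  have r5 := real_comp2 t rP Wx.
  have ra2 : Imp (a ^+ 2)^-1 = 0 by apply: Im0V; rewrite expr2; exact: Im0M.
  exact: (Im0D (Im0D (Im0D (Im0M (Im0M ra r1) r2) (Im0M ra r3))
    (Im0M (Im0M (Im0M (Im0M b_real ra) r1) r4) (erefl : Imp (x%:CC : C) = 0)))
    (Im0N (Im0M (Im0M b_real ra2) r5))).
by rewrite (per2 pdx st Wx) (per1 ph st Wx) (per2 ph st Wx) (per1 pdx st Wx) (per2 pP st Wx).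
Qed.

Section Estimates.
Variable M : R.
Hypothesis PsiM : forall z, D z -> nc (Psi z) <= M.

Let A := nc a.
Let dxM := 2 * M / eps.
Let A_gt0 : 0 < A. Proof. by rewrite nc_gt0. Qed.
Let MW_ge0 : 0 <= MW. Proof. by apply: le_trans (W_le W1); exact: nc_ge0. Qed.
Let M_ge0 : 0 <= M.
Proof. by apply: le_trans (PsiM (D01 rho_gt0 W1)); exact: nc_ge0. Qed.
Section AtPoint.
Variables (theta x : C).
Hypothesis st : strip rho theta.
Hypothesis Wx : W x.
Let X := a * x.
Let y := Psi (theta, X).
Let th' := theta + omega%:CC.
Let st' : strip rho th'. Proof. exact: strip_shift. Qed.

Lemma inner_dx1 : nc (dx Psi (theta, X)) <= dxM.
Proof. exact: (dx_le rho_gt0 PsiB PsiM W_open (strip_closed_strip st) eps_gt0 (disc1 Wx)). Qed.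

Lemma inner_dx2 : nc (dx Psi (th', y)) <= dxM.
Proof. exact: (dx_le rho_gt0 PsiB PsiM W_open (strip_closed_strip st') eps_gt0 (disc2 st Wx)). Qed.

Lemma inner_D1 : D (theta, X).
Proof. by split => //; apply: (disc1 Wx); rewrite subrr nc0 ltW. Qed.

Lemma inner_D2 : D (th', y).
Proof. by split => //; apply: (disc2 st Wx); rewrite subrr nc0 ltW. Qed.

Section Direction.
Variables (h : C * C -> C) (N : R).
Hypothesis hB : inB rho W h.
Hypothesis hN : forall z, D z -> nc (h z) <= N.
Let b := p0C h 1.

Let N_ge0 : 0 <= N.
Proof. by apply: le_trans (hN (D01 rho_gt0 W1)); exact: nc_ge0. Qed.

Let bN : nc b <= 2 * N. Proof. exact: (p0C_le rho_gt0 hB W1 hN). Qed.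

(** Each term of DT is a product of one factor linear in h with uniformly bounded
    factors. *)
Lemma nc_DT : nc (DT omega Psi h (theta, x)) <=
  (dxM / A + A^-1 + 2 / A * dxM * dxM * MW + 2 / A ^+ 2 * M) * N.
Proof.
have h1 := inner_dx1; have h2 := inner_dx2.
have h3 := hN inner_D1; have h4 := hN inner_D2; have h5 := PsiM inner_D2.
have hx := W_le Wx; have ia : nc a^-1 <= A^-1 by rewrite ncV.
have ia2 : nc (a ^+ 2)^-1 <= (A ^+ 2)^-1 by rewrite ncV ncX.
rewrite /DT -/X -/y -/th' -/b.
have -> : (dxM / A + A^-1 + 2 / A * dxM * dxM * MW + 2 / A ^+ 2 * M) * N =
  A^-1 * dxM * N + A^-1 * N + 2 * N / A * dxM * dxM * MW + 2 * N / A ^+ 2 * M by ring.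
exact: (ncB_le (ncD_le (ncD_le (ncM_le (ncM_le ia h2) h3) (ncM_le ia h4))
  (ncM_le (ncM_le (ncM_le (ncM_le bN ia) h2) h1) hx)) (ncM_le (ncM_le bN ia2) h5)).
Qed.

Let L := 8 * M * MW / eps + 1.
Let c1 := 16 * M * MW ^+ 2 / eps ^+ 2.
Let c2 := 8 * MW / eps.
Let c3 := 4 * M * L ^+ 2 / eps ^+ 2.
Let c4 := 4 * L / eps.
Let c5 := dxM * (c1 + c2) + c3 + c4.
Let c6 := dxM * (dxM * (2 * MW) + 1) + 1.
(** c1 to c4 are the constants of the four Taylor remainders in [T_remainder]; c6 N bounds
    the first order variation of (Psi + h) at the outer evaluation point. *)
Definition frechet_const : R := M * 8 / A ^+ 3 + c6 * 4 / A ^+ 2 + c5 * 2 / A.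

(** r1 and r2 are the remainders of Psi and h at the inner point a x, moved by b x;
    r3 and r4 those at y, moved by the increment l of the inner function. Each is
    quadratic in the norm of h. *)
Lemma T_remainder : 2 * N <= A / 2 -> 2 * N * MW <= eps / 2 -> L * N <= eps / 2 ->
  nc (T_op omega (Psi + h) (theta, x) - T_op omega Psi (theta, x) - DT omega Psi h (theta, x))
  <= frechet_const * N ^+ 2.
Proof.
move=> NA NW NL.
have hx := W_le Wx.
have e0 := eps_gt0.
pose Px := dx Psi (theta, X); pose Q := h (theta, X).
pose k := b * x.
have kN : nc k <= 2 * N * MW by exact: ncM_le.
have k_eps : nc k <= eps / 2 := le_trans kN NW.
have abx : (a + b) * x = X + k by rewrite mulrDl.
pose y' := Psi (theta, X + k) + h (theta, X + k).
pose r1 := Psi (theta, X + k) - y - Px * k.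
pose r2 := h (theta, X + k) - Q.
pose l := y' - y.
have lE : l = Px * k + Q + r1 + r2.
  by rewrite /l /y' /r1 /r2; move: (Psi _) (h _) => u v; ring.
have ct := strip_closed_strip st; have ct' := strip_closed_strip st'.
have N0 := N_ge0; have M0 := M_ge0; have W0 := MW_ge0.
have k2 : nc k ^+ 2 <= (2 * N * MW) ^+ 2.
  by rewrite lerXn2r ?nnegrE ?nc_ge0// !mulr_ge0.
have h1 : nc r1 <= c1 * N ^+ 2.
  apply: (le_trans (slice_taylor rho_gt0 PsiB PsiM W_open ct e0 (disc1 Wx) k_eps)).
  have -> : c1 * N ^+ 2 = 4 * M * (2 * N * MW) ^+ 2 / eps ^+ 2 by rewrite /c1; ring.
  by rewrite ler_wpM2r ?invr_ge0 ?exprn_ge0 ?(ltW e0)// ler_wpM2l// mulr_ge0.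
have h2 : nc r2 <= c2 * N ^+ 2.
  apply: (le_trans (slice_lipschitz rho_gt0 hB hN W_open ct e0 (disc1 Wx) k_eps)).
  have -> : c2 * N ^+ 2 = 4 * N / eps * (2 * N * MW) by rewrite /c2; ring.
  by rewrite ler_wpM2l// divr_ge0 ?mulr_ge0// ltW.
have lN : nc l <= L * N.
  have hl := slice_lipschitz rho_gt0 PsiB PsiM W_open ct e0 (disc1 Wx) k_eps.
  have DXk : D (theta, X + k).
    split => //; apply: (disc1 Wx); rewrite /= [X + k]addrC addrK (le_trans k_eps)//.
    by rewrite ler_pdivrMr// ler_pMr// ler1n.
  have hh := hN DXk.
  have -> : l = (Psi (theta, X + k) - y) + h (theta, X + k) by rewrite /l /y' addrAC.
  have -> : L * N = 4 * M / eps * (2 * N * MW) + N by rewrite /L; ring.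
  apply: ncD_le hh; apply: (le_trans hl).
  by rewrite ler_wpM2l// divr_ge0 ?mulr_ge0// ltW.
have L0 : 0 <= L by rewrite addr_ge0// divr_ge0 ?mulr_ge0// ltW.
have l_eps : nc l <= eps / 2 := le_trans lN NL.
pose Po := Psi (th', y); pose Pxo := dx Psi (th', y); pose Ho := h (th', y).
pose r3 := Psi (th', y + l) - Po - Pxo * l.
pose r4 := h (th', y + l) - Ho.
have l2 : nc l ^+ 2 <= (L * N) ^+ 2.
  by rewrite lerXn2r ?nnegrE ?nc_ge0// !mulr_ge0.
have h3 : nc r3 <= c3 * N ^+ 2.
  apply: (le_trans (slice_taylor rho_gt0 PsiB PsiM W_open ct' e0 (disc2 st Wx) l_eps)).
  have -> : c3 * N ^+ 2 = 4 * M * (L * N) ^+ 2 / eps ^+ 2 by rewrite /c3; ring.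
  by rewrite ler_wpM2r ?invr_ge0 ?exprn_ge0 ?(ltW e0)// ler_wpM2l// mulr_ge0.
have h4 : nc r4 <= c4 * N ^+ 2.
  apply: (le_trans (slice_lipschitz rho_gt0 hB hN W_open ct' e0 (disc2 st Wx) l_eps)).
  have -> : c4 * N ^+ 2 = 4 * N / eps * (L * N) by rewrite /c4; ring.
  by rewrite ler_wpM2l// divr_ge0 ?mulr_ge0// ltW.
have ab_ge : A / 2 <= nc (a + b).
  have := ncBD (a + b) a 0; rewrite !subr0 opprD addrA subrr add0r ncN -/A.
  by have := bN; move: (nc b) (nc (a + b)) A NA => ? ? ? ?; lra.
have A2 : 0 < A / 2 by rewrite divr_gt0.
have ab0 : a + b != 0 by rewrite -nc_gt0; exact: lt_le_trans ab_ge.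
have iab : nc (a + b)^-1 <= 2 / A.
  by rewrite ncV -[2 / A]invf_div lef_pV2// posrE (lt_le_trans A2).
have yl : y + l = y' by rewrite /l addrC subrK.
have TE : T_op omega (Psi + h) (theta, x) =
    (a + b)^-1 * ((Po + (Pxo * (Px * (b * x) + Q + r1 + r2) + r3)) + (Ho + r4)).
  have E1 : Psi (th', y') = Po + (Pxo * (Px * (b * x) + Q + r1 + r2) + r3).
    rewrite -/k -lE /r3 yl; move: (Psi (th', y')) => u; ring.
  have E2 : h (th', y') = Ho + r4 by rewrite /r4 yl addrC subrK.
  rewrite -E1 -E2 /T_op /= (p0CD rho_gt0 PsiB hB W1) -/b.
  by rewrite -[(Psi + h) (theta, _)]/(Psi (theta, _) + h (theta, _)) abx.
rewrite TE /T_op /= -/X -/y -/th' -/Po /DT -/X -/y -/th' -/b -/Px -/Q -/Po -/Ho -/Pxo.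
rewrite remainder_identity//.
have p1 := inner_dx1; have p2 := inner_dx2; have p3 := hN inner_D1.
have p4 := hN inner_D2; have p5 := PsiM inner_D2.
rewrite -/Px in p1; rewrite -/Pxo in p2; rewrite -/Q in p3; rewrite -/Ho in p4.
rewrite -/Po in p5.
have ia : nc a^-1 <= A^-1 by rewrite ncV.
have ia2 : nc (a ^+ 2)^-1 <= (A ^+ 2)^-1 by rewrite ncV ncX.
have -> : frechet_const * N ^+ 2 =
  M * ((2 * N) * (2 * N) * ((A ^+ 2)^-1 * (2 / A)))
  + (dxM * (dxM * (2 * N * MW) + N) + N) * ((2 * N) * (A^-1 * (2 / A)))
  + (dxM * (c1 * N ^+ 2 + c2 * N ^+ 2) + c3 * N ^+ 2 + c4 * N ^+ 2) * (2 / A).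
  by rewrite /frechet_const /c5 /c6; field; rewrite gt_eqF.
exact: (ncD_le (ncB_le (ncM_le p5 (ncM_le (ncM_le bN bN) (ncM_le ia2 iab)))
  (ncM_le (ncD_le (ncM_le p2 (ncD_le (ncM_le p1 kN) p3)) p4) (ncM_le bN (ncM_le ia iab))))
  (ncM_le (ncD_le (ncD_le (ncM_le p2 (ncD_le h1 h2)) h3) h4) iab)).
Qed.

End Direction.

End AtPoint.

End Estimates.

End OnePsi.

End Margin.

(** * Differentiability of T and openness of the margin *)

Section Frechet.
Variables (R : realType) (rho : R) (W : set (Cplx R)) (MW : R) (omega : R).
Local Notation C := (Cplx R).
Hypothesis rho_gt0 : 0 < rho.
Hypothesis W_open : open W.
Hypothesis W_le : forall z, W z -> nc z <= MW.
Hypothesis W1 : W 1.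
Local Notation D := (strip rho `*` W).

Lemma DT_linear (Psi h k : C * C -> C) (c : R) z : inB rho W h -> inB rho W k ->
  DT omega Psi (fun w => c%:CC * h w + k w) z = c%:CC * DT omega Psi h z + DT omega Psi k z.
Proof.
move=> hB kB; case: z => theta x; rewrite /DT (p0C_comb rho_gt0 _ hB kB W1).
move: (p0C h 1) (p0C k 1) => b b'.
move: (p0C Psi 1) => a; move: (Psi (theta, _)) => y; move: (Psi (_, y)) => Po.
move: (dx Psi _) => p1; move: (dx Psi _) => p2.
move: (h _) => h1; move: (h _) => h2; move: (k _) => k1; move: (k _) => k2.
by move: (c%:CC) => c'; ring.
Qed.

Section Derivative.
Variables (Psi : C * C -> C) (eps : R).
Hypothesis eps_gt0 : 0 < eps.
Hypothesis PsiB : inB rho W Psi.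
Hypothesis Psi_margin : margin rho W Psi eps.

Lemma DT_bounded_linear : bounded_linear_B rho W (DT omega Psi).
Proof.
have [M M0 PsiM] := inB_bounded rho_gt0 W_le PsiB.
split.
- by move=> h; exact: (DT_inB omega rho_gt0 W_open W_le W1 eps_gt0 PsiB Psi_margin).
- by move=> c h k hB kB z _; exact: DT_linear.
- eexists => h hB; have [N [N0 EN hN]] := inB_fin rho_gt0 W_le W1 hB.
  rewrite EN -EFinM; apply: normB_le => -[theta x] [/= st Wx].
  exact: (nc_DT omega rho_gt0 W_open W_le W1 eps_gt0 PsiB Psi_margin PsiM st Wx hB hN).
Qed.

(** The remainder is at most K N^2 with N the norm of h, hence at most e N once N <= e / K;
    the other bounds on N keep the moved points within the margin. *)
Lemma T_frechet (eta1 : R) : 0 < eta1 ->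
  (forall h, inB rho W h -> (normB rho W h < eta1%:E)%E -> T_defined rho W omega (Psi + h)) ->
  frechet_derivative_T rho W omega Psi (DT omega Psi).
Proof.
move=> eta10 Tdef; split; first exact: DT_bounded_linear.
move=> e e0.
have [M M0 PsiM] := inB_bounded rho_gt0 W_le PsiB.
have A0 : 0 < nc (p0C Psi 1) by rewrite nc_gt0; case: Psi_margin.
have MW0 : 0 <= MW by apply: le_trans (W_le W1); exact: nc_ge0.
have eps0 := eps_gt0.
pose L := 8 * M * MW / eps + 1.
have L0 : 0 < L by rewrite ltr_wpDl// divr_ge0 ?mulr_ge0// ltW.
pose K := `|frechet_const MW Psi eps M| + 1.
have K0 : 0 < K by rewrite ltr_wpDl.
pose eta := Num.min (Num.min eta1 (nc (p0C Psi 1) / 4))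
  (Num.min (eps / (4 * (MW + 1))) (Num.min (eps / (2 * L)) (e / K))).
have MW1 : 0 < MW + 1 by rewrite ltr_wpDl.
exists eta.
  rewrite !lt_min eta10 (divr_gt0 A0)// (divr_gt0 e0 K0).
  by rewrite !divr_gt0 ?mulr_gt0.
move=> h hB heta.
have [N [N0 EN hN]] := inB_fin rho_gt0 W_le W1 hB.
move: (heta); rewrite EN lte_fin !lt_min => /andP[/andP[n1 n2] /and3P[n3 n4 n5]].
split; first by apply: Tdef => //; rewrite EN lte_fin.
rewrite -EFinM; apply: normB_le => -[theta x] [/= st Wx].
have c1 : 2 * N <= nc (p0C Psi 1) / 2 by move: (nc (p0C Psi 1)) n2 => ? ?; lra.
have c2 : 2 * N * MW <= eps / 2.
  move: n3; rewrite ltr_pdivlMr ?mulr_gt0// => n3.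
  have : N * (4 * (MW + 1)) = 4 * (N * MW) + 4 * N by ring.
  by move=> E; lra.
have c3 : L * N <= eps / 2.
  move: n4; rewrite ltr_pdivlMr ?mulr_gt0// => n4.
  have : N * (2 * L) = 2 * (L * N) by ring.
  by move=> E; lra.
apply: (le_trans (T_remainder omega rho_gt0 W_open W_le W1 eps_gt0 PsiB Psi_margin PsiM
  st Wx hB hN c1 c2 c3)).
move: n5; rewrite ltr_pdivlMr// => n5.
rewrite expr2 mulrA ler_wpM2r// mulrC; apply: le_trans (ltW n5).
by rewrite ler_wpM2l// /K (le_trans (ler_norm _))// lerDl.
Qed.

End Derivative.

(** A change of Psi by eta moves a by at most 2 eta, hence both families of
    evaluation points by O(eta). *)
Lemma margin_stable (Phi : C * C -> C) (E : R) : 0 < E -> inB rho W Phi ->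
  margin rho W Phi E -> exists2 eta : R, 0 < eta & forall Psi, inB rho W Psi ->
    (forall z, D z -> nc (Psi z - Phi z) <= eta) -> margin rho W Psi (E / 2).
Proof.
move=> E0 PhiB Pm; have [a0 d1 d2] := Pm.
have [M M0 PhiM] := inB_bounded rho_gt0 W_le PhiB.
have A0 : 0 < nc (p0C Phi 1) by rewrite nc_gt0.
have MW0 : 0 <= MW by apply: le_trans (W_le W1); exact: nc_ge0.
(* The three terms account for the distance of Psi to Phi, for the shift of a x, and
   for the effect of this shift on Phi. *)
pose K := 1 + 2 * MW + 8 * M * MW / E.
have K0 : 0 < K by rewrite /K -addrA ltr_pwDl// addr_ge0 ?divr_ge0 ?mulr_ge0// ltW.
pose eta := Num.min (nc (p0C Phi 1) / 4) (E / 2 / K).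
have eta0 : 0 < eta by rewrite lt_min !divr_gt0.
have e1 : eta <= nc (p0C Phi 1) / 4 by rewrite ge_min lexx.
have e2 : eta * K <= E / 2 by rewrite -ler_pdivlMr// ge_min lexx orbT.
have e3 : 2 * eta * MW <= E / 2.
  apply: le_trans e2; rewrite /K; have : 0 <= 8 * M * MW / E by rewrite divr_ge0 ?mulr_ge0// ltW.
  by move: (8 * M * MW / E) => t t0; nra.
have e4 : eta + 8 * M * MW / E * eta <= E / 2.
  apply: le_trans e2; rewrite /K; move: (8 * M * MW / E) => t.
  by have : 0 <= eta * MW by [rewrite mulr_ge0// ltW]; lra.
exists eta => // Psi PsiB close.
have da : nc (p0C Psi 1 - p0C Phi 1) <= 2 * eta.
  have c1 := within_real_trace rho_gt0 PsiB W1; have c2 := within_real_trace rho_gt0 PhiB W1.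
  rewrite !p0CE -(pathintB c1 c2).
  have := pathint_le (M := eta) ler01 (withinB c1 c2).
  rewrite subr0 mulr1; apply => t _; apply: (close (t%:CC, 1)); split => //.
  exact: strip_real.
set a := p0C Phi 1 in a0 d1 d2 A0 e1 da *; set a' := p0C Psi 1 in da *.
have dax x : W x -> nc (a' * x - a * x) <= 2 * eta * MW.
  by move=> Wx; rewrite -mulrBl; apply: ncM_le => //; exact: W_le.
split.
- apply/eqP => h; have a'0 : a' = 0 by exact: h.
  move: da; rewrite a'0 sub0r ncN => da.
  by move: (nc a) A0 e1 da => t ? ? ?; lra.
- move=> x y Wx yx; apply: (d1 x y Wx).
  apply: (le_trans (ncBD (a' * x) _ _)).
  by have := le_trans (dax x Wx) e3; move: (nc _) (nc _) yx => t1 t2; lra.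
- move=> theta x y st Wx yx; apply: (d2 theta x y st Wx).
  have Wax : W (a * x) by apply: (d1 x) => //; rewrite subrr nc0 ltW.
  have Wa'x : W (a' * x).
    by apply: (d1 x) => //; apply: (le_trans (le_trans (dax x Wx) e3)); lra.
  have h1 := close (theta, a' * x) (conj st Wa'x).
  have h2 : nc (Phi (theta, a' * x) - Phi (theta, a * x)) <= 8 * M * MW / E * eta.
    have := slice_lipschitz rho_gt0 PhiB PhiM W_open (strip_closed_strip st) E0
      (fun y => d1 x y Wx) (le_trans (dax x Wx) e3).
    rewrite (addrC (a * x)) subrK => h; apply: (le_trans h).
    have -> : 8 * M * MW / E * eta = 4 * M / E * (2 * eta * MW) by ring.
    by rewrite ler_wpM2l ?dax// divr_ge0 ?mulr_ge0// ltW.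
  apply: (le_trans (ncBD (Psi (theta, a' * x)) _ _)).
  have h3 := ncBD (Phi (theta, a' * x)) (Psi (theta, a' * x)) (Phi (theta, a * x)).
  move: (nc _) (nc _) (nc _) (nc _) yx h1 h2 h3 e4 => t1 t2 t3 t4; lra.
Qed.

End Frechet.


(** * Phi does not depend on the angle *)

Section Fibered.
Variables (R : realType) (delta rho : R) (r : nat) (W : set (Cplx R)) (MW : R).
Variable Phi : Cplx R * Cplx R -> Cplx R.
Local Notation C := (Cplx R).
Hypothesis delta_gt0 : 0 < delta.
Hypothesis rho_gt0 : 0 < rho.
Hypothesis W_open : open W.
Hypothesis W_le : forall z, W z -> nc z <= MW.
Hypothesis IW : forall x : R, Idelta delta x -> W x%:CC.
Hypothesis PhiB : inB rho W Phi.
Hypothesis PhiX0 : inX0 delta r (restr Phi).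

Lemma Idelta_small (x : R) : `|x| <= 1 -> Idelta delta x.
Proof.
have := delta_gt0; rewrite ler_norml => d0 /andP[h1 h2].
by rewrite /Idelta /= in_itv/=; apply/andP; split; lra.
Qed.

(** At real arguments Phi is real and equal to its mean over theta. *)
Lemma Phi_real_fibers (t x : R) : Idelta delta x -> Phi (t%:CC, x%:CC) = Phi (0, x%:CC).
Proof.
move=> Ix; have [_ H] := PhiX0; have [_ _ rP _] := PhiB.
have E (s : R) : Phi (s%:CC, x%:CC) = (p0 (restr Phi) x)%:CC.
  by rewrite (Im0E (rP s x (IW Ix))) (H s x Ix).
by rewrite E -(E 0).
Qed.

Lemma cluster_zero_of_real (f : C -> C) (p : C) : Imp p = 0 ->
  (forall t : R, `|t - Rep p| <= 1 -> f t%:CC = 0) ->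
  forall e : R, 0 < e -> exists z, [/\ z != p, nc (z - p) < e & f z = 0].
Proof.
move=> /Im0E pr f0 e e0; pose k := Num.min (e / 2) 1.
have k0 : 0 < k by rewrite lt_min divr_gt0//= ltr01.
have k1 : k <= 1 by rewrite ge_min lexx orbT.
have k2 : k <= e / 2 by rewrite ge_min lexx.
have E : nc ((Rep p + k)%:CC - p : C) = k.
  by rewrite {2}pr -(rmorphB (real_complex R)) addrC addKr nc_real gtr0_norm.
exists ((Rep p + k)%:CC); split.
- by rewrite -subr_eq0 -nc_eq0 E gt_eqF.
- by rewrite E; lra.
- by apply: f0; rewrite addrC addKr gtr0_norm.
Qed.

(** The identity theorem is used in x for real theta, from I_delta to its component,
    and then in theta along the vertical segment from the real axis to theta. *)
Lemma Phi_fibers_component theta x : connected_component W 0 x -> strip rho theta ->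
  Phi (theta, x) = Phi (0, x).
Proof.
move=> Ax st.
have I0 : Idelta delta 0 by apply: Idelta_small; rewrite normr0.
have AW : connected_component W (0 : C) `<=` W by exact: connected_component_sub.
have Wx := AW x Ax; have W0 : W 0 := IW I0.
have A0 : connected_component W (0 : C) 0 by exact: connected_component_refl.
have [M M0 PhiM] := inB_bounded rho_gt0 W_le PhiB.
have st0 : strip rho (0 : C) by exact: (strip_real rho_gt0 0).
have real_theta (t : R) : Phi (t%:CC, x) = Phi (0, x).
  apply/eqP; rewrite -subr_eq0; apply/eqP.
  apply: (identity_theorem (f := fun y => Phi (t%:CC, y) - Phi (0, y)) (M := M + M)
    W_open _ _ (@component_connected _ W 0) AW A0 _ Ax).
  - move=> z Wz; apply: differentiableB.
      exact: (slice_x PhiB (strip_real rho_gt0 t) Wz).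
    exact: (slice_x PhiB st0 Wz).
  - move=> z Wz; apply: ncB_le; first exact: (PhiM (t%:CC, z) (conj (strip_real rho_gt0 t) Wz)).
    exact: (PhiM (0, z) (conj st0 Wz)).
  - apply: cluster_zero_of_real => // s; rewrite subr0 => /Idelta_small Is.
    by rewrite (Phi_real_fibers t Is) subrr.
apply/eqP; rewrite -subr_eq0; apply/eqP.
pose path (s : R) : C := Complex (Rep theta) (s * Imp theta).
pose S := path @` `[0, 1].
have cS : connected S.
  apply: connected_continuous_connected; first exact: segment_connected.
  apply: continuous_subspaceT => s; apply: cvg_Complex; first exact: cvg_cst.
  by apply: cvgM; [exact: cvg_id|exact: cvg_cst].
have S_strip : S `<=` strip rho.
  move=> y [s /=]; rewrite in_itv/= => /andP[s0 s1] <-; rewrite /strip /= normrM ger0_norm//.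
  by apply: le_lt_trans st; rewrite ler_piMl.
apply: (identity_theorem (f := fun y => Phi (y, x) - Phi (0, x)) (M := M + M) (p := path 0)
    (@open_strip R rho) _ _ cS S_strip).
- by move=> z sz; apply: differentiableB; [exact: (slice_theta PhiB sz Wx)|exact: differentiable_cst].
- move=> z sz; apply: ncB_le; first exact: (PhiM (z, x) (conj sz Wx)).
  exact: (PhiM (0, x) (conj st0 Wx)).
- by exists 0 => //=; rewrite in_itv/= lexx ler01.
- by apply: cluster_zero_of_real => [|s _]; rewrite /= ?mul0r// real_theta subrr.
- exists 1; first by rewrite /= in_itv/= lexx ler01.
  by rewrite /path mul1r; case: (theta).
Qed.

Lemma Phi_fibered :
  (forall x : C, W x -> ~ connected_component W 0 x ->
     forall theta : C, strip rho theta -> p0C Phi x = Phi (theta, x)) ->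
  forall x theta, W x -> strip rho theta -> p0C Phi x = Phi (theta, x).
Proof.
move=> other x theta Wx st.
have [Ax|nAx] := pselect (connected_component W 0 x); last exact: other.
rewrite (Phi_fibers_component Ax st) p0CE.
rewrite (@eq_pathint _ 0 1 _ (fun=> Phi (0, x))).
  by rewrite pathint_cst// subr0 mulr1.
by move=> t _; exact: (Phi_fibers_component Ax (strip_real rho_gt0 t)).
Qed.

End Fibered.

(** * Phi belongs to the domain of T *)

Section RealExtensionality.
Variables (R : realType) (delta : R).
Implicit Types (f g : R -> R -> R) (psi phi : R -> R).

(** The real spaces only see the values over I_delta, and T(Phi) = Phi is known over
    I_delta only; hence the extensionality lemmas of this section. *)
Lemma has_derivative_within_ext (A : set R) psi phi x l :
  (forall y, A y -> psi y = phi y) -> A x ->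
  has_derivative_within A psi x l -> has_derivative_within A phi x l.
Proof.
move=> E Ax; rewrite /has_derivative_within; apply: cvg_trans.
apply: near_eq_cvg; apply: filterS (withinT _ _) => y Ay.
by rewrite (E y Ay) (E x Ax).
Qed.

Lemma within_ext (T U : topologicalType) (A : set T) (u v : T -> U) :
  (forall x, A x -> u x = v x) -> {within A, continuous u} -> {within A, continuous v}.
Proof. by move=> E; apply: subspace_eq_continuous => x /set_mem Ax; exact: E. Qed.

Lemma inM_ext psi phi : 0 < delta -> (forall x, Idelta delta x -> psi x = phi x) ->
  inM delta psi -> inM delta phi.
Proof.
move=> d0 E [h1 h2 h3 [dpsi [h4 h5 h6]]].
have IN x : Idelta delta x -> Idelta delta (- x).
  by rewrite /Idelta /= !in_itv/= => /andP[? ?]; apply/andP; split; lra.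
split.
- by move=> x Ix; rewrite -E//; exact: h1.
- by move=> x Ix; rewrite -!E ?h2//; exact: IN.
- by rewrite -E// /Idelta /= in_itv/=; apply/andP; split; lra.
- exists dpsi; split => // x Ix.
  exact: (has_derivative_within_ext E Ix (h4 x Ix)).
Qed.

Lemma class_C_ext k f g : (forall theta x, Idelta delta x -> f theta x = g theta x) ->
  class_C delta k f -> class_C delta k g.
Proof.
move=> E; have cE : {within [set z : R * R | Idelta delta z.2], continuous (fun z => f z.1 z.2)} ->
    {within [set z : R * R | Idelta delta z.2], continuous (fun z => g z.1 z.2)}.
  by apply: within_ext => z; exact: E.
case: k => [|k] [cf hf]; split; try exact: cE; first by [].
have [f1 [f2 [h1 h2 h3 h4]]] := hf; exists f1, f2; split => //.
- move=> theta x Ix.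
  have <- : (fun t => f t x) = (fun t => g t x) by apply/funext => t; exact: E.
  exact: h1.
- move=> theta x Ix; exact: (has_derivative_within_ext (E theta) Ix (h2 theta x Ix)).
Qed.

Lemma p0_ext f g x : (forall theta, f theta x = g theta x) -> p0 f x = p0 g x.
Proof. by move=> E; rewrite /p0; apply: eq_Rintegral => t _; exact: E. Qed.

Lemma inX_ext k f g : 0 < delta -> (forall theta x, Idelta delta x -> f theta x = g theta x) ->
  inX delta k f -> inX delta k g.
Proof.
move=> d0 E [h1 h2 h3 h4]; split.
- by move=> theta x Ix; rewrite -!E//; exact: h1.
- by move=> theta x Ix; rewrite -E//; exact: h2.
- exact: class_C_ext h3.
- by apply: inM_ext h4 => // x Ix; apply: p0_ext => theta; exact: E.
Qed.

(** On a fibered map, T is the one-dimensional renormalization; a fixed point of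
    the latter is thus reproduced by T. *)
Lemma inDT_fixed_point k omega f : 0 < delta -> inX0 delta k f ->
  renorm_fixed_point delta (p0 f) -> inDT delta k omega f.
Proof.
move=> d0 [fX f0] [[pM a_lt0 /andP[ab b1] _] fix_p].
set a := p0 f 1 in a_lt0 ab b1.
have aI x : Idelta delta x -> Idelta delta (a * x).
  rewrite /Idelta /= !in_itv/= => /andP[h1 h2].
  have h3 : - ((1 + delta) * a) < 1 by lra.
  by apply/andP; split; nra.
split => //; first by rewrite lt_eqF.
apply: (inX_ext d0 _ fX) => theta x Ix.
have [pI _ _ _] := pM.
rewrite /T_real -/a -(f0 theta _ (aI x Ix)) -(f0 _ _ (pI _ (aI x Ix))).
by rewrite -(f0 theta x Ix) -(fix_p x Ix).
Qed.

End RealExtensionality.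

Theorem theorem2p15 (R : realType) (delta rho : R) (r : nat)
  (W : set (Cplx R)) (Phi : Cplx R * Cplx R -> Cplx R) (omega : R)
  (delta_gt0 : 0 < delta) (rho_gt0 : 0 < rho) (r_ge1 : (1 <= r)%N)
  (W_open : open W) (W_bounded : bounded_set W)
  (IW : forall x : R, Idelta delta x -> W x%:CC)
  (PhiB : inB rho W Phi)
  (PhiX0 : inX0 delta r (restr Phi))
  (* p_0(Phi) = Phi on the components of W disjoint from I_delta (vacuous if W
     is connected); on the component of I_delta it follows from PhiX0 *)
  (Phi_other : forall x : Cplx R, W x -> ~ connected_component W 0 x ->
     forall theta : Cplx R, strip rho theta -> p0C Phi x = Phi (theta, x))
  (Phi_fixed : renorm_fixed_point delta (p0 (restr Phi)))
  (aW : closure [set p0C Phi 1 * x | x in W] `<=` W)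
  (PhiaW : closure [set p0C Phi (p0C Phi 1 * x) | x in W] `<=` W) :
  exists U : set (Cplx R * Cplx R -> Cplx R),
    [/\ forall Psi, U Psi -> inB rho W Psi /\ inDT delta r omega (restr Psi),
        U Phi,
        (* U is open in the topology of D(T) /\ B induced by B *)
        forall Psi, U Psi -> exists2 eta : R, 0 < eta &
          forall g, inB rho W g -> inDT delta r omega (restr g) ->
            (normB rho W (fun z => g z - Psi z)%R < eta%:E)%E -> U g,
        forall Psi, U Psi -> T_defined rho W omega Psi &
        forall Psi, U Psi ->
          frechet_derivative_T rho W omega Psi (DT omega Psi)].
Proof.
have [MW MW0 W_le] := bounded_ncP W_bounded.
have W1 : W 1 by apply: (IW 1); apply: Idelta_small; rewrite ?normr1.
have fibered := Phi_fibered delta_gt0 rho_gt0 W_open W_le IW PhiB PhiX0 Phi_other.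
have [e1 e10 he1] := uniform_margin W_open aW W_le.
have [e2 e20 he2] := uniform_margin W_open PhiaW W_le.
(* e1 keeps a x inside W, e2 keeps Phi(theta, a x) inside W. *)
pose E := Num.min e1 e2.
have E0 : 0 < E by rewrite lt_min e10.
have E1 : E <= e1 by rewrite ge_min lexx.
have E2 : E <= e2 by rewrite ge_min lexx orbT.
have Phi_margin : margin rho W Phi E.
  split.
  - apply/eqP => a0; have [[_ a_lt0 _ _] _] := Phi_fixed.
    have : p0 (restr Phi) 1 = Rep (p0C Phi 1) by [].
    by rewrite a0 => h; rewrite h ltxx in a_lt0.
  - by move=> x y Wx yx; apply: (he1 (p0C Phi 1 * x)); [exists x|exact: le_trans yx E1].
  - move=> theta x y st Wx yx; apply: (he2 (p0C Phi (p0C Phi 1 * x))); first by exists x.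
    rewrite (fibered _ theta _ st); first exact: le_trans yx E2.
    apply: (he1 (p0C Phi 1 * x)); first by exists x.
    by rewrite subrr nc0 ltW.
have [eta0 eta00 stable] := margin_stable rho_gt0 W_open W_le W1 E0 PhiB Phi_margin.
have E20 : 0 < E / 2 by rewrite divr_gt0.
have near_margin Psi : inB rho W Psi -> (normB rho W (fun z => Psi z - Phi z)%R < eta0%:E)%E ->
    margin rho W Psi (E / 2).
  move=> PsiB close; apply: stable => // z Dz.
  by have := le_trans (normB_ub (fun z => Psi z - Phi z) Dz) (ltW close); rewrite lee_fin.
have normB_triangle (f g h : Cplx R * Cplx R -> Cplx R) (s t : R) :
    (normB rho W (fun z => f z - g z)%R < s%:E)%E ->
    (normB rho W (fun z => g z - h z)%R = t%:E)%E ->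
    (normB rho W (fun z => f z - h z)%R < (s + t)%:E)%E.
  move=> fg gh; have [N [_ EN hN]] := normB_fin rho_gt0 W1 (ltW fg).
  apply: (@le_lt_trans _ _ (N + t)%:E); last first.
    by move: fg; rewrite EN !lte_fin ltrD2r.
  apply: normB_le => z Dz; apply: (le_trans (ncBD (g z) _ _)).
  rewrite lerD ?hN//.
  by have := normB_ub (fun z => g z - h z) Dz; rewrite gh lee_fin.
exists [set Psi | [/\ inB rho W Psi, inDT delta r omega (restr Psi) &
  (normB rho W (fun z => Psi z - Phi z)%R < eta0%:E)%E]].
split.
- by move=> Psi [].
- split => //; first exact: inDT_fixed_point.
  apply: (@le_lt_trans _ _ 0%:E); last by rewrite lte_fin.
  by apply: normB_le => z _; rewrite subrr nc0.
- move=> Psi [PsiB PsiD close].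
  have [N [_ EN _]] := normB_fin rho_gt0 W1 (ltW close).
  exists (eta0 - N); first by rewrite subr_gt0 -lte_fin -EN.
  move=> g gB gD gPsi; split => //.
  by have := normB_triangle _ _ _ _ _ gPsi EN; rewrite subrK.
- move=> Psi [PsiB PsiD close].
  exact: (margin_T_defined omega rho_gt0 W1 E20 PsiB (near_margin _ PsiB close)).
- move=> Psi [PsiB PsiD close].
  have [N [_ EN _]] := normB_fin rho_gt0 W1 (ltW close).
  have eta10 : 0 < eta0 - N by rewrite subr_gt0 -lte_fin -EN.
  apply: (T_frechet rho_gt0 W_open W_le W1 E20 PsiB (near_margin _ PsiB close) eta10).
  move=> h hB hsmall; have sB := inBD PsiB hB.
  apply: (margin_T_defined omega rho_gt0 W1 E20 sB); apply: near_margin => //.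
  have hPsi : (normB rho W (fun z => (Psi + h) z - Psi z)%R < (eta0 - N)%:E)%E.
    have -> // : (fun z => (Psi + h) z - Psi z) = h.
    by apply/funext => z; rewrite fctE addrC addKr.
  by have := normB_triangle _ _ _ _ _ hPsi EN; rewrite subrK.
Qed.
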